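(* Consider $N$ fully actuated Euler-Lagrange agents $M_i(q_i)\ddot q_i+C_i(q_i,\dot q_i)\dot q_i+g_i(q_i)=f_i$, $q_i\in\mathbb{R}^n$, $i=1,\dots,N$, with unbounded actuation, controlled using position measurements only by $$f_i=-c_i\sum_{j\in\mathcal{N}_i(0)}\nabla_i\psi(\|q_{ij}\|)-\kappa_i\dot{\hat q}_i+g_i(q_i),\qquad \dot{\hat q}_i=-\hat q_i+\kappa_iq_i,\qquad \hat q_i(0)=\kappa_iq_i(0),$$ with constants $c_i,\kappa_i>0$ and a generalized potential $\psi,\Psi,\Psi_{max}$ as in the context. Suppose the initial communication graph is undirected and connected, that there is $\epsilon>0$ with $\|q_{ij}(0)\|\le r-\epsilon$ for all $(i,j)\in\mathcal{E}(0)$, and that $\Psi(q(0))<\Psi_{max}$; the initial velocities $\dot q_i(0)$ are arbitrary. Then: (a) if $\Psi_{max}=\infty$, for all $c_i,\kappa_i>0$, (b) if $\Psi_{max}<\infty$, for all $\kappa_i>0$ and all sufficiently large $c_i$ (depending on the initial state), the closed loop achieves connectivity-preserving consensus: $\|q_i(t)-q_j(t)\|<r$ for all $t\ge0$ and $(i,j)\in\mathcal{E}(0)$, and $q_i(t)-q_j(t)\to0$ as $t\to\infty$ for all $i,j$.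
   Context: All agents have communication radius $r>0$; $\mathcal{E}(0)$ is the initial edge set and $\mathcal{N}_i(0)=\{j:(i,j)\in\mathcal{E}(0)\}$. Put $q_{ij}=q_j-q_i$; $\nabla_i$ is the gradient with respect to $q_i$. Euler-Lagrange dynamics: $M_i$ (inertia), $C_i$ (Coriolis/centrifugal), $g_i$ (gravity) are smooth functions with P1. $M_i(q_i)$ symmetric and $0\prec\lambda_{i1}I\preceq M_i(q_i)\preceq\lambda_{i2}I$ for constants $\lambda_{i1},\lambda_{i2}>0$; P2. $\dot M_i(q_i)-2C_i(q_i,\dot q_i)$ skew-symmetric; P3. there is a constant $\bar c_i>0$ with $\|C_i(q_i,\dot q_i)y\|\le \bar c_i\|\dot q_i\|\|y\|$ for all $q_i,\dot q_i,y$. Generalized potential: $\Psi(q)=\frac12\sum_{i=1}^N\sum_{j\in\mathcal{N}_i(0)}\psi(\|q_{ij}\|)$, where $\psi:[0,r]\to[0,+\infty]$ is continuous, finite on $[0,r)$, and 1. $\psi(s)=0\Leftrightarrow s=0$; 2. as a function of $s^2$, $\psi$ is twice continuously differentiable on $[0,r)$ with positive first derivative; 3. there is $\Psi_{max}\in(0,+\infty]$, not necessarily finite, with $\Psi(q)\ge\Psi_{max}$ whenever $\|q_{ij}\|\le r$ for all $(i,j)\in\mathcal{E}(0)$ and $\|q_{ij}\|=r$ for some $(i,j)\in\mathcal{E}(0)$. *)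

(* Defs.v *)
From mathcomp Require Import all_boot all_order all_algebra.
From mathcomp Require Import all_classical all_reals all_analysis.

Set Implicit Arguments.
Unset Strict Implicit.
Unset Printing Implicit Defensive.

Import Order.TTheory GRing.Theory Num.Theory.
Import numFieldNormedType.Exports.

Local Open Scope ring_scope.
Local Open Scope classical_set_scope.

(* The library norm `|x| on matrices is the sup norm, so the Euclidean norm is
   needed separately (both induce the same topology and the same derivatives). *)
Definition enorm (R : realType) (n : nat) (x : 'cV[R]_n) : R :=
  Num.sqrt (\sum_(k < n) x k 0 ^+ 2).

Definition loewner_le (R : realType) (n : nat) (A B : 'M[R]_n) : Prop :=
  forall y : 'cV[R]_n, (y^T *m A *m y) 0 0 <= (y^T *m B *m y) 0 0.

Definition gradient (R : realType) (n : nat) (f : 'cV[R]_n -> R)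
    (x : 'cV[R]_n) : 'cV[R]_n :=
  \col_(k < n) 'D_(delta_mx k 0 : 'cV[R]_n) f x.

(* C^oo: every iterated directional derivative, including f itself, exists and
   is differentiable everywhere. *)
Definition smooth (R : realType) (U V : normedModType R) (f : U -> V) : Prop :=
  forall (us : seq U) (x : U),
    differentiable (foldr (fun u (g : U -> V) => 'D_u g) f us) x.

(* Derivative of f at x relative to D; one-sided if x is an endpoint of D. *)
Definition deriv_within (R : realType) (V : normedModType R) (D : set R)
    (f : R -> V) (x : R) (l : V) : Prop :=
  (y - x)^-1 *: (f y - f x) @[y --> within D x^'] --> l.

Record euler_lagrange (R : realType) (n : nat) := EulerLagrange {
  inertia : 'cV[R]_n -> 'M[R]_n;
  coriolis : 'cV[R]_n -> 'cV[R]_n -> 'M[R]_n;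
  gravity : 'cV[R]_n -> 'cV[R]_n }.

(* In el_skew, the time derivative of M(q) is the derivative of M at the
   position q in the direction of the velocity v. *)
Record el_properties (R : realType) (n : nat) (S : euler_lagrange R n) : Prop :=
  ELProperties {
  el_smooth_inertia : smooth (inertia S);
  el_smooth_coriolis :
    smooth (fun x : ('cV[R]_n * 'cV[R]_n)%type => coriolis S x.1 x.2);
  el_smooth_gravity : smooth (gravity S);
  el_sym : forall q, (inertia S q)^T = inertia S q;
  el_bounds : exists l1 l2 : R, [/\ 0 < l1, 0 < l2 &
    forall q, loewner_le l1%:M (inertia S q) /\ loewner_le (inertia S q) l2%:M];
  el_skew : forall q v : 'cV[R]_n,
    let X := 'D_v (inertia S) q - 2 *: coriolis S q v in X^T = - X;
  el_coriolis_bound : exists2 cbar : R, 0 < cbar &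
    forall q v y : 'cV[R]_n,
      enorm (coriolis S q v *m y) <= cbar * enorm v * enorm y }.

Definition undirected (N : nat) (E : rel 'I_N) : Prop :=
  symmetric E /\ irreflexive E.

Definition graph_connected (N : nat) (E : rel 'I_N) : Prop :=
  forall i j : 'I_N, connect E i j.

Definition total_potential (R : realType) (N n : nat) (E : rel 'I_N)
    (psi : R -> \bar R) (q : 'I_N -> 'cV[R]_n) : \bar R :=
  ((2^-1 : R)%:E * \sum_(i < N) \sum_(j < N | E i j) psi (enorm (q j - q i)))%E.

(* psi as a function of the squared distance. *)
Definition psi_sq (R : realType) (psi : R -> \bar R) (u : R) : R :=
  fine (psi (Num.sqrt u)).

(* psi is only relevant on [0, r]; its values elsewhere are arbitrary. *)
Record generalized_potential (R : realType) (N n : nat) (E : rel 'I_N) (r : R)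
    (psi : R -> \bar R) (Psimax : \bar R) : Prop := GeneralizedPotential {
  gp_ge0 : forall s : R, 0 <= s <= r -> (0 <= psi s)%E;
  gp_continuous : {within `[0, r], continuous psi};
  gp_finite : forall s : R, 0 <= s < r -> (psi s < +oo)%E;
  gp_eq0 : forall s : R, 0 <= s <= r -> (psi s = 0%E <-> s = 0);
  gp_C2 : exists d1 d2 : R -> R,
    [/\ forall u : R, 0 <= u < r ^+ 2 ->
          deriv_within `[0, r ^+ 2[ (psi_sq psi : R -> R^o) u (d1 u),
        forall u : R, 0 <= u < r ^+ 2 ->
          deriv_within `[0, r ^+ 2[ (d1 : R -> R^o) u (d2 u),
        {within `[0, r ^+ 2[, continuous d2} &
        forall u : R, 0 <= u < r ^+ 2 -> 0 < d1 u];
  gp_max_gt0 : (0 < Psimax)%E;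
  gp_max : forall q : 'I_N -> 'cV[R]_n,
    (forall i j, E i j -> enorm (q j - q i) <= r) ->
    (exists i j, E i j /\ enorm (q j - q i) = r) ->
    (Psimax <= total_potential E psi q)%E }.

Section ClosedLoop.
Variables (R : realType) (N n : nat) (r : R) (E : rel 'I_N).
Variables (S : 'I_N -> euler_lagrange R n) (psi : R -> \bar R).
Variables (c kappa : 'I_N -> R) (q0 v0 : 'I_N -> 'cV[R]_n).

Definition links_kept (q : 'I_N -> 'cV[R]_n) : Prop :=
  forall i j, E i j -> enorm (q i - q j) < r.

(* Configuration q, derivative dz of agent i's filter state. *)
Definition control (q : 'I_N -> 'cV[R]_n) (i : 'I_N) (dz : 'cV[R]_n) :
    'cV[R]_n :=
  - (c i *: \sum_(j < N | E i j)
       gradient (fun x => fine (psi (enorm (q j - x)))) (q i))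
  - kappa i *: dz + gravity (S i) (q i).

Record trajectory := Trajectory {
  pos : R -> 'I_N -> 'cV[R]_n;
  vel : R -> 'I_N -> 'cV[R]_n;
  filt : R -> 'I_N -> 'cV[R]_n }.

Definition agent_dynamics (x : trajectory) (t : R) (i : 'I_N) : Prop :=
  exists a dz : 'cV[R]_n,
    [/\ deriv_within `[0, +oo[ (pos x ^~ i) t (vel x t i),
        deriv_within `[0, +oo[ (vel x ^~ i) t a,
        deriv_within `[0, +oo[ (filt x ^~ i) t dz,
        inertia (S i) (pos x t i) *m a
          + coriolis (S i) (pos x t i) (vel x t i) *m vel x t i
          + gravity (S i) (pos x t i) = control (pos x t) i dz &
        dz = - filt x t i + kappa i *: pos x t i].

(* Closed-loop trajectory on [0, T), T possibly +oo.  The control law makes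
   sense only while all initial links are shorter than r (psi need not be
   differentiable, nor finite, at r), so the equations are imposed up to the
   first loss of a link; that no link is ever lost is not part of the
   definition. *)
Definition closed_loop_on (T : \bar R) (x : trajectory) : Prop :=
  [/\ forall i, [/\ pos x 0 i = q0 i, vel x 0 i = v0 i &
                    filt x 0 i = kappa i *: q0 i],
      forall i, {within [set t : R | 0 <= t /\ (t%:E < T)%E],
                   continuous (pos x ^~ i)} &
      forall t : R, 0 <= t -> (t%:E < T)%E ->
        (forall s : R, 0 <= s <= t -> links_kept (pos x s)) ->
        forall i, agent_dynamics x t i].

Definition extends (T : \bar R) (y x : trajectory) : Prop :=
  forall (t : R) i, 0 <= t -> (t%:E < T)%E ->
    [/\ pos y t i = pos x t i, vel y t i = vel x t i & filt y t i = filt x t i].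

(* The first two clauses give global existence: the closed loop has a trajectory
   on [0, +oo), and no trajectory stops at a finite time. *)
Definition connectivity_preserving_consensus : Prop :=
  [/\ exists x, closed_loop_on +oo%E x,
      forall (T : \bar R) x, (0 < T)%E -> closed_loop_on T x ->
        exists2 y, closed_loop_on +oo%E y & extends T y x &
      forall x, closed_loop_on +oo%E x ->
        (forall t : R, 0 <= t -> links_kept (pos x t)) /\
        (forall i j, pos x t i - pos x t j @[t --> +oo] --> (0 : 'cV[R]_n))].

End ClosedLoop.

(* Main.v *)
Require Import Defs.
From mathcomp Require Import all_boot all_order all_algebra.
From mathcomp Require Import all_classical all_reals all_analysis.
From mathcomp Require Import lra ring.

(** The energy
      V = sum_i (v_i . M_i(q_i) v_i + |w_i|^2) / (2 c_i) + Psi(q),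
    where w_i is the derivative of the filter state of agent i, satisfies
    V' = - sum_i |w_i|^2 / c_i along the closed loop: the gravity compensation
    removes g_i, the Coriolis terms cancel by skew symmetry, and the coupling
    forces and the filters exchange energy with the agents.  The filters start
    with w_i = 0, so V(0) is Psi(q(0)) plus the initial kinetic energies
    divided by the gains c_i.  It is below Psimax, either because Psimax is
    infinite or because the gains are large.

    Links.  As long as all links are shorter than r, Psi(q(t)) <= V(0).  By
    [link_margin] a configuration whose potential is at most V(0) < Psimax and
    whose links are shorter than r has all its links at most rho, for some
    rho < r that depends only on V(0).  If psi(r) is infinite, this holds
    because each link contributes to the potential; if psi(r) is finite, then
    scaling the configuration so that its longest link gets length r would
    otherwise reach Psimax with hardly any increase of the potential.  By continuity ([links_bootstrap]) no link ever
    exceeds rho.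

    Existence and uniqueness.  Freezing the derivative of the potential beyond
    a squared distance slightly larger than rho^2 makes the closed loop an
    equation x' = F x with F locally Lipschitz; the solutions of interest never
    see the change.  The energy bounds the velocities, hence everything on
    bounded time intervals, so that Picard iteration for F clamped to a large
    box yields a global solution ([locally_lipschitz_global_solution]), and a
    Gronwall argument yields uniqueness ([solves_unique]).  In particular every
    trajectory on [0, T[ is a restriction of the global one.

    Convergence.  Lemma [barbalat] is applied three times: if f converges and
    f' = g + h, where g is Lipschitz and h vanishes at infinity, then g
    vanishes.  With f = V the filter rates w_i vanish; with f = w_i and
    w_i' = - w_i + kappa_i v_i the velocities vanish; with f = M_i(q_i) v_i the
    gradients of the potential vanish.  The last step uses that M_i' is the sum
    of the Coriolis matrix and its transpose, so that no bound on the
    positions, which may drift, is needed.  Pairing the gradients with the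
    offsets from one fixed agent shows that the links shrink to 0, and the
    graph is connected. *)

Set Implicit Arguments.
Unset Strict Implicit.
Unset Printing Implicit Defensive.

Import Order.TTheory GRing.Theory Num.Theory.
Import numFieldNormedType.Exports.

Local Open Scope ring_scope.
Local Open Scope classical_set_scope.

(** * Differentiation and antiderivatives on the real line *)

Section RealCalculus.
Context {R : realType}.
Implicit Types (f g : R -> R) (a b t x K M : R).

Lemma lipschitz_continuous f K :
  (forall s t, `|f s - f t| <= K * `|s - t|) -> continuous f.
Proof.
move=> fK x; apply/cvgrPdist_le => e e0.
have K1 : 0 < `|K| + 1 by rewrite ltr_wpDl.
near=> y; apply: (le_trans (fK _ _)).
apply: (@le_trans _ _ ((`|K| + 1) * `|x - y|)).
  by rewrite ler_wpM2r// (le_trans (ler_norm _))// lerDl.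
rewrite mulrC -ler_pdivlMr//.
near: y; apply: cvgr_dist_le => //; exact: divr_gt0.
Unshelve. all: by end_near. Qed.

(** Differentiation rules stated for functions given pointwise. *)
Lemma is_derive_add f g x a b : is_derive x 1 f a -> is_derive x 1 g b ->
  is_derive x 1 (fun y => f y + g y) (a + b).
Proof. by move=> ? ?; exact: is_deriveD. Qed.

Lemma is_derive_opp f x a : is_derive x 1 f a ->
  is_derive x 1 (fun y => - f y) (- a).
Proof. by move=> ?; exact: is_deriveN. Qed.

Lemma is_derive_sub f g x a b : is_derive x 1 f a -> is_derive x 1 g b ->
  is_derive x 1 (fun y => f y - g y) (a - b).
Proof. by move=> ? ?; exact: is_deriveB. Qed.

Lemma is_derive_mul f g x a b : is_derive x 1 f a -> is_derive x 1 g b ->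
  is_derive x 1 (fun y => f y * g y) (a * g x + f x * b).
Proof.
move=> df dg; have -> : a * g x + f x * b = f x *: b + g x *: a.
  by rewrite /GRing.scale/= addrC (mulrC (g x)).
exact: is_deriveM.
Qed.

Lemma is_derive_scale f x (k a : R) : is_derive x 1 f a ->
  is_derive x 1 (fun y => k * f y) (k * a).
Proof. by move=> ?; exact: (@is_deriveZ _ _ _ f k). Qed.

Lemma is_derive_bigsum (J : finType) (P : pred J) (h : J -> R -> R)
    (h' : J -> R) x :
  (forall j, P j -> is_derive x 1 (h j) (h' j)) ->
  is_derive x 1 (fun y => \sum_(j | P j) h j y) (\sum_(j | P j) h' j).
Proof.
move=> dh.
have -> : (fun y => \sum_(j | P j) h j y) = \sum_(j | P j) h j.
  by apply/funext => y; rewrite fct_sumE.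
elim/big_ind2 : _ => //.
  exact: (is_derive_cst 0).
by move=> u u' v v' ? ?; exact: is_deriveD.
Qed.

Lemma continuous_bigsum (T : topologicalType) (J : finType) (P : pred J)
    (h : J -> T -> R) (x : T) :
  (forall j, P j -> {for x, continuous (h j)}) ->
  {for x, continuous (fun y => \sum_(j | P j) h j y)}.
Proof.
move=> ch.
have -> : (fun y => \sum_(j | P j) h j y) = \sum_(j | P j) h j.
  by apply/funext => y; rewrite fct_sumE.
elim/big_ind : _ => //; first exact: cst_continuous.
by move=> u v cu cv; exact: continuousD.
Qed.

Lemma derive_incr f f' a b : a <= b ->
  (forall x, a <= x <= b -> {for x, continuous f}) ->
  (forall x, a < x < b -> is_derive x 1 f (f' x)) ->
  (forall x, a < x < b -> 0 <= f' x) -> f a <= f b.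
Proof.
move=> ab cf df f'0; move: ab; rewrite le_eqVlt => /orP[/eqP->//|ab].
have [|c] := @MVT _ f f' a b ab.
- apply: continuous_in_subspaceT => x; rewrite inE/= in_itv/=; exact: cf.
- rewrite in_itv/= => cab fba; rewrite -subr_ge0 fba mulr_ge0 ?f'0//.
  by rewrite subr_ge0 ltW.
Qed.

Lemma derive_bound f f' a b M : a <= b ->
  (forall x, a <= x <= b -> {for x, continuous f}) ->
  (forall x, a < x < b -> is_derive x 1 f (f' x)) ->
  (forall x, a < x < b -> `|f' x| <= M) -> `|f b - f a| <= M * (b - a).
Proof.
move=> ab cf df f'0; move: ab; rewrite le_eqVlt => /orP[/eqP->|ab].
  by rewrite !subrr normr0 mulr0.
have [|c] := @MVT _ f f' a b ab.
- apply: continuous_in_subspaceT => x; rewrite inE/= in_itv/=; exact: cf.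
- rewrite in_itv/= => cab fba; rewrite fba normrM (@gtr0_norm _ (b - a)) ?subr_gt0//.
  by rewrite ler_wpM2r ?f'0// subr_ge0 ltW.
Qed.

(** Comparison of a function with a majorant of its derivative. *)
Lemma derive_bound_by f f' g g' a b : a <= b ->
  (forall x, a <= x <= b -> {for x, continuous f}) ->
  (forall x, a <= x <= b -> {for x, continuous g}) ->
  (forall x, a < x < b -> is_derive x 1 f (f' x)) ->
  (forall x, a < x < b -> is_derive x 1 g (g' x)) ->
  (forall x, a < x < b -> `|f' x| <= g' x) -> `|f b - f a| <= g b - g a.
Proof.
move=> ab cf cg df dg fg; rewrite ler_norml; apply/andP; split.
- have : (f + g) a <= (f + g) b.
    apply: (@derive_incr _ (fun x => f' x + g' x)) => // x xab.
    + by apply: continuousD; [exact: cf|exact: cg].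
    + by apply: is_deriveD; [exact: df|exact: dg].
    + by have := fg x xab; rewrite ler_norml => /andP[? ?] /=; lra.
  rewrite /= !fctE; lra.
- have : (g - f) a <= (g - f) b.
    apply: (@derive_incr _ (fun x => g' x - f' x)) => // x xab.
    + by apply: continuousB; [exact: cg|exact: cf].
    + by apply: is_deriveB; [exact: dg|exact: df].
    + by have := fg x xab; rewrite ler_norml => /andP[? ?] /=; lra.
  rewrite /= !fctE; lra.
Qed.

Let mu := @lebesgue_measure R.

(** An antiderivative on ]-1, +oo[ that vanishes at 0; starting the integral at
    -1 makes 0 an interior point. *)
Definition antiderivative f t : R :=
  (\int[mu]_(s in `[-1, t]) f s - \int[mu]_(s in `[-1, 0]) f s)%R.

Lemma antiderivative0 f : antiderivative f 0 = 0.
Proof. by rewrite /antiderivative subrr. Qed.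

Lemma is_derive_antiderivative f t : continuous f -> -1 < t ->
  is_derive t 1 (antiderivative f) (f t).
Proof.
move=> cf t1.
have [||||dF F'] := @continuous_FTC1_closed _ f (-1) t (t + 1).
- by rewrite ltrDl.
- apply: continuous_compact_integrable; first exact: segment_compact.
  exact: continuous_subspaceT.
- exact: t1.
- exact: cf.
have H : is_derive t 1 (fun x => \int[mu]_(s in `[-1, x]) f s)%R (f t).
  by split => //; rewrite -F' derive1E.
have := is_deriveB H (is_derive_cst (\int[mu]_(s in `[-1, 0]) f s)%R t 1).
by rewrite subr0.
Qed.

Lemma is_derive_continuous f t l : is_derive t 1 f l -> {for t, continuous f}.
Proof.
by move=> [d _]; apply: differentiable_continuous; apply/derivable1_diffP.
Qed.

(** A sequence with geometrically decaying increments converges, with an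
    explicit rate. *)
Lemma geometric_limit (u : nat -> R) (D : R) :
  (forall k, `|u k.+1 - u k| <= D / 2 ^+ k) ->
  exists l, forall k, `|l - u k| <= 2 * D / 2 ^+ k.
Proof.
move=> uD.
have e2 k : 0 < 2 ^- k :> R by rewrite invr_gt0 exprn_gt0.
have D0 : 0 <= D by have := le_trans (normr_ge0 _) (uD 0%N); rewrite expr0 divr1.
pose lo k := u k - 2 * D / 2 ^+ k; pose hi k := u k + 2 * D / 2 ^+ k.
have half k : 2 ^- k.+1 = 2 ^- k / 2 :> R by rewrite exprS invfM mulrC.
have los k : lo k <= lo k.+1.
  have := uD k; rewrite /lo ler_norml half.
  have := mulr_ge0 D0 (ltW (e2 k)); lra.
have his k : hi k.+1 <= hi k.
  have := uD k; rewrite /hi ler_norml half.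
  have := mulr_ge0 D0 (ltW (e2 k)); lra.
have lomono m d : lo m <= lo (m + d)%N.
  by elim: d => [|d IH]; rewrite ?addn0// addnS (le_trans IH).
have himono m d : hi (m + d)%N <= hi m.
  by elim: d => [|d IH]; rewrite ?addn0// addnS (le_trans _ IH).
have lohi m k : lo m <= hi k.
  have le0 j : lo j <= hi j.
    by rewrite /lo /hi; have := mulr_ge0 D0 (ltW (e2 j)); lra.
  case: (leqP m k) => mk.
    by rewrite -(subnKC mk) in le0 *; rewrite (le_trans (lomono m (k - m)%N)).
  have km := ltnW mk; rewrite -(subnKC km).
  by apply: (le_trans (le0 _)); exact: himono.
pose A : set R := range lo.
have A0 : A !=set0 by exists (lo 0%N), 0%N.
exists (sup A) => k; rewrite ler_norml; apply/andP; split.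
  have : lo k <= sup A.
    apply: ub_le_sup; last by exists k.
    by exists (hi 0%N) => _ [m _ <-].
  by rewrite /lo; lra.
have : sup A <= hi k by apply: ge_sup => // _ [m _ <-].
by rewrite /hi; lra.
Qed.

End RealCalculus.

(** * Picard iteration *)

Section Picard.
Context {R : realType} {I : finType}.
Implicit Types (x y : I -> R) (F : (I -> R) -> I -> R).

(** Lipschitz estimate for the supremum distance, on the box of radius B. *)
Definition lipschitz_box F (B L : R) : Prop :=
  forall x y (d : R), (forall j, `|x j| <= B) -> (forall j, `|y j| <= B) ->
    (forall j, `|x j - y j| <= d) -> forall i, `|F x i - F y i| <= L * d.

(** x solves x' = F x on ]0, T[, and is continuous on [0, T[; the values of x
    at negative times play no role beyond continuity at 0. *)
Definition solves F (T : R) (x : R -> I -> R) : Prop :=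
  (forall (t : R) i, 0 <= t < T -> {for t, continuous (x ^~ i)}) /\
  (forall (t : R) i, 0 < t < T -> is_derive t 1 (x ^~ i) (F (x t) i)).

Lemma solves_le F T T' (x : R -> I -> R) : T' <= T -> solves F T x -> solves F T' x.
Proof.
move=> TT [c d]; split=> t i /andP[t0 tT].
  by apply: c; rewrite t0 (lt_le_trans tT).
by apply: d; rewrite t0 (lt_le_trans tT).
Qed.

(** Global existence for a bounded and globally Lipschitz right-hand side. *)
Section GlobalPicard.
Variables (F : (I -> R) -> I -> R) (L M : R) (x0 : I -> R).
Hypothesis L0 : 0 < L.
Hypothesis FL : forall x y (d : R), (forall j, `|x j - y j| <= d) ->
  forall i, `|F x i - F y i| <= L * d.
Hypothesis FM : forall x i, `|F x i| <= M.

Let M0 : I -> 0 <= M. Proof. by move=> i; exact: le_trans (FM x0 i). Qed.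

(** Picard iterates; only their values at nonnegative times matter, and each
    iterate is computed from the previous one restricted to these times and
    continued by its value at 0. *)
Fixpoint picard (k : nat) : R -> I -> R :=
  if k is k'.+1 then
    fun t i => x0 i + antiderivative (fun s : R => F (picard k' (Num.max s 0)) i) t
  else fun _ => x0.

Let max_lip (s t : R) : `|Num.max s 0 - Num.max t 0| <= `|s - t|.
Proof.
rewrite !maxEle; case: (lerP s 0) => s0; case: (lerP t 0) => t0.
- by rewrite subrr normr0.
- by rewrite sub0r normrN gtr0_norm// distrC gtr0_norm; lra.
- by rewrite subr0 gtr0_norm// gtr0_norm; lra.
- by [].
Qed.

Let lip_past (u : R -> I -> R) :
  (forall i (s t : R), 0 <= s -> 0 <= t -> `|u s i - u t i| <= M * `|s - t|) ->
  forall i : I, continuous (fun s : R => F (u (Num.max s 0)) i).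
Proof.
move=> uM i; apply: (@lipschitz_continuous _ _ (L * M)) => s t; rewrite -mulrA.
apply: FL => j; apply: (le_trans (uM _ _ _ _ _)); rewrite ?le_max ?lexx ?orbT//.
by rewrite ler_wpM2l// M0.
Qed.

Let antider_lip (f : R -> R) (i : I) : continuous f -> (forall t, `|f t| <= M) ->
  forall s t : R, 0 <= s -> 0 <= t ->
  `|(x0 i + antiderivative f s) - (x0 i + antiderivative f t)| <= M * `|s - t|.
Proof.
move=> cf fM.
have H (s t : R) : 0 <= s -> s <= t ->
  `|antiderivative f t - antiderivative f s| <= M * (t - s).
  move=> s0 st; apply: (@derive_bound _ _ f) => // x /andP[sx xt].
    apply: is_derive_continuous; apply: is_derive_antiderivative => //; lra.
  by apply: is_derive_antiderivative => //; lra.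
move=> s t s0 t0; rewrite opprD addrACA subrr add0r; case: (lerP s t) => st.
  by rewrite distrC H.
by rewrite H// ltW.
Qed.

Let picard_lip k (i : I) (s t : R) : 0 <= s -> 0 <= t ->
  `|picard k s i - picard k t i| <= M * `|s - t|.
Proof.
elim: k i s t => [|k IH] i s t s0 t0 /=.
  by rewrite subrr normr0 mulr_ge0// M0.
by apply: antider_lip => //; exact: lip_past.
Qed.

(** In the distance weighted by the inverse of this exponential, the Picard
    operator is a contraction of ratio 1/2. *)
Let weight (t : R) := expR (2 * L * t).

Let weight_gt0 t : 0 < weight t. Proof. exact: expR_gt0. Qed.

Let weight_der (C t : R) : is_derive t 1 (fun s => C * weight s) (C * (2 * L) * weight t).
Proof.
rewrite -mulrA; apply: is_derive_scale.
have -> : 2 * L * weight t = weight t * (2 * L * 1) by ring.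
exact: (@is_derive1_comp _ expR (fun s => 2 * L * s)).
Qed.

Let contract (u v : R -> I -> R) (C : R) :
  (forall i (s t : R), 0 <= s -> 0 <= t -> `|u s i - u t i| <= M * `|s - t|) ->
  (forall i (s t : R), 0 <= s -> 0 <= t -> `|v s i - v t i| <= M * `|s - t|) ->
  0 <= C ->
  (forall (t : R) i, 0 <= t -> `|u t i - v t i| <= C * weight t) ->
  forall (t : R) i, 0 <= t ->
  `|antiderivative (fun s : R => F (u (Num.max s 0)) i) t -
    antiderivative (fun s : R => F (v (Num.max s 0)) i) t| <= C / 2 * weight t.
Proof.
move=> uM vM C0 uv t i t0.
set f := fun s => _; set g := fun s : R => F (v _) i.
have cf : continuous f by exact: lip_past.
have cg : continuous g by exact: lip_past.
pose h := antiderivative f - antiderivative g.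
have hE s : h s = antiderivative f s - antiderivative g s by [].
have dh (s : R) : 0 <= s -> is_derive s 1 h (f s - g s).
  by move=> s0; apply: is_deriveB; apply: is_derive_antiderivative => //; lra.
have := @derive_bound_by _ h (fun s => f s - g s) (fun s => C / 2 * weight s)
  (fun s => C / 2 * (2 * L) * weight s) 0 t t0.
rewrite !hE !antiderivative0 !subr0 => H; apply: (le_trans (H _ _ _ _ _)).
- by move=> x /andP[x1 _]; apply: is_derive_continuous (dh _ x1).
- by move=> x _; apply: is_derive_continuous (weight_der _ _).
- by move=> x /andP[x1 _]; apply: dh; exact: ltW.
- by move=> x _; exact: weight_der.
- move=> x /andP[x1 _]; have x1' := ltW x1.
  have -> : C / 2 * (2 * L) * weight x = L * (C * weight x) by field.
  by apply: FL => j; rewrite /= (max_idPl x1') uv.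
- have := mulr_ge0 C0 (ltW (weight_gt0 0)); lra.
Qed.

Theorem picard_lindelof : exists x : R -> I -> R,
  x 0 = x0 /\ forall (t : R) i, 0 <= t -> is_derive t 1 (x ^~ i) (F (x t) i).
Proof.
have w0 : weight 0 = 1 by rewrite /weight mulr0 expR0.
pose D : R := `|M| / L.
have D0 : 0 <= D by rewrite divr_ge0// ltW.
(* The first increment is at most M t, hence at most a multiple of the weight. *)
have step k (t : R) i : 0 <= t -> `|picard k.+1 t i - picard k t i| <= D / 2 ^+ k * weight t.
  elim: k t i => [|k IH] t i t0.
    rewrite expr0 divr1 /= addrC addKr.
    have := @antider_lip (fun s : R => F x0 i) i (fun=> @cst_continuous _ _ _ _)
      (fun=> FM x0 i) t 0 t0 (lexx _).
    rewrite antiderivative0 addr0 addrC addKr subr0 => /le_trans; apply.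
    rewrite (ger0_norm t0) /D mulrAC ler_pdivlMr//.
    have := expR_ge1Dx (2 * L * t); rewrite -/(weight t) => wt.
    have Mn := ler_norm M; have Mn0 := normr_ge0 M.
    have tL : 0 <= t * L by rewrite mulr_ge0// ltW.
    apply: (@le_trans _ _ (`|M| * (t * L))); first by rewrite -mulrA ler_wpM2r.
    by rewrite ler_wpM2l//; lra.
  have -> : D / 2 ^+ k.+1 = D / 2 ^+ k / 2 by rewrite exprS; field; rewrite expf_neq0.
  have := @contract (picard k.+1) (picard k) (D / 2 ^+ k) (picard_lip k.+1) (picard_lip k).
  move=> /(_ _ IH _ _ t0) H /=; rewrite opprD addrACA subrr add0r; apply: H.
  by rewrite divr_ge0// exprn_ge0.
have lim (t : R) i : exists l, 0 <= t ->
    forall k, `|l - picard k t i| <= 2 * (D * weight t) / 2 ^+ k.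
  case: (lerP 0 t) => [t0|]; last by exists 0.
  have [|l lP] := @geometric_limit _ (fun k => picard k t i) (D * weight t).
    by move=> k; rewrite mulrAC step.
  by exists l => _; exact: lP.
have [y0 yP0] := choice (fun p : R * I => lim p.1 p.2).
pose y : R -> I -> R := fun t i => y0 (t, i).
have yP (t : R) i k : 0 <= t -> `|y t i - picard k t i| <= 2 * D / 2 ^+ k * weight t.
  by move=> t0; have := yP0 (t, i) t0 k; rewrite mulrA mulrAC.
have small (C e : R) : 0 < e -> exists k, C / 2 ^+ k <= e.
  move=> e0; have C0 : 0 <= `|C| / e by rewrite divr_ge0// ltW.
  exists (Num.truncn (`|C| / e)).+1.
  rewrite ler_pdivrMr ?exprn_gt0// mulrC -ler_pdivrMr//.
  have := truncnS_gt (`|C| / e); set m := (_.+1)%N => Cm.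
  apply: (@le_trans _ _ (`|C| / e)); first by rewrite ler_pM2r ?invr_gt0// ler_norm.
  apply: (le_trans (ltW Cm)); rewrite -natrX ler_nat; exact/ltnW/ltn_expl.
have le_small (a C : R) : (forall k, `|a| <= C / 2 ^+ k) -> a = 0.
  move=> aC; apply/eqP; rewrite -normr_le0; apply/ler_addgt0Pr => e e0.
  by have [k Ck] := small C e e0; rewrite add0r (le_trans (aC k)).
have yM i (s t : R) : 0 <= s -> 0 <= t -> `|y s i - y t i| <= M * `|s - t|.
  move=> s0 t0; apply/ler_addgt0Pr => e e0.
  have [k Ck] := small (2 * D * weight s + 2 * D * weight t) e e0.
  have h1 := yP s i k s0; have h2 := yP t i k t0; have h3 := @picard_lip k i s t s0 t0.
  have -> : y s i - y t i = (y s i - picard k s i)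
    + (picard k s i - picard k t i) - (y t i - picard k t i) by ring.
  apply: (le_trans (ler_normB _ _)); apply: (le_trans (lerD (ler_normD _ _) h2)).
  have : 2 * D / 2 ^+ k * weight s + 2 * D / 2 ^+ k * weight t <= e.
    by apply: le_trans Ck; rewrite le_eqVlt; apply/orP; left; apply/eqP; ring.
  by lra.
(* The pointwise limit y is only known for t >= 0; applying the Picard operator
   once more gives a function that is differentiable around 0 as well. *)
pose x (t : R) (i : I) : R := x0 i + antiderivative (fun s : R => F (y (Num.max s 0)) i) t.
have cF i : continuous (fun s : R => F (y (Num.max s 0)) i) by exact: lip_past.
have xy (t : R) i : 0 <= t -> x t i = y t i.
  move=> t0; apply/eqP; rewrite -subr_eq0; apply/eqP.
  apply: (@le_small _ (2 * D * weight t)) => k.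
  have h1 := yP t i k.+1 t0.
  have H : `|x t i - picard k.+1 t i| <= 2 * D / 2 ^+ k / 2 * weight t.
    rewrite /= /x opprD addrACA subrr add0r.
    apply: (@contract y (picard k) (2 * D / 2 ^+ k) yM (picard_lip k) _ _ t i t0).
      by apply: divr_ge0; [exact: mulr_ge0|exact: exprn_ge0].
    by move=> *; exact: yP.
  have -> : x t i - y t i = (x t i - picard k.+1 t i) - (y t i - picard k.+1 t i) by ring.
  apply: (le_trans (ler_normB _ _)).
  rewrite exprS invfM in h1.
  have -> : 2 * D * weight t / 2 ^+ k = 2 * D / 2 ^+ k * weight t by ring.
  have : 0 <= 2 * D / 2 ^+ k * weight t.
    apply: mulr_ge0; last exact: ltW.
    by apply: divr_ge0; [exact: mulr_ge0|exact: exprn_ge0].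
  lra.
exists x; split.
  by apply/funext => i; rewrite /x antiderivative0 addr0.
move=> t i t0.
have <- : F (y (Num.max t 0)) i = F (x t) i.
  by rewrite (max_idPl t0); congr F; apply/funext => j; rewrite xy.
rewrite -[F _ _]add0r; apply: is_deriveD.
by apply: is_derive_antiderivative => //; lra.
Qed.

End GlobalPicard.
End Picard.

(** * Uniqueness and global existence for locally Lipschitz equations *)

Section LocalToGlobal.
Context {R : realType} {I : finType}.
Implicit Types (F : (I -> R) -> I -> R) (s t T : R).

(** Induction on an interval: P propagates to the end of a half-open interval
    on which it holds, and a little beyond. *)
Lemma real_induction (P : R -> Prop) (T : R) :
  (forall t, 0 <= t < T -> (forall s, 0 <= s < t -> P s) -> P t) ->
  (forall t, 0 <= t < T -> P t ->
     exists2 e, 0 < e & forall s, t <= s < t + e -> P s) ->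
  forall t, 0 <= t < T -> P t.
Proof.
move=> Pclosed Popen t /andP[t0 tT]; apply: contrapT => nPt.
pose A : set R := [set s | 0 <= s < T /\ ~ P s].
have At : A t by split; rewrite ?t0.
have Ainf : has_inf A by split; [exists t|exists 0 => s [/andP[]]].
have m0 : 0 <= inf A by apply: lb_le_inf => [|s [/andP[]//]]; exists t.
have mT : inf A < T.
  by apply: le_lt_trans tT; apply: (ge_inf _ At); case: Ainf.
have below s : 0 <= s < inf A -> P s.
  move=> /andP[s0 sm]; apply: contrapT => nPs.
  have As : A s by split; rewrite ?s0 ?(lt_trans sm).
  by move: sm; rewrite ltNge (ge_inf _ As)//; case: Ainf.
have Pm : P (inf A) by apply: Pclosed; rewrite ?m0.
have [|e e0 Pe] := Popen _ _ Pm; first by rewrite m0.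
have [|s As sme] := @inf_adherent _ A e e0; first exact: Ainf.
case: (As) => _; apply; apply: Pe; rewrite sme andbT.
by apply: (ge_inf _ As); case: Ainf.
Qed.

(** The two solutions are compared through the squared Euclidean distance. *)
Lemma solves_unique F (B L T : R) (x y : R -> I -> R) :
  lipschitz_box F B L -> 0 <= L ->
  solves F T x -> solves F T y -> x 0 = y 0 ->
  (forall t i, 0 <= t < T -> `|x t i| <= B) ->
  (forall t i, 0 <= t < T -> `|y t i| <= B) ->
  forall t, 0 <= t < T -> x t = y t.
Proof.
move=> FL L0 [cx dx] [cy dy] xy0 xB yB t /andP[t0 tT].
pose u s := \sum_i (x s i - y s i) ^+ 2.
pose u' s := \sum_i (2 * (x s i - y s i) * (F (x s) i - F (y s) i)).
have u_ge0 s : 0 <= u s by apply: sumr_ge0 => i _; exact: sqr_ge0.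
have ui s i : `|x s i - y s i| <= Num.sqrt (u s).
  rewrite -sqrtr_sqr ler_sqrt// /u (bigD1 i)//= lerDl.
  by apply: sumr_ge0 => j _; exact: sqr_ge0.
pose K := 2 * L * #|I|%:R.
have du s : 0 < s < T -> is_derive s 1 u (u' s).
  move=> sT; apply: is_derive_bigsum => i _.
  have dxy : is_derive s 1 (fun r => x r i - y r i) (F (x s) i - F (y s) i).
    by apply: is_derive_sub; [exact: dx|exact: dy].
  have := is_derive_mul dxy dxy.
  rewrite [X in is_derive _ _ _ X -> _]
    (_ : _ = 2 * (x s i - y s i) * (F (x s) i - F (y s) i)) //.
  by ring.
have u'u s : 0 <= s < T -> u' s <= K * u s.
  move=> sT; apply: (@le_trans _ _ (\sum_(i : I) 2 * L * u s)); last first.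
    by rewrite sumr_const -[X in X <= _]mulr_natr /K mulrAC.
  apply: ler_sum => i _; apply: (le_trans (ler_norm _)).
  rewrite !normrM gtr0_norm// -mulrA -[2 * L * _]mulrA ler_wpM2l//.
  have -> : L * u s = Num.sqrt (u s) * (L * Num.sqrt (u s)).
    by rewrite mulrCA -expr2 sqr_sqrtr.
  apply: ler_pM => //; apply: FL => // j; by [exact: xB|exact: yB|].
pose E (s : R) : R := expR (- K * s).
have dE (s : R) : is_derive s 1 E (- K * E s).
  have -> : - K * E s = E s * (- K * 1) by ring.
  exact: (@is_derive1_comp _ expR (fun s => - K * s)).
have cu (s : R) : 0 <= s < T -> {for s, continuous u}.
  move=> sT; rewrite /u; apply: continuous_bigsum => i _ /=.
  have c : {for s, continuous (fun r => x r i - y r i)}.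
    by apply: continuousB; [exact: cx|exact: cy].
  exact: (continuousM c).
(* Gronwall: exp (- K s) * u s is nonincreasing. *)
have : - (E 0 * u 0) <= - (E t * u t).
  apply: (@derive_incr _ (fun s => - (E s * u s))
     (fun s => - (- K * E s * u s + E s * u' s))) => // s /andP[s0 st].
  - have sT : 0 <= s < T by rewrite s0 (le_lt_trans st).
    apply: (@continuousN _ _ _ (fun s => E s * u s)).
    apply: continuousM; last exact: cu.
    exact: is_derive_continuous (dE s).
  - apply: is_derive_opp; apply: is_derive_mul => //.
    by apply: du; rewrite s0 (lt_trans st).
  - have sT : 0 <= s < T by rewrite (ltW s0) (lt_trans st).
    have := u'u s sT; have := expR_ge0 (- K * s); rewrite -/(E s) => E0 H.
    have : 0 <= E s * (K * u s - u' s) by rewrite mulr_ge0// subr_ge0.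
    lra.
have -> : u 0 = 0 by rewrite /u big1// => i _; rewrite xy0 subrr expr0n.
rewrite mulr0 oppr0 oppr_ge0 pmulr_rle0 ?expR_gt0// => ut.
apply/funext => i; apply/eqP; rewrite -subr_eq0 -normr_le0.
by rewrite (le_trans (ui t i))// -sqrtr0 ler_wsqrtr.
Qed.

(** Projection of the real line onto [- B, B]. *)
Definition clamp (B a : R) : R := Num.max (- B) (Num.min B a).

Lemma clampE B a : `|a| <= B -> clamp B a = a.
Proof. by rewrite ler_norml => /andP[h1 h2]; rewrite /clamp (min_idPr h2) (max_idPr h1). Qed.

Lemma clamp_bound B a : 0 <= B -> `|clamp B a| <= B.
Proof.
move=> B0; rewrite ler_norml /clamp le_max lexx/= ge_max ge_min lexx/= andbT.
by lra.
Qed.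

Lemma clamp_lip B a b : 0 <= B -> `|clamp B a - clamp B b| <= `|a - b|.
Proof.
move=> B0; rewrite /clamp !maxEle !minEle.
case: (lerP B a) => ?; case: (lerP B b) => ?; rewrite ?subrr ?normr0//;
  repeat case: ifP => /= ?; rewrite ?subrr ?normr0//; 
  rewrite ler_norml; apply/andP; split;
  have := ler_norm (a - b); have := ler_norm (b - a); rewrite (distrC b a); lra.
Qed.

(** F is Lipschitz on every bounded box. *)
Definition locally_lipschitz F : Prop :=
  forall B, 0 <= B -> exists2 L, 0 < L & lipschitz_box F B L.

(** Solutions through x0 on bounded time intervals stay bounded. *)
Definition no_blow_up F (x0 : I -> R) : Prop :=
  forall T, 0 < T -> exists B : R, forall T' (x : R -> I -> R), T' <= T ->
    solves F T' x -> x 0 = x0 -> forall t i, 0 <= t < T' -> `|x t i| <= B.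

(** The equation clamped to a large box has a global solution, which by the a
    priori bound does not reach the boundary of the box before time T. *)
Lemma solves_bounded_interval F x0 (T : R) :
  locally_lipschitz F -> no_blow_up F x0 -> 0 < T ->
  exists x : R -> I -> R, x 0 = x0 /\
    forall t i, 0 <= t < T -> is_derive t 1 (x ^~ i) (F (x t) i).
Proof.
move=> locF bF T0; have [B BP] := bF T T0.
pose B' := `|B| + \sum_i `|x0 i| + 1.
have S0 : 0 <= \sum_i `|x0 i| by apply: sumr_ge0.
have B'0 : 0 <= B' by rewrite /B'; have := normr_ge0 B; lra.
have [L L0 FL] := locF B' B'0.
pose G (x : I -> R) := F (fun j => clamp B' (x j)).
have GL x y d : (forall j, `|x j - y j| <= d) -> forall i, `|G x i - G y i| <= L * d.
  move=> xyd; apply: FL => j; do ?exact: clamp_bound.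
  exact: le_trans (clamp_lip _ _ B'0) (xyd j).
pose M := \sum_i `|F (fun=> 0) i| + L * B'.
have GM x i : `|G x i| <= M.
  have h : `|G x i - F (fun=> 0) i| <= L * B'.
    apply: FL => j; rewrite ?subr0 ?normr0//; exact: clamp_bound.
  have h1 : `|F (fun=> 0) i| <= \sum_i `|F (fun=> 0) i|.
    by rewrite (bigD1 i)//= lerDl sumr_ge0.
  have -> : G x i = (G x i - F (fun=> 0) i) + F (fun=> 0) i by rewrite subrK.
  by rewrite (le_trans (ler_normD _ _))// /M addrC lerD.
have [x [x00 dx]] := picard_lindelof x0 L0 GL GM.
have cx i (t : R) : 0 <= t -> {for t, continuous (x ^~ i)}.
  by move=> t0; apply: is_derive_continuous; exact: dx.
have GE (y : I -> R) : (forall i, `|y i| < B') -> G y = F y.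
  by move=> yB; rewrite /G; congr F; apply/funext => j; rewrite clampE// ltW.
suff xB (t : R) : 0 <= t < T -> forall i, `|x t i| < B'.
  exists x; split=> // t i tT; rewrite -GE; last exact: xB.
  by apply: dx; case/andP: tT.
move: t; apply: real_induction => t /andP[t0 tT] Pt.
- move: t0; rewrite le_eqVlt => /orP[/eqP<- i|t0 i].
    rewrite x00 /B'; have : `|x0 i| <= \sum_i `|x0 i|.
      by rewrite (bigD1 i)//= lerDl sumr_ge0.
    by have := normr_ge0 B; lra.
  have xt : solves F t x.
    split=> s j /andP[s0 st]; first exact: cx.
    by rewrite -GE; [apply: dx; exact: ltW|move=> k; apply: Pt; rewrite ltW].
  have xsB (s : R) : 0 <= s < t -> `|x s i| <= B.
    by move=> st; apply: (BP t x _ xt) => //; exact: ltW.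
  apply: (@le_lt_trans _ _ `|B|); last by rewrite /B'; lra.
  rewrite leNgt; apply/negP => Bx.
  have /cvgr_dist_lt/(_ (`|x t i| - `|B|)) := cx i t (ltW t0).
  rewrite subr_gt0 => /(_ Bx)/nbhs_ballP[e /= e0 xe].
  pose s := Num.max (t / 2) (t - e / 2).
  have s0 : 0 <= s by rewrite le_max divr_ge0// ltW.
  have st : s < t by rewrite gt_max; apply/andP; split; lra.
  have se : t - e / 2 <= s by rewrite le_max lexx orbT.
  have /xe : ball t e s by rewrite /ball/= gtr0_norm; lra.
  have := xsB s; rewrite s0 st => /(_ isT) xs.
  have := ler_normB (x t i) (x t i - x s i); rewrite subKr => h.
  have := lerB_dist (x t i) (x s i); have := ler_norm B.
  lra.
- have : \forall s \near t, forall i, `|x s i| < B'.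
    apply: (@filter_forall R I (fun i s => `|x s i| < B') (nbhs t)) => i.
    have /cvgr_dist_lt/(_ (B' - `|x t i|)) := cx i t t0.
    rewrite subr_gt0 => /(_ (Pt i)); apply: filterS => s xs.
    have := lerB_dist (x s i) (x t i); rewrite (distrC (x s i)); lra.
  move=> /nbhs_ballP[e /= e0 xe]; exists e => // s /andP[ts se]; apply: xe.
  by rewrite /ball/= ltr_norml; apply/andP; split; lra.
Qed.

(** The solutions on the intervals [0, n] are restrictions of one another by
    uniqueness, and are glued together. *)
Theorem locally_lipschitz_global_solution F x0 :
  locally_lipschitz F -> no_blow_up F x0 ->
  exists x : R -> I -> R, x 0 = x0 /\
    forall t i, 0 <= t -> is_derive t 1 (x ^~ i) (F (x t) i).
Proof.
move=> locF bF.
have /choice[xs xsP] (n : nat) : exists x : R -> I -> R, x 0 = x0 /\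
    forall t i, 0 <= t < n.+1%:R -> is_derive t 1 (x ^~ i) (F (x t) i).
  by apply: solves_bounded_interval.
have xsS n : solves F n.+1%:R (xs n).
  case: (xsP n) => _ d; split=> t i; last by move=> /andP[t0 tn]; apply: d; rewrite ltW.
  by move=> tn; apply: is_derive_continuous; exact: d.
have agree m n (t : R) : 0 <= t -> t < m.+1%:R -> t < n.+1%:R -> xs m t = xs n t.
  wlog mn : m n / (m <= n)%N => [H|].
    by move=> t0 tm tn; case/orP: (leq_total m n) => mn; [|symmetry]; exact: H.
  move=> t0 tm tn.
  have mn' : m.+1%:R <= n.+1%:R :> R by rewrite ler_nat.
  have [B BP] := bF n.+1%:R (ltr0Sn _ _).
  have [L L0 FL] := locF `|B| (normr_ge0 _).
  have BB k (s : R) (i : I) : (k <= n)%N -> 0 <= s < k.+1%:R -> `|xs k s i| <= `|B|.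
    move=> kn sk; apply: (le_trans _ (ler_norm _)).
    apply: (BP k.+1%:R (xs k)) => //; last by case: (xsP k).
    by rewrite ler_nat.
  apply: (solves_unique FL (ltW L0) (xsS m) (solves_le mn' (xsS n))).
  - by rewrite (xsP m).1 (xsP n).1.
  - by move=> s i; exact: BB.
  - by move=> s i /andP[s0 sm]; apply: BB => //; rewrite s0 (lt_le_trans sm).
  - by rewrite t0.
(* Negative times use the same solution as 0, so that the glued function is
   differentiable at 0 too. *)
pose N (t : R) := (Num.truncn t).+1.
have tN (t : R) : 0 <= t -> t < (N t).+1%:R.
  move=> t0; apply: (lt_le_trans (truncnS_gt t)); by rewrite ler_nat /N.
pose x (t : R) : I -> R := xs (N t) t.
have xE n (t : R) : 0 <= t -> t < n.+1%:R -> x t = xs n t.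
  by move=> t0 tn; apply: agree => //; exact: tN.
exists x; split; first by rewrite /x (xsP _).1.
move=> t i t0; have -> : F (x t) i = F (xs (N t) t) i by [].
have d : is_derive t 1 (xs (N t) ^~ i) (F (xs (N t) t) i).
  by apply: (xsP _).2; rewrite t0 tN.
apply: (@near_eq_is_derive _ _ _ (xs (N t) ^~ i)) => //.
move: t0; rewrite le_eqVlt => /orP[/eqP t0|t0].
- rewrite -t0; near=> s.
  have -> // : x s i = xs (N 0) s i.
  rewrite /x /N; congr (xs _.+1 _ _).
  have s1 : s < 1 by near: s; exact: lt_nbhsl.
  by rewrite truncn0; apply/truncn0Pn; rewrite -ltNge.
- near=> s; have s0 : 0 < s by near: s; exact: lt_nbhsr.
  rewrite (xE (N t))//; first exact: ltW.
  by near: s; apply: lt_nbhsl; exact/tN/ltW.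
Unshelve. all: by end_near. Qed.

End LocalToGlobal.

(** * Bounded Lipschitz functions, coercive systems and smooth maps *)

Section BoundedLipschitz.
Context {R : realType} {T : Type}.
Variables (K : set T) (d : T -> T -> R).
Implicit Types (f g : T -> R).

(** f is bounded on K, and Lipschitz there for the distance d. *)
Definition bounded_lipschitz f : Prop :=
  exists B L : R, [/\ 0 <= B, 0 <= L, forall x, K x -> `|f x| <= B &
    forall x y, K x -> K y -> `|f x - f y| <= L * d x y].

Lemma bl_ext f g : (forall x, K x -> f x = g x) ->
  bounded_lipschitz f -> bounded_lipschitz g.
Proof.
move=> fg [B [L [B0 L0 fB fL]]]; exists B, L; split=> // [x Kx|x y Kx Ky].
  by rewrite -fg// fB.
by rewrite -!fg// fL.
Qed.

Lemma bl_cst (a : R) : bounded_lipschitz (fun=> a).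
Proof.
exists `|a|, 0; split=> // x y _ _; by rewrite subrr normr0 mul0r.
Qed.

Lemma bl_add f g : bounded_lipschitz f -> bounded_lipschitz g ->
  bounded_lipschitz (fun x => f x + g x).
Proof.
move=> [B [L [B0 L0 fB fL]]] [B' [L' [B'0 L'0 gB gL]]].
exists (B + B'), (L + L'); split; rewrite ?addr_ge0//.
  by move=> x Kx; rewrite (le_trans (ler_normD _ _))// lerD ?fB ?gB.
move=> x y Kx Ky; rewrite opprD addrACA mulrDl.
by rewrite (le_trans (ler_normD _ _))// lerD ?fL ?gL.
Qed.

Lemma bl_opp f : bounded_lipschitz f -> bounded_lipschitz (fun x => - f x).
Proof.
move=> [B [L [B0 L0 fB fL]]]; exists B, L; split=> // [x Kx|x y Kx Ky].
  by rewrite normrN fB.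
by rewrite -opprD normrN fL.
Qed.

Lemma bl_sub f g : bounded_lipschitz f -> bounded_lipschitz g ->
  bounded_lipschitz (fun x => f x - g x).
Proof. by move=> hf hg; apply: bl_add => //; exact: bl_opp. Qed.

Lemma bl_mul f g : bounded_lipschitz f -> bounded_lipschitz g ->
  bounded_lipschitz (fun x => f x * g x).
Proof.
move=> [B [L [B0 L0 fB fL]]] [B' [L' [B'0 L'0 gB gL]]].
exists (B * B'), (B * L' + L * B'); split; rewrite ?addr_ge0 ?mulr_ge0//.
  by move=> x Kx; rewrite normrM ler_pM ?fB ?gB.
move=> x y Kx Ky.
have -> : f x * g x - f y * g y = f x * (g x - g y) + (f x - f y) * g y by ring.
rewrite (le_trans (ler_normD _ _))// [X in _ <= X]mulrDl !normrM lerD//.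
  by rewrite -mulrA ler_pM ?fB ?gL.
by rewrite mulrAC ler_pM ?gB ?fL.
Qed.

Lemma bl_scale (a : R) f : bounded_lipschitz f -> bounded_lipschitz (fun x => a * f x).
Proof. by move=> hf; apply: bl_mul => //; exact: bl_cst. Qed.

Lemma bl_sum (J : finType) (P : pred J) (h : J -> T -> R) :
  (forall j, P j -> bounded_lipschitz (h j)) ->
  bounded_lipschitz (fun x => \sum_(j | P j) h j x).
Proof.
move=> H; have -> : (fun x => \sum_(j | P j) h j x) = \sum_(j | P j) h j.
  by apply/funext => x; rewrite fct_sumE.
elim/big_ind : _ => //; first exact: (bl_cst 0).
by move=> u v hu hv; exact: bl_add.
Qed.

Lemma bl_lip_comp (phi : R -> R) (L' : R) f :
  (forall a b, `|phi a - phi b| <= L' * `|a - b|) ->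
  bounded_lipschitz f -> bounded_lipschitz (fun x => phi (f x)).
Proof.
move=> phiL [B [L [B0 L0 fB fL]]].
exists (`|phi 0| + `|L'| * B), (`|L'| * L); split.
- by rewrite addr_ge0// mulr_ge0.
- by rewrite mulr_ge0.
- move=> x Kx; have -> : phi (f x) = phi 0 + (phi (f x) - phi 0) by rewrite addrC subrK.
  rewrite (le_trans (ler_normD _ _))// lerD2l (le_trans (phiL _ _))// subr0.
  by rewrite (le_trans (ler_wpM2r _ (ler_norm L')))// ler_wpM2l// fB.
- move=> x y Kx Ky; rewrite (le_trans (phiL _ _))//.
  by rewrite (le_trans (ler_wpM2r _ (ler_norm L')))// -mulrA ler_wpM2l// fL.
Qed.

End BoundedLipschitz.

Section Coercive.
Context {R : realType} {n : nat}.
Implicit Types (M : 'M[R]_n) (a b y : 'cV[R]_n).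

(** The quadratic form of M is at least lam times the squared Euclidean norm. *)
Definition coercive (lam : R) M : Prop :=
  forall y, lam * \sum_k y k 0 ^+ 2 <= (y^T *m M *m y) 0 0.

Lemma row_colE a b : (a^T *m b) 0 0 = \sum_k a k 0 * b k 0.
Proof. by rewrite mxE; apply: eq_bigr => k _; rewrite mxE. Qed.

(** A solution of a coercive linear system is bounded by its right-hand side. *)
Lemma coercive_bound lam M a b : 0 < lam -> coercive lam M -> M *m a = b ->
  forall k, `|a k 0| <= lam^-1 * \sum_l `|b l 0|.
Proof.
move=> lam0 cM Mab k.
have a2 j : `|a j 0| ^+ 2 <= \sum_l a l 0 ^+ 2.
  rewrite real_normK ?num_real// (bigD1 j)//= lerDl.
  by apply: sumr_ge0 => l _; exact: sqr_ge0.
pose A := Num.sqrt (\sum_l a l 0 ^+ 2).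
have aA j : `|a j 0| <= A.
  by rewrite -[X in X <= _]ger0_norm// -sqrtr_sqr ler_wsqrtr.
have AA : A * A = \sum_l a l 0 ^+ 2.
  by rewrite -expr2 sqr_sqrtr// sumr_ge0// => l _; exact: sqr_ge0.
have A0 : 0 <= A by exact: sqrtr_ge0.
apply: (le_trans (aA k)).
move: A0; rewrite le_eqVlt => /orP[/eqP <-|A0].
  by rewrite mulr_ge0 ?invr_ge0 ?sumr_ge0// ltW.
have := cM a; rewrite -mulmxA Mab row_colE -AA => H.
rewrite mulrC ler_pdivlMr// -(ler_pM2r A0).
have -> : A * lam * A = lam * (A * A) by ring.
apply: (le_trans H); rewrite mulr_suml; apply: ler_sum => l _.
by rewrite (le_trans (ler_norm _))// normrM mulrC ler_wpM2l.
Qed.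

Lemma coercive_unitmx lam M : 0 < lam -> coercive lam M -> M \in unitmx.
Proof.
move=> lam0 cM; rewrite -unitmx_tr -row_free_unit; apply/inj_row_free => v vM.
have Mv : M *m v^T = 0 by rewrite -[M]trmxK -trmx_mul vM trmx0.
apply/rowP => k; rewrite [RHS]mxE; apply/eqP; rewrite -normr_le0.
have := coercive_bound lam0 cM Mv k; rewrite big1 ?mulr0 ?mxE//.
by move=> l _; rewrite mxE normr0.
Qed.

(** The solution of a coercive linear system depends on a parameter in a
    Lipschitz way if the matrix and the right-hand side do. *)
Lemma bl_coercive_solve (T : Type) (K : set T) (d : T -> T -> R) (lam : R)
    (M : T -> 'M[R]_n) (a b : T -> 'cV[R]_n) :
  0 < lam ->
  (forall x, K x -> coercive lam (M x)) ->
  (forall x, K x -> M x *m a x = b x) ->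
  (forall k l, bounded_lipschitz K d (fun x => M x k l)) ->
  (forall k, bounded_lipschitz K d (fun x => b x k 0)) ->
  forall k, bounded_lipschitz K d (fun x => a x k 0).
Proof.
move=> lam0 cM Mab hM hb k.
have il0 : 0 <= lam^-1 by rewrite invr_ge0 ltW.
have /choice[Bb /choice[Lb bP]] := hb.
have hM' (p : 'I_n * 'I_n) := hM p.1 p.2.
have /choice[Bm /choice[Lm mP]] := hM'.
have Bb0 l : 0 <= Bb l by case: (bP l).
have Lb0 l : 0 <= Lb l by case: (bP l).
have Lm0 l : 0 <= Lm l by case: (mP l).
pose A := lam^-1 * \sum_l Bb l.
have aA x j : K x -> `|a x j 0| <= A.
  move=> Kx; apply: (le_trans (coercive_bound lam0 (cM x Kx) (Mab x Kx) j)).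
  rewrite ler_wpM2l//; apply: ler_sum => l _; by case: (bP l) => _ _ + _; exact.
have A0 : 0 <= A by rewrite mulr_ge0// sumr_ge0.
exists A, (lam^-1 * \sum_l (Lb l + \sum_j Lm (l, j) * A)); split => //.
- rewrite mulr_ge0// sumr_ge0// => l _; rewrite addr_ge0// sumr_ge0// => j _.
  by rewrite mulr_ge0.
- by move=> x Kx; exact: aA.
- move=> x y Kx Ky.
  have E : M x *m (a x - a y) = (b x - b y) - (M x - M y) *m a y.
    by rewrite mulmxBr mulmxBl !Mab// opprB addrA subrK.
  have := coercive_bound lam0 (cM x Kx) E k; rewrite !mxE => H.
  apply: (le_trans H); rewrite -mulrA ler_wpM2l// mulr_suml; apply: ler_sum => l _.
  rewrite !mxE (le_trans (ler_normB _ _))// mulrDl lerD//.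
    by case: (bP l) => _ _ _; exact.
  rewrite (le_trans (ler_norm_sum _ _ _))// mulr_suml; apply: ler_sum => j _.
  rewrite normrM mulrAC ler_pM ?aA// !mxE.
  by case: (mP (l, j)) => _ _ _; exact.
Qed.

End Coercive.

Section Smooth.
Context {R : realType}.

Lemma is_derive_chain (U W : normedModType R) (f : U -> W) (c : R -> U) t v :
  differentiable f (c t) -> is_derive t 1 c v ->
  is_derive t 1 (fun s => f (c s)) ('D_v f (c t)).
Proof.
move=> df [dc cv].
have dc' : differentiable c t by apply/derivable1_diffP.
have dfc : differentiable (f \o c) t by exact: differentiable_comp.
split; first by apply/derivable1_diffP.
rewrite deriveE// (_ : (fun s => f (c s)) = f \o c)// diff_comp//=.
have -> : 'd c t 1 = v by rewrite -cv deriveE.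
by rewrite deriveE.
Qed.

Lemma derive_bigsum (U W : normedModType R) (f : U -> W) (u : U) (J : finType)
    (x : J -> R) (e : J -> U) :
  differentiable f u ->
  'D_(\sum_j x j *: e j) f u = \sum_j x j *: 'D_(e j) f u.
Proof.
move=> df; rewrite deriveE// raddf_sum.
by apply: eq_bigr => j _; rewrite [RHS]/= deriveE//; exact: linearZ_LR.
Qed.

Lemma derivable_mxE (U : normedModType R) p q (f : U -> 'M[R]_(p, q)) u v k l :
  derivable f u v -> ('D_v f u) k l = 'D_v (fun w => f w k l) u.
Proof. by move=> df; rewrite derive_mx// mxE. Qed.

(** The linear combinations of finitely many vectors with coefficients in
    [- B, B] lie in a compact set. *)
Lemma box_span_compact (U : normedModType R) (J : eqType) (s : seq J)
    (e : J -> U) (B : R) :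
  exists2 K : set U, compact K & forall x : J -> R,
    (forall j, `|x j| <= B) -> K (\sum_(j <- s) x j *: e j).
Proof.
elim: s => [|j s [K cK KP]].
  exists [set 0]; first exact: compact_set1.
  by move=> x _; rewrite big_nil.
pose g (p : R * U) : U := p.1 *: e j + p.2.
exists (g @` (`[- B, B] `*` K)).
  apply: continuous_compact; last exact: compact_setX (@segment_compact _ _ _) cK.
  apply: continuous_subspaceT => p; apply: cvgD; last exact: cvg_snd.
  by apply: cvgZ; [exact: cvg_fst|exact: cvg_cst].
move=> x xB; rewrite big_cons; exists (x j, \sum_(i <- s) x i *: e i) => //=.
by split => /=; [rewrite in_itv/= -ler_norml|exact: KP].
Qed.

(** Smooth maps preserve bounded Lipschitz functions: by the mean value theorem
    along segments, with the partial derivatives bounded on a compact set by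
    continuity. *)
Lemma bl_smooth (T : Type) (K : set T) (d : T -> T -> R) (U : normedModType R)
    p q (f : U -> 'M[R]_(p, q)) (J : finType) (e : J -> U) (g : J -> T -> R) k l :
  smooth f ->
  (forall j, bounded_lipschitz K d (g j)) ->
  bounded_lipschitz K d (fun x => f (\sum_j g j x *: e j) k l).
Proof.
move=> sf /choice[Bg /choice[Lg gP]].
have Bg0 j : 0 <= Bg j by case: (gP j).
pose B : R := \sum_j Bg j.
have gB x j : K x -> `|g j x| <= B.
  move=> Kx; apply: (@le_trans _ _ (Bg j)); first by case: (gP j) => _ _ + _; exact.
  by rewrite /B (bigD1 j)//= lerDl sumr_ge0.
have [C cC CP] := box_span_compact (index_enum J) e B.
have bnd (h : U -> R) : continuous h -> exists2 A : R, 0 <= A &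
    forall x : J -> R, (forall j, `|x j| <= B) -> `|h (\sum_j x j *: e j)| <= A.
  move=> ch; have [[u Cu]|C0] := pselect (C !=set0).
    have [c _ cM] := @compact_EVT_max _ _ (fun u => `|h u|) C (ex_intro _ u Cu) cC
        (continuous_subspaceT (fun x => continuous_comp (ch x) (@norm_continuous _ _ _))).
    exists `|h c| => // x xB; apply: cM; rewrite inE; exact: CP.
  by exists 0 => // x xB; case: C0; exists (\sum_j x j *: e j); exact: CP.
have df u : differentiable f u by exact: (sf [::]).
have cf : continuous (fun u => f u k l).
  move=> u; apply: (@continuous_comp _ _ _ f (fun M : 'M[R]_(p, q) => M k l)).
    exact: differentiable_continuous (df u).
  exact: coord_continuous.
have cD j : continuous (fun u => ('D_(e j) f u) k l).
  move=> u; apply: (@continuous_comp _ _ _ ('D_(e j) f) (fun M : 'M[R]_(p, q) => M k l)).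
    exact: differentiable_continuous (sf [:: e j] u).
  exact: coord_continuous.
have [A A0 AP] := bnd _ cf.
have /choice[D DP] (j : J) : exists D : R, 0 <= D /\
    forall x : J -> R, (forall i, `|x i| <= B) ->
      `|('D_(e j) f (\sum_i x i *: e i)) k l| <= D.
  by have [D D0 DP] := bnd _ (cD j); exists D.
have H (x y : J -> R) : (forall j, `|x j| <= B) -> (forall j, `|y j| <= B) ->
    `|f (\sum_j x j *: e j) k l - f (\sum_j y j *: e j) k l|
      <= \sum_j D j * `|x j - y j|.
  move=> xB yB.
  pose c (s : R) := \sum_j (y j + s * (x j - y j)) *: e j.
  pose v := \sum_j (x j - y j) *: e j.
  have cE (s : R) : c s = s *: v + \sum_j y j *: e j.
    rewrite /c /v scaler_sumr -big_split; apply: eq_bigr => j _ /=.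
    by rewrite scalerA -scalerDl addrC.
  have dc (s : R) : is_derive s 1 c v.
    have -> : c = (fun s => s *: v + \sum_j y j *: e j) by apply/funext.
    rewrite -[X in is_derive _ _ _ X]addr0; apply: is_deriveD.
    rewrite -[X in is_derive _ _ _ X]scale1r.
    have dl : differentiable (fun t : R => t *: v) s by exact: differentiableZl.
    split; first exact/derivable1_diffP.
    by rewrite deriveE// diffZl// diff_val.
  have df' (s : R) : is_derive s 1 (fun s => f (c s) k l)
      (\sum_j (x j - y j) * ('D_(e j) f (c s)) k l).
    have [h1 h2] := is_derive_chain (df (c s)) (dc s).
    split; first by have /derivable_mxP := h1; exact.
    rewrite -(derivable_mxE _ _ h1) h2 derive_bigsum// summxE.
    by apply: eq_bigr => j _; rewrite !mxE.
  have := @derive_bound _ (fun s => f (c s) k l)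
    (fun s => \sum_j (x j - y j) * ('D_(e j) f (c s)) k l) 0 1 (\sum_j D j * `|x j - y j|) ler01.
  have -> : c 1 = \sum_j x j *: e j.
    by apply: eq_bigr => j _; rewrite mul1r addrC subrK.
  have -> : c 0 = \sum_j y j *: e j.
    by apply: eq_bigr => j _; rewrite mul0r addr0.
  rewrite subr0 mulr1; apply.
  - by move=> s _; exact: is_derive_continuous (df' s).
  - move=> s /andP[s0 s1]; rewrite (le_trans (ler_norm_sum _ _ _))//.
    apply: ler_sum => j _; rewrite normrM mulrC ler_wpM2r//.
    apply: (DP j).2 => i.
    have -> : y i + s * (x i - y i) = (1 - s) * y i + s * x i by ring.
    rewrite (le_trans (ler_normD _ _))// !normrM (gtr0_norm s0).
    rewrite (@gtr0_norm _ (1 - s)) ?subr_gt0//.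
    have := ler_wpM2l (ltW s0) (xB i).
    have s1' : 0 <= 1 - s by rewrite subr_ge0 ltW.
    by have := ler_wpM2l s1' (yB i); lra.
exists A, (\sum_j D j * Lg j); split => //.
- by rewrite sumr_ge0// => j _; rewrite mulr_ge0 ?(DP j).1//; case: (gP j).
- by move=> x Kx; apply: AP => j; exact: gB.
- move=> x y Kx Ky; apply: (le_trans (H _ _ _ _)) => [j|j|].
  + exact: gB.
  + exact: gB.
  + rewrite mulr_suml; apply: ler_sum => j _; rewrite -mulrA ler_wpM2l ?(DP j).1//.
    by case: (gP j) => _ _ _; exact.
Qed.

End Smooth.

(** * Derivatives relative to a set *)

Section Derivatives.
Context {R : realType}.
Implicit Types (f g u : R -> R) (s t l v : R) (D : set R).

(** Differentiability within D, in the form of a first-order expansion. *)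
Lemma deriv_withinP D f t l :
  deriv_within D (f : R -> R^o) t l <->
  forall e, 0 < e -> exists2 d, 0 < d & forall s, D s -> `|s - t| < d ->
    `|f s - f t - l * (s - t)| <= e * `|s - t|.
Proof.
have E s : s != t -> `|f s - f t - l * (s - t)|
    = `|l - (s - t)^-1 * (f s - f t)| * `|s - t|.
  move=> st; rewrite -normrM mulrBl mulrAC mulVf ?subr_eq0// mul1r.
  by rewrite distrC.
split.
- move=> /cvgrPdist_le H e e0; have /= := H e e0.
  rewrite near_withinE near_withinE => /nbhs_ballP[d /= d0 dP]; exists d => // s Ds std.
  have [->|st] := eqVneq s t; first by rewrite !subrr mulr0 subr0 !normr0 mulr0.
  rewrite E// ler_wpM2r//; apply: dP => //.
  by rewrite /ball/= distrC.
- move=> H; apply/cvgrPdist_le => e e0 /=.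
  rewrite near_withinE near_withinE; have [d d0 dP] := H e e0.
  apply/nbhs_ballP; exists d => //= s std st Ds.
  rewrite /ball/= distrC in std.
  have := dP s Ds std; rewrite E// ler_pM2r//.
  by rewrite normr_gt0 subr_eq0.
Qed.

(** The corresponding form of the ordinary derivative. *)
Lemma is_deriveP f t l :
  is_derive t 1 f l <->
  forall e, 0 < e -> exists2 d, 0 < d & forall s, `|s - t| < d ->
    `|f s - f t - l * (s - t)| <= e * `|s - t|.
Proof.
have E h : h != 0 -> `|l - h^-1 * (f (h + t) - f t)| * `|h|
    = `|f (h + t) - f t - l * h|.
  by move=> h0; rewrite -normrM mulrBl mulrAC mulVf// mul1r distrC.
split.
- move=> [/cvg_ex[/= l' fl'] fl].
  have {fl' fl} : h^-1 *: (f (h *: 1 + t) - f t) @[h --> 0^'] --> (l : R^o).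
    by rewrite -fl /derive; move/cvg_lim : (fl') => ->.
  move=> /cvgrPdist_le H e e0; have /= := H e e0.
  rewrite near_withinE => /nbhs_ballP[d /= d0 dP]; exists d => // s std.
  have [->|st] := eqVneq s t; first by rewrite !subrr mulr0 subr0 !normr0 mulr0.
  have st0 : s - t != 0 by rewrite subr_eq0.
  have := E _ st0; rewrite subrK => <-; rewrite ler_wpM2r//.
  have := dP (s - t); rewrite /ball/= sub0r normrN => /(_ std st0).
  by rewrite /GRing.scale/= mulr1 subrK.
- move=> H.
  have c : h^-1 *: (f (h *: 1 + t) - f t) @[h --> 0^'] --> (l : R^o).
    apply/cvgrPdist_le => e e0 /=; rewrite near_withinE.
    have [d d0 dP] := H e e0; apply/nbhs_ballP; exists d => //= h hd h0.
    have hn : 0 < `|h| by rewrite normr_gt0.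
    rewrite /GRing.scale/= mulr1 -(ler_pM2r hn) E//.
    have := dP (h + t); rewrite addrK; apply.
    by move: hd; rewrite /ball/= sub0r normrN.
  split; first by apply/cvg_ex; exists l.
  exact: cvg_lim c.
Qed.

Lemma is_derive_deriv_within D f t l :
  is_derive t 1 f l -> deriv_within D (f : R -> R^o) t l.
Proof.
move=> /is_deriveP H; apply/deriv_withinP => e e0.
by have [d d0 dP] := H e e0; exists d => // s _; exact: dP.
Qed.

Lemma deriv_within_is_derive f t l : 0 < t ->
  deriv_within `[0, +oo[ (f : R -> R^o) t l -> is_derive t 1 f l.
Proof.
move=> t0 /deriv_withinP H; apply/is_deriveP => e e0.
have [d d0 dP] := H e e0; exists (Num.min d t); first by rewrite lt_min d0.
move=> s; rewrite lt_min => /andP[sd st]; apply: dP => //=.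
by rewrite in_itv/= andbT; move: st; rewrite ltr_norml => /andP[? _]; lra.
Qed.

Lemma deriv_within_continuous D f t l e : deriv_within D (f : R -> R^o) t l ->
  0 < e -> exists2 d, 0 < d & forall s, D s -> `|s - t| < d -> `|f s - f t| <= e.
Proof.
move=> /deriv_withinP H e0; have [d d0 dP] := H 1 ltr01.
have l1 : 0 < `|l| + 1 by rewrite ltr_wpDl.
exists (Num.min d (e / (`|l| + 1))); first by rewrite lt_min d0 divr_gt0.
move=> s Ds; rewrite lt_min => /andP[sd se]; have := dP s Ds sd.
rewrite mul1r => h.
have -> : f s - f t = (f s - f t - l * (s - t)) + l * (s - t) by rewrite subrK.
rewrite (le_trans (ler_normD _ _))// normrM.
apply: (@le_trans _ _ ((`|l| + 1) * `|s - t|)); first by lra.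
by rewrite mulrC -ler_pdivlMr// ltW.
Qed.

(** Chain rule for an outer function differentiable only within D. *)
Lemma is_derive_within_comp D f u t l v :
  deriv_within D (f : R -> R^o) (u t) l -> is_derive t 1 u v ->
  (\forall s \near t, D (u s)) ->
  is_derive t 1 (fun s => f (u s)) (l * v).
Proof.
move=> /deriv_withinP fD du Du; apply/is_deriveP => e e0.
have v1 : 0 < `|v| + 1 by rewrite ltr_wpDl.
have l1 : 0 < `|l| + 1 by rewrite ltr_wpDl.
pose e1 := e / 2 / (`|v| + 1); pose e2 := e / 2 / (`|l| + 1).
have e10 : 0 < e1 by rewrite !divr_gt0.
have e20 : 0 < e2 by rewrite !divr_gt0.
have [d1 d10 fP] := fD e1 e10.
move/is_deriveP : (du) => H.
have [d2 d20 uP] := H e2 e20; have [d3 d30 uP'] := H 1 ltr01.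
have cu := is_derive_continuous du.
have /cvgrPdist_lt/(_ d1 d10) cu1 := cu.
have /nbhs_ballP[d4 /= d40 dP] : \forall s \near t, D (u s) /\ `|u t - u s| < d1.
  by apply: filterI.
exists (Num.min (Num.min d2 d3) d4); first by rewrite !lt_min d20 d30.
move=> s; rewrite !lt_min => /andP[/andP[sd2 sd3] sd4].
have [|Dus us1] := dP s; first by rewrite /ball/= distrC.
have h1 := fP (u s) Dus; rewrite distrC in us1; move/(_ us1) in h1.
have h2 := uP s sd2; have h3 := uP' s sd3.
have h4 : `|u s - u t| <= (`|v| + 1) * `|s - t|.
  have -> : u s - u t = (u s - u t - v * (s - t)) + v * (s - t) by rewrite subrK.
  by rewrite (le_trans (ler_normD _ _))// normrM; lra.
have -> : f (u s) - f (u t) - l * v * (s - t)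
  = (f (u s) - f (u t) - l * (u s - u t)) + l * (u s - u t - v * (s - t)) by ring.
rewrite (le_trans (ler_normD _ _))// normrM.
have h5 : e1 * `|u s - u t| <= e / 2 * `|s - t|.
  have -> : e / 2 = e1 * (`|v| + 1) by rewrite /e1 divfK// gt_eqF.
  by rewrite -mulrA ler_wpM2l// ltW.
have h6 : `|l| * `|u s - u t - v * (s - t)| <= e / 2 * `|s - t|.
  apply: (@le_trans _ _ ((`|l| + 1) * (e2 * `|s - t|))).
    by rewrite ler_pM// lerDl.
  by rewrite mulrA [_ * e2]mulrC /e2 divfK// gt_eqF.
by rewrite [leRHS](_ : _ = e / 2 * `|s - t| + e / 2 * `|s - t|); [lra|field].
Qed.

Lemma continuous_within_comp D f u t l :
  deriv_within D (f : R -> R^o) (u t) l -> {for t, continuous u} ->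
  (\forall s \near t, D (u s)) ->
  {for t, continuous (fun s => f (u s))}.
Proof.
move=> fD cu Du; apply/cvgrPdist_le => e e0.
have [d d0 dP] := deriv_within_continuous fD e0.
have /cvgrPdist_lt/(_ d d0) cu1 := cu.
near=> s; rewrite distrC; apply: dP; first by near: s.
by rewrite distrC; near: s.
Unshelve. all: by end_near. Qed.

Lemma deriv_within_mxP D p (f : R -> 'cV[R]_p) t (l : 'cV[R]_p) :
  deriv_within D f t l <->
  forall k, deriv_within D ((fun s => f s k 0) : R -> R^o) t (l k 0).
Proof.
split.
- move=> /cvgrPdist_le H k; apply/cvgrPdist_le => e e0.
  have := H e e0; apply: filterS => s; apply: le_trans.
  rewrite [in leRHS]/Num.Def.normr/= mx_normrE.
  apply: le_trans (le_bigmax _ _ (k, 0)).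
  by rewrite !mxE.
- move=> H; apply/cvgrPdist_le => e e0.
  near=> s; rewrite /Num.Def.normr/= mx_normrE (bigmax_le _ (ltW e0))//= => -[k j] _.
  rewrite !mxE/= ord1; move: k {j}; near: s.
  apply: (@filter_forall _ _ (fun k s =>
    `|l k 0 + - ((s - t)^-1 * (f s k 0 + - f t k 0))| <= e)) => k.
  exact: (cvgrPdist_le _ _).1 (H k) e e0.
Unshelve. all: by end_near. Qed.

Lemma is_derive_mx p q (f : R -> 'M[R]_(p, q)) t (l : 'M[R]_(p, q)) :
  (forall k j, is_derive t 1 (fun s => f s k j) (l k j)) -> is_derive t 1 f l.
Proof.
move=> H; have df : derivable f t 1.
  by apply/derivable_mxP => k j; case: (H k j).
by split=> //; rewrite derive_mx//; apply/matrixP => k j; rewrite mxE; case: (H k j).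
Qed.

Lemma is_derive_entry p q (f : R -> 'M[R]_(p, q)) t (l : 'M[R]_(p, q)) k j :
  is_derive t 1 f l -> is_derive t 1 (fun s => f s k j) (l k j).
Proof.
move=> [df <-]; split; first by have /derivable_mxP := df; exact.
by rewrite derivable_mxE.
Qed.

End Derivatives.

(** * The closed loop as a vector field *)

Section ClosedLoopField.
Context {R : realType} {N n : nat}.
Variables (E : rel 'I_N) (S : 'I_N -> euler_lagrange R n).
Variables (c kappa : 'I_N -> R).
Implicit Types (y : 'cV[R]_n) (q v z : 'I_N -> 'cV[R]_n).

(** Index type of the coordinates of a state: positions, velocities and filter
    states of all agents, in this order. *)
Definition coords : finType :=
  (('I_N * 'I_n) + ('I_N * 'I_n) + ('I_N * 'I_n))%type.

Implicit Types (x : coords -> R).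

Definition pos_of x (i : 'I_N) : 'cV[R]_n := \col_k x (inl (inl (i, k))).
Definition vel_of x (i : 'I_N) : 'cV[R]_n := \col_k x (inl (inr (i, k))).
Definition filt_of x (i : 'I_N) : 'cV[R]_n := \col_k x (inr (i, k)).

Definition state_of q v z : coords -> R := fun a =>
  match a with
  | inl (inl p) => q p.1 p.2 0
  | inl (inr p) => v p.1 p.2 0
  | inr p => z p.1 p.2 0
  end.

(** Squared Euclidean norm. *)
Definition sqnorm y : R := \sum_k y k 0 ^+ 2.

Definition dot (a b : 'cV[R]_n) : R := \sum_k a k 0 * b k 0.

(** Derivative of agent i's filter state. *)
Definition filt_rate x i : 'cV[R]_n := - filt_of x i + kappa i *: pos_of x i.

Variable dpsi : R -> R.

(** Gradient with respect to agent i of its potentials, where dpsi is the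
    derivative of the potential with respect to the squared distance. *)
Definition pull q i : 'cV[R]_n :=
  \sum_(j | E i j) (2 * dpsi (sqnorm (q j - q i))) *: (q i - q j).

(** Inertial force of agent i: the control without its gravity compensation,
    minus the Coriolis term. *)
Definition acc_rhs x i : 'cV[R]_n :=
  - (c i *: pull (pos_of x) i) - kappa i *: filt_rate x i
  - coriolis (S i) (pos_of x i) (vel_of x i) *m vel_of x i.

Definition acc x i : 'cV[R]_n := invmx (inertia (S i) (pos_of x i)) *m acc_rhs x i.

(** The right-hand side of the closed loop.  The gravity terms of the dynamics
    and of the control cancel and do not appear. *)
Definition field x : coords -> R := state_of (vel_of x) (acc x) (filt_rate x).

Lemma pos_ofK q v z i : pos_of (state_of q v z) i = q i.
Proof. by apply/colP => k; rewrite mxE. Qed.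
Lemma vel_ofK q v z i : vel_of (state_of q v z) i = v i.
Proof. by apply/colP => k; rewrite mxE. Qed.
Lemma filt_ofK q v z i : filt_of (state_of q v z) i = z i.
Proof. by apply/colP => k; rewrite mxE. Qed.

Lemma sum_delta y : \sum_k y k 0 *: delta_mx k 0 = y.
Proof.
rewrite {2}[y]matrix_sum_delta; apply: eq_bigr => k _.
by rewrite big_ord1.
Qed.

Hypothesis elS : forall i, el_properties (S i).

Lemma inertia_coercive i : exists2 lam : R, 0 < lam &
  forall p : 'cV[R]_n, coercive lam (inertia (S i) p).
Proof.
have [l1 [l2 [l10 _ H]]] := el_bounds (elS i); exists l1 => // q y.
have [h _] := H q; apply: le_trans (h y).
rewrite mul_mx_scalar -scalemxAl mxE row_colE.
by rewrite ler_wpM2l// ?ltW//.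
Qed.

Lemma inertia_acc x i : inertia (S i) (pos_of x i) *m acc x i = acc_rhs x i.
Proof.
have [lam lam0 cM] := inertia_coercive i.
by rewrite /acc mulKVmx// (coercive_unitmx lam0 (cM _)).
Qed.

Variable Ld : R.
Hypothesis dpsiL : forall a b, `|dpsi a - dpsi b| <= Ld * `|a - b|.

(* Sum distance and boxes on the space of states. *)
Let dist1 (x x' : coords -> R) : R := \sum_a `|x a - x' a|.
Let box (B : R) : set (coords -> R) := [set x | forall a, `|x a| <= B].

Let dist1_ge0 x x' : 0 <= dist1 x x'. Proof. exact: sumr_ge0. Qed.

Section Box.
Variable B : R.
Hypothesis B0 : 0 <= B.
Notation bl := (bounded_lipschitz (box B) dist1).

Let bl_coord a : bl (fun x => x a).
Proof.
exists B, 1; split=> // x y _ _.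
by rewrite mul1r /dist1 (bigD1 a)//= lerDl sumr_ge0.
Qed.

Let bl_pos i k : bl (fun x => pos_of x i k 0).
Proof. by apply: bl_ext (bl_coord (inl (inl (i, k)))) => x _; rewrite mxE. Qed.

Let bl_vel i k : bl (fun x => vel_of x i k 0).
Proof. by apply: bl_ext (bl_coord (inl (inr (i, k)))) => x _; rewrite mxE. Qed.

Let bl_filt i k : bl (fun x => filt_of x i k 0).
Proof. by apply: bl_ext (bl_coord (inr (i, k))) => x _; rewrite mxE. Qed.

Let bl_filt_rate i k : bl (fun x => filt_rate x i k 0).
Proof.
apply: (@bl_ext _ _ _ _ (fun x => - filt_of x i k 0 + kappa i * pos_of x i k 0)).
  by move=> x _; rewrite /filt_rate !mxE.
by apply: bl_add => //; [exact: bl_opp|exact: bl_scale].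
Qed.

Let bl_pull i k : bl (fun x => pull (pos_of x) i k 0).
Proof.
pose g x j := 2 * dpsi (sqnorm (pos_of x j - pos_of x i)).
apply: (@bl_ext _ _ _ _ (fun x => \sum_(j | E i j) g x j * (pos_of x i k 0 - pos_of x j k 0))).
  by move=> x _; rewrite /pull summxE; apply: eq_bigr => j _; rewrite !mxE.
apply: bl_sum => // j _; apply: bl_mul => //; last exact: bl_sub.
apply: bl_scale => //.
apply: (bl_lip_comp dpsiL).
have D l : bl (fun x => (pos_of x j - pos_of x i) l 0).
  apply: (@bl_ext _ _ _ _ (fun x => pos_of x j l 0 - pos_of x i l 0)).
    by move=> x _; rewrite !mxE.
  exact: bl_sub.
by apply: bl_sum => // l _; apply: bl_mul => //; exact: D.
Qed.

Let bl_inertia i k l : bl (fun x => inertia (S i) (pos_of x i) k l).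
Proof.
have := @bl_smooth R _ (box B) dist1 _ _ _ (inertia (S i)) 'I_n
  (fun k => delta_mx k 0) (fun k x => pos_of x i k 0) k l
  (el_smooth_inertia (elS i)) (bl_pos i).
by apply: bl_ext => x _; rewrite sum_delta.
Qed.

Let bl_coriolis i k l : bl (fun x => coriolis (S i) (pos_of x i) (vel_of x i) k l).
Proof.
pose e (a : 'I_n + 'I_n) : ('cV[R]_n * 'cV[R]_n)%type :=
  match a with inl k => (delta_mx k 0, 0) | inr k => (0, delta_mx k 0) end.
pose g (a : 'I_n + 'I_n) x :=
  match a with inl k => pos_of x i k 0 | inr k => vel_of x i k 0 end.
have gbl a : bl (g a) by case: a => a; [exact: bl_pos|exact: bl_vel].
have := @bl_smooth R _ (box B) dist1 _ _ _ _ _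
  e g k l (el_smooth_coriolis (elS i)) gbl.
apply: bl_ext => x _.
congr (coriolis (S i) _ _ k l).
- rewrite (big_morph (@fst _ _) (fun _ _ => erefl) erefl) big_sumType/=.
  rewrite [X in _ + X]big1 ?addr0 ?sum_delta// => j _; exact: scaler0.
- rewrite (big_morph (@snd _ _) (fun _ _ => erefl) erefl) big_sumType/=.
  rewrite [X in X + _]big1 ?add0r ?sum_delta// => j _; exact: scaler0.
Qed.

Let bl_rhs i k : bl (fun x => acc_rhs x i k 0).
Proof.
apply: (@bl_ext _ _ _ _ (fun x => - (c i * pull (pos_of x) i k 0)
   - kappa i * filt_rate x i k 0
   - \sum_l coriolis (S i) (pos_of x i) (vel_of x i) k l * vel_of x i l 0)).
  by move=> x _; rewrite /acc_rhs !mxE.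
apply: bl_sub => //; last first.
  by apply: bl_sum => // l _; exact: bl_mul.
apply: bl_sub => //; last exact: bl_scale.
by apply: bl_opp => //; exact: bl_scale.
Qed.

Let bl_acc i k : bl (fun x => acc x i k 0).
Proof.
have [lam lam0 cM] := inertia_coercive i.
apply: (@bl_coercive_solve _ _ _ (box B) dist1 lam
  (fun x => inertia (S i) (pos_of x i)) (fun x => acc x i) (fun x => acc_rhs x i)) => //.
by move=> x _; exact: inertia_acc.
Qed.

Let bl_field a : bl (fun x => field x a).
Proof.
case: a => [[[i k]|[i k]]|[i k]];
  [exact: bl_vel|exact: bl_acc|exact: bl_filt_rate].
Qed.

Lemma field_lipschitz_box : exists2 L, 0 < L & lipschitz_box field B L.
Proof.
have /choice[Bf /choice[Lf fP]] := bl_field.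
have Lf0 a : 0 <= Lf a by case: (fP a).
have S0 : 0 <= \sum_a Lf a by apply: sumr_ge0.
exists ((\sum_a Lf a) * #|coords|%:R + 1).
  by rewrite ltr_wpDl// mulr_ge0.
move=> x y d xB yB xyd a.
have d0 : 0 <= d by exact: le_trans (normr_ge0 _) (xyd a).
have [_ _ _ H] := fP a; apply: (le_trans (H x y xB yB)).
have Dd : dist1 x y <= #|coords|%:R * d.
  rewrite mulr_natl -sumr_const /dist1; apply: ler_sum => b _; exact: xyd.
have La : Lf a <= \sum_a Lf a by rewrite (bigD1 a)//= lerDl sumr_ge0.
rewrite mulrDl mul1r.
apply: (@le_trans _ _ ((\sum_a Lf a) * (#|coords|%:R * d))).
  by rewrite ler_pM// dist1_ge0.
by rewrite mulrA lerDl.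
Qed.

End Box.

Lemma field_locally_lipschitz : locally_lipschitz field.
Proof. by move=> B B0; exact: field_lipschitz_box. Qed.

End ClosedLoopField.

(** * The energy and its dissipation *)

Section DotProduct.
Context {R : realType} {n : nat}.
Implicit Types (a b y : 'cV[R]_n) (A : 'M[R]_n).

Lemma dotC a b : dot a b = dot b a.
Proof. by apply: eq_bigr => k _; rewrite mulrC. Qed.

Lemma dotDr a b y : dot a (b + y) = dot a b + dot a y.
Proof. by rewrite /dot -big_split; apply: eq_bigr => k _ /=; rewrite !mxE mulrDr. Qed.

Lemma dotZr a (l : R) b : dot a (l *: b) = l * dot a b.
Proof. by rewrite /dot mulr_sumr; apply: eq_bigr => k _ /=; rewrite !mxE mulrCA. Qed.

Lemma dotNr a b : dot a (- b) = - dot a b.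
Proof. by rewrite -scaleN1r dotZr mulN1r. Qed.

Lemma dotBr a b y : dot a (b - y) = dot a b - dot a y.
Proof. by rewrite dotDr dotNr. Qed.

Lemma dot_sumr (J : finType) (P : pred J) a (b : J -> 'cV[R]_n) :
  dot a (\sum_(j | P j) b j) = \sum_(j | P j) dot a (b j).
Proof.
rewrite /dot exchange_big/=; apply: eq_bigr => k _; rewrite summxE mulr_sumr.
by [].
Qed.

Lemma dotxx y : dot y y = sqnorm y. Proof. by []. Qed.

Lemma dot_trmx a A b : dot a (A *m b) = dot (A^T *m a) b.
Proof. by rewrite /dot -!row_colE trmx_mul trmxK mulmxA. Qed.

Lemma sqnorm_ge0 y : 0 <= sqnorm y.
Proof. by apply: sumr_ge0 => k _; exact: sqr_ge0. Qed.

Lemma sqnormN y : sqnorm (- y) = sqnorm y.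
Proof. by apply: eq_bigr => k _; rewrite mxE sqrrN. Qed.

Lemma enormE y : enorm y = Num.sqrt (sqnorm y). Proof. by []. Qed.

Lemma enorm_ge0 y : 0 <= enorm y. Proof. exact: sqrtr_ge0. Qed.

Lemma enorm_sqr y : enorm y ^+ 2 = sqnorm y.
Proof. by rewrite sqr_sqrtr// sqnorm_ge0. Qed.

Lemma coord_le_enorm y k : `|y k 0| <= enorm y.
Proof.
rewrite -sqrtr_sqr ler_sqrt ?sqnorm_ge0// (bigD1 k)//= lerDl.
by apply: sumr_ge0 => j _; exact: sqr_ge0.
Qed.

End DotProduct.

Section GraphSums.
Context {R : realType} {N n : nat}.
Variable E : rel 'I_N.
Hypothesis symE : symmetric E.

(** Summation by parts over the edges of an undirected graph. *)
Lemma edge_sum_by_parts (a : 'I_N -> 'I_N -> R) (x y : 'I_N -> 'cV[R]_n) :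
  (forall i j, a i j = a j i) ->
  \sum_i \sum_(j | E i j) a i j * dot (x i - x j) (y i - y j)
  = 2 * \sum_i dot (y i) (\sum_(j | E i j) a i j *: (x i - x j)).
Proof.
move=> symA.
pose G := \sum_i \sum_(j | E i j) a i j * dot (y i) (x i - x j).
have GE : \sum_i dot (y i) (\sum_(j | E i j) a i j *: (x i - x j)) = G.
  apply: eq_bigr => i _; rewrite dot_sumr; apply: eq_bigr => j _.
  by rewrite dotZr.
have GE' : \sum_i \sum_(j | E i j) a i j * dot (y j) (x i - x j) = - G.
  rewrite (exchange_big_dep xpredT)//= /G -sumrN; apply: eq_bigr => j _.
  rewrite -sumrN; apply: eq_big => [i|i _]; first by rewrite symE.
  by rewrite symA -mulrN -dotNr opprB.
rewrite GE mulr_natl mulr2n -[X in _ = _ + X]opprK -GE' -sumrB.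
apply: eq_bigr => i _; rewrite -sumrB; apply: eq_bigr => j _.
by rewrite dotBr mulrBr dotC [dot _ (y j)]dotC.
Qed.

(** A reflexive relation that can be extended along edges relates all connected
    vertices. *)
Lemma connect_rel_ind (P : 'I_N -> 'I_N -> Prop) :
  (forall i, P i i) -> (forall i j k, E i j -> P j k -> P i k) ->
  forall i j, connect E i j -> P i j.
Proof.
move=> Pr Pt i j /connectP[p ep ->]; elim: p i ep => [|k p IH] i /=.
  by move=> _; exact: Pr.
by move=> /andP[eik ep]; apply: Pt eik _; exact: IH.
Qed.

End GraphSums.

Section Inertia.
Context {R : realType} {n : nat}.
Variable S : euler_lagrange R n.
Hypothesis elS : el_properties S.
Implicit Types (p v a : 'cV[R]_n).

(** The inertia matrix is symmetric, so the skew symmetry of its derivative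
    minus twice the Coriolis matrix determines that derivative. *)
Lemma inertia_derivative p v :
  'D_v (inertia S) p = coriolis S p v + (coriolis S p v)^T.
Proof.
have dM : derivable (inertia S) p v.
  by apply: diff_derivable; exact: (el_smooth_inertia elS [::]).
have symD : ('D_v (inertia S) p)^T = 'D_v (inertia S) p.
  apply/matrixP => k l; rewrite mxE !derivable_mxE//; congr ('D_v _ p).
  by apply/funext => q; rewrite -[in RHS](el_sym elS) mxE.
have := el_skew elS p v; rewrite /= linearB/= symD linearZ/= opprB.
move=> /matrixP H; apply/matrixP => k l; have := H k l; have := H l k.
have := symD => /matrixP/(_ k l); rewrite !mxE; lra.
Qed.

(** The Coriolis term accounts for the variation of the inertia matrix. *)
Lemma is_derive_kinetic (q v : R -> 'cV[R]_n) (t : R) a :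
  is_derive t 1 q (v t) -> is_derive t 1 v a ->
  is_derive t 1 (fun s => dot (v s) (inertia S (q s) *m v s))
    (2 * dot (v t) (inertia S (q t) *m a + coriolis S (q t) (v t) *m v t)).
Proof.
move=> dq dv; pose Md := 'D_(v t) (inertia S) (q t).
have dM : is_derive t 1 (fun s => inertia S (q s)) Md.
  by apply: is_derive_chain => //; exact: (el_smooth_inertia elS [::]).
have -> : 2 * dot (v t) (inertia S (q t) *m a + coriolis S (q t) (v t) *m v t)
  = \sum_k (a k 0 * (\sum_l inertia S (q t) k l * v t l 0)
    + v t k 0 * (\sum_l (Md k l * v t l 0 + inertia S (q t) k l * a l 0))).
  have -> : \sum_k (a k 0 * (\sum_l inertia S (q t) k l * v t l 0)
    + v t k 0 * (\sum_l (Md k l * v t l 0 + inertia S (q t) k l * a l 0)))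
    = dot a (inertia S (q t) *m v t) + dot (v t) (Md *m v t + inertia S (q t) *m a).
    rewrite /dot -big_split; apply: eq_bigr => k _ /=; rewrite !mxE.
    by rewrite big_split.
  rewrite [dot a _]dot_trmx (el_sym elS) [dot (_ *m a) _]dotC.
  rewrite !dotDr /Md inertia_derivative mulmxDl dotDr.
  by rewrite [dot _ (_^T *m _)]dot_trmx trmxK [dot (_ *m v t) _]dotC; ring.
have -> : (fun s => dot (v s) (inertia S (q s) *m v s))
  = (fun s => \sum_k v s k 0 * (\sum_l inertia S (q s) k l * v s l 0)).
  by apply/funext => s; apply: eq_bigr => k _; rewrite mxE.
apply: is_derive_bigsum => k _; apply: is_derive_mul.
  exact: is_derive_entry dv.
apply: is_derive_bigsum => l _; apply: is_derive_mul.
  exact: is_derive_entry dM.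
exact: is_derive_entry dv.
Qed.

Lemma continuous_kinetic (q v : R -> 'cV[R]_n) (t : R) :
  {for t, continuous q} -> (forall k, {for t, continuous (fun s => v s k 0)}) ->
  {for t, continuous (fun s => dot (v s) (inertia S (q s) *m v s))}.
Proof.
move=> cq cv.
have cM k l : {for t, continuous (fun s => inertia S (q s) k l)}.
  apply: (@continuous_comp _ _ _ (fun s => inertia S (q s)) (fun M : 'M[R]_n => M k l)).
    apply: continuous_comp => //; apply: differentiable_continuous.
    exact: (el_smooth_inertia elS [::]).
  exact: coord_continuous.
have -> : (fun s => dot (v s) (inertia S (q s) *m v s))
  = (fun s => \sum_k v s k 0 * (\sum_l inertia S (q s) k l * v s l 0)).
  by apply/funext => s; apply: eq_bigr => k _; rewrite mxE.
apply: continuous_bigsum => k _; apply: continuousM; first exact: cv.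
by apply: continuous_bigsum => l _; apply: continuousM; [exact: cM|exact: cv].
Qed.

End Inertia.

Lemma continuous_cV {R : realType} {n : nat} (q : R -> 'cV[R]_n) (t : R) :
  (forall k, {for t, continuous (fun s => q s k 0)}) -> {for t, continuous q}.
Proof.
move=> cq; apply/cvgrPdist_le => e e0.
near=> s; rewrite /Num.Def.normr/= mx_normrE (bigmax_le _ (ltW e0))//= => -[k j] _.
rewrite !mxE/= ord1; move: k {j}; near: s.
apply: (@filter_forall _ _ (fun k s => `|q t k 0 + - q s k 0| <= e)) => k.
exact: (cvgrPdist_le _ _).1 (cq k) e e0.
Unshelve. all: by end_near. Qed.

Section Energy.
Context {R : realType} {N n : nat}.
Variables (r : R) (E : rel 'I_N) (S : 'I_N -> euler_lagrange R n).
Variables (psi : R -> \bar R) (c kappa : 'I_N -> R).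
Hypothesis elS : forall i, el_properties (S i).
Hypothesis symE : symmetric E.
Hypothesis c0 : forall i, 0 < c i.
Notation state := (@coords N n -> R).

(** Twice the kinetic energy of agent i. *)
Definition kinetic (x : state) i : R :=
  dot (vel_of x i) (inertia (S i) (pos_of x i) *m vel_of x i).

(** The total potential, which is finite as long as all links are shorter
    than r, as a function of the squared distances. *)
Definition potential (q : 'I_N -> 'cV[R]_n) : R :=
  2^-1 * \sum_i \sum_(j | E i j) psi_sq psi (sqnorm (q j - q i)).

(** The total potential plus the kinetic energies and half the squared filter
    rates, weighted by the inverse gains so that the work of the coupling forces
    balances the change of the potential. *)
Definition energy (x : state) : R :=
  \sum_i (c i)^-1 * (2^-1 * kinetic x i + 2^-1 * sqnorm (filt_rate kappa x i))
  + potential (pos_of x).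

(** The rate at which the energy decreases. *)
Definition dissipation (x : state) : R :=
  \sum_i (c i)^-1 * sqnorm (filt_rate kappa x i).

(** All links of the configuration q are shorter than r, and dpsi is there the
    derivative of the potential. *)
Definition regular (dpsi : R -> R) (q : 'I_N -> 'cV[R]_n) : Prop :=
  forall i j, E i j -> sqnorm (q j - q i) < r ^+ 2 /\
    deriv_within `[0, r ^+ 2[ (psi_sq psi : R -> R^o) (sqnorm (q j - q i))
      (dpsi (sqnorm (q j - q i))).

Variables (dpsi : R -> R) (T : R) (x : R -> state).
Hypothesis xS : solves (field E S c kappa dpsi) T x.

Lemma continuous_pos t i k : 0 <= t < T -> {for t, continuous (fun s => pos_of (x s) i k 0)}.
Proof.
move=> tT.
have -> : (fun s => pos_of (x s) i k 0) = x ^~ (inl (inl (i, k))).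
  by apply/funext => s; rewrite mxE.
exact: xS.1.
Qed.

Lemma continuous_vel t i k : 0 <= t < T -> {for t, continuous (fun s => vel_of (x s) i k 0)}.
Proof.
move=> tT.
have -> : (fun s => vel_of (x s) i k 0) = x ^~ (inl (inr (i, k))).
  by apply/funext => s; rewrite mxE.
exact: xS.1.
Qed.

Lemma continuous_filt_rate t i k : 0 <= t < T ->
  {for t, continuous (fun s => filt_rate kappa (x s) i k 0)}.
Proof.
move=> tT.
have -> : (fun s => filt_rate kappa (x s) i k 0)
  = (fun s => - x s (inr (i, k)) + kappa i * pos_of (x s) i k 0).
  by apply/funext => s; rewrite /filt_rate !mxE.
apply: continuousD; first by apply: continuousN; exact: xS.1.
by apply: continuousM; [exact: cst_continuous|exact: continuous_pos].
Qed.

Lemma is_derive_pos t i k : 0 < t < T ->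
  is_derive t 1 (fun s => pos_of (x s) i k 0) (vel_of (x t) i k 0).
Proof.
move=> tT.
have -> : (fun s => pos_of (x s) i k 0) = x ^~ (inl (inl (i, k))).
  by apply/funext => s; rewrite mxE.
exact: (xS.2 t (inl (inl (i, k)))).
Qed.

Lemma is_derive_vel t i k : 0 < t < T ->
  is_derive t 1 (fun s => vel_of (x s) i k 0) (acc E S c kappa dpsi (x t) i k 0).
Proof.
move=> tT.
have -> : (fun s => vel_of (x s) i k 0) = x ^~ (inl (inr (i, k))).
  by apply/funext => s; rewrite mxE.
exact: (xS.2 t (inl (inr (i, k)))).
Qed.

Lemma is_derive_filt_rate t i k : 0 < t < T ->
  is_derive t 1 (fun s => filt_rate kappa (x s) i k 0)
    (- filt_rate kappa (x t) i k 0 + kappa i * vel_of (x t) i k 0).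
Proof.
move=> tT.
have -> : (fun s => filt_rate kappa (x s) i k 0)
  = (fun s => - x s (inr (i, k)) + kappa i * pos_of (x s) i k 0).
  by apply/funext => s; rewrite /filt_rate !mxE.
apply: is_derive_add; first by apply: is_derive_opp; exact: (xS.2 t (inr (i, k))).
by apply: is_derive_scale; exact: is_derive_pos.
Qed.

Lemma is_derive_sqdist t i j : 0 < t < T ->
  is_derive t 1 (fun s => sqnorm (pos_of (x s) j - pos_of (x s) i))
    (2 * dot (pos_of (x t) i - pos_of (x t) j) (vel_of (x t) i - vel_of (x t) j)).
Proof.
move=> tT; rewrite /dot mulr_sumr; apply: is_derive_bigsum => k _.
have d : is_derive t 1 (fun s => (pos_of (x s) j - pos_of (x s) i) k 0)
    (vel_of (x t) j k 0 - vel_of (x t) i k 0).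
  have -> : (fun s => (pos_of (x s) j - pos_of (x s) i) k 0)
    = (fun s => pos_of (x s) j k 0 - pos_of (x s) i k 0).
    by apply/funext => s; rewrite !mxE.
  exact: is_derive_sub (is_derive_pos j k tT) (is_derive_pos i k tT).
have := is_derive_mul d d.
rewrite [X in is_derive _ _ _ X -> _](_ : _ = 2 * ((pos_of (x t) i - pos_of (x t) j) k 0 *
  (vel_of (x t) i - vel_of (x t) j) k 0))//.
by rewrite !mxE; ring.
Qed.

Lemma continuous_sqdist t i j : 0 <= t < T ->
  {for t, continuous (fun s => sqnorm (pos_of (x s) j - pos_of (x s) i))}.
Proof.
move=> tT; apply: continuous_bigsum => k _.
have d : {for t, continuous (fun s => (pos_of (x s) j - pos_of (x s) i) k 0)}.
  have -> : (fun s => (pos_of (x s) j - pos_of (x s) i) k 0)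
    = (fun s => pos_of (x s) j k 0 - pos_of (x s) i k 0).
    by apply/funext => s; rewrite !mxE.
  by apply: continuousB; exact: continuous_pos.
exact: (continuousM d).
Qed.

Let near_short t i j : 0 <= t < T -> sqnorm (pos_of (x t) j - pos_of (x t) i) < r ^+ 2 ->
  \forall s \near t, `[0, r ^+ 2[ (sqnorm (pos_of (x s) j - pos_of (x s) i)).
Proof.
move=> tT ur; have := @continuous_sqdist t i j tT.
move=> /cvgrPdist_lt/(_ (r ^+ 2 - sqnorm (pos_of (x t) j - pos_of (x t) i))).
rewrite subr_gt0 => /(_ ur); apply: filterS => s h /=.
rewrite in_itv/= sqnorm_ge0/=; move: h; rewrite ltr_norml => /andP[h _]; lra.
Qed.

Lemma is_derive_energy t : 0 < t < T -> regular dpsi (pos_of (x t)) ->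
  is_derive t 1 (fun s => energy (x s)) (- dissipation (x t)).
Proof.
move=> tT reg.
have tT' : 0 <= t < T by case/andP: tT => /ltW -> ->.
pose q := pos_of (x t); pose v := vel_of (x t); pose w := filt_rate kappa (x t).
pose u i j := sqnorm (q j - q i).
have usym i j : u i j = u j i by rewrite /u -sqnormN opprB.
have dpot : is_derive t 1 (fun s => potential (pos_of (x s)))
    (\sum_i dot (v i) (pull E dpsi q i)).
  have -> : \sum_i dot (v i) (pull E dpsi q i) =
    2^-1 * \sum_i \sum_(j | E i j) dpsi (u i j) * (2 * dot (q i - q j) (v i - v j)).
    rewrite (_ : \sum_i \sum_(j | E i j) dpsi (u i j) * (2 * dot (q i - q j) (v i - v j))
       = \sum_i \sum_(j | E i j) (2 * dpsi (u i j)) * dot (q i - q j) (v i - v j)).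
      rewrite edge_sum_by_parts//; last by move=> i j; rewrite usym.
      by rewrite mulrA mulVf// mul1r.
    by apply: eq_bigr => i _; apply: eq_bigr => j _; ring.
  apply: is_derive_scale; apply: is_derive_bigsum => i _; apply: is_derive_bigsum => j Eij.
  have [ur du] := reg i j Eij.
  apply: (is_derive_within_comp du); first exact: is_derive_sqdist.
  exact: near_short.
have dw i : is_derive t 1 (fun s => sqnorm (filt_rate kappa (x s) i))
    (2 * dot (w i) (- w i + kappa i *: v i)).
  rewrite /dot mulr_sumr; apply: is_derive_bigsum => k _.
  have d := is_derive_filt_rate i k tT.
  have := is_derive_mul d d.
  rewrite [X in is_derive _ _ _ X -> _](_ : _ = 2 * (w i k 0 * (- w i + kappa i *: v i) k 0))//.
  by rewrite /w !mxE; ring.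
have dk i : is_derive t 1 (fun s => kinetic (x s) i)
    (2 * dot (v i) (- (c i *: pull E dpsi q i) - kappa i *: w i)).
  have := @is_derive_kinetic _ _ (S i) (elS i) (fun s => pos_of (x s) i)
    (fun s => vel_of (x s) i) t (acc E S c kappa dpsi (x t) i).
  rewrite inertia_acc// subrK; apply.
    by apply: is_derive_mx => k j; rewrite ord1; exact: is_derive_pos.
  by apply: is_derive_mx => k j; rewrite ord1; exact: is_derive_vel.
have -> : - dissipation (x t) = \sum_i (c i)^-1 *
   (2^-1 * (2 * dot (v i) (- (c i *: pull E dpsi q i) - kappa i *: w i))
    + 2^-1 * (2 * dot (w i) (- w i + kappa i *: v i)))
  + \sum_i dot (v i) (pull E dpsi q i).
  rewrite /dissipation -sumrN -big_split; apply: eq_bigr => i _ /=.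
  rewrite -/(w i); move: (w i) (v i) (pull E dpsi q i) => wi vi pulli.
  rewrite dotBr dotNr !dotZr dotDr dotNr dotZr dotxx [dot wi vi]dotC.
  by field; rewrite gt_eqF.
apply: is_derive_add => //.
apply: is_derive_bigsum => i _; apply: is_derive_scale; apply: is_derive_add;
  exact: is_derive_scale.
Qed.

Lemma continuous_energy t : 0 <= t < T -> regular dpsi (pos_of (x t)) ->
  {for t, continuous (fun s => energy (x s))}.
Proof.
move=> tT reg; apply: continuousD.
  apply: continuous_bigsum => i _; apply: continuousM; first exact: cst_continuous.
  apply: continuousD; (apply: continuousM; first exact: cst_continuous).
    apply: (@continuous_kinetic _ _ (S i) (elS i) (fun s => pos_of (x s) i)
      (fun s => vel_of (x s) i)) => [|k]; last exact: continuous_vel.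
    by apply: continuous_cV => k; exact: continuous_pos.
  have cw k := @continuous_filt_rate t i k tT.
  by apply: continuous_bigsum => k _; exact: (continuousM (cw k)).
apply: continuousM; first exact: cst_continuous.
apply: continuous_bigsum => i _; apply: continuous_bigsum => j Eij.
have [ur du] := reg i j Eij.
apply: (continuous_within_comp du); first exact: continuous_sqdist.
exact: near_short.
Qed.

Lemma dissipation_ge0 (y : state) : 0 <= dissipation y.
Proof.
by apply: sumr_ge0 => i _; rewrite mulr_ge0 ?sqnorm_ge0// invr_ge0 ltW.
Qed.

Lemma energy_nonincreasing s t : 0 <= s -> s <= t -> t < T ->
  (forall t', 0 <= t' <= t -> regular dpsi (pos_of (x t'))) ->
  energy (x t) <= energy (x s).
Proof.
move=> s0 st tT reg; rewrite -lerN2.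
apply: (@derive_incr _ (fun t => - energy (x t)) (fun t => - - dissipation (x t)) s t st).
- move=> t' /andP[st' t't]; apply: (@continuousN _ _ _ (fun t => energy (x t))).
  by apply: continuous_energy; [|apply: reg]; apply/andP; split; lra.
- move=> t' /andP[st' t't]; apply: is_derive_opp; apply: is_derive_energy.
    by apply/andP; split; lra.
  by apply: reg; apply/andP; split; lra.
- by move=> t' _; rewrite opprK dissipation_ge0.
Qed.

End Energy.

(** * Distance of the links to the communication radius *)

Section LinkMargin.
Context {R : realType} {N n : nat}.
Variables (r : R) (E : rel 'I_N) (psi : R -> \bar R) (Psimax : \bar R).
Hypothesis r0 : 0 < r.
Hypothesis gp : generalized_potential n E r psi Psimax.
Implicit Types (q : 'I_N -> 'cV[R]_n) (y : 'cV[R]_n).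

Lemma enorm_lt y : (enorm y < r) = (sqnorm y < r ^+ 2).
Proof.
by rewrite -enorm_sqr ltr_pXn2r// nnegrE ?enorm_ge0// ltW.
Qed.

Lemma enormN y : enorm (- y) = enorm y.
Proof. by rewrite !enormE sqnormN. Qed.

Lemma enormZ (a : R) y : 0 <= a -> enorm (a *: y) = a * enorm y.
Proof.
move=> a0; rewrite -[X in X * _](ger0_norm a0) -sqrtr_sqr -sqrtrM ?sqr_ge0//.
congr Num.sqrt; rewrite mulr_sumr; apply: eq_bigr => k _.
by rewrite mxE exprMn.
Qed.

Lemma psi_fin (s : R) : 0 <= s < r -> psi s = (fine (psi s))%:E.
Proof.
move=> sr; have /andP[s0 sr'] := sr.
rewrite fineK// ge0_fin_numE; first exact: (gp_finite gp).
by apply: (gp_ge0 gp); rewrite s0 ltW.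
Qed.

Lemma psi_fine_ge0 (s : R) : 0 <= s <= r -> 0 <= fine (psi s).
Proof. by move=> sr; apply: fine_ge0; exact: (gp_ge0 gp). Qed.

Lemma total_potentialE q : (forall i j, E i j -> enorm (q j - q i) < r) ->
  total_potential E psi q = (potential E psi q)%:E.
Proof.
move=> qr; rewrite /total_potential /potential EFinM; congr (_ * _)%E.
rewrite -sumEFin; apply: eq_bigr => i _; rewrite -sumEFin; apply: eq_bigr => j Eij.
by rewrite /psi_sq -enormE psi_fin// enorm_ge0 qr.
Qed.

Lemma edge_le_potential q i j : (forall i j, E i j -> enorm (q j - q i) < r) ->
  E i j -> fine (psi (enorm (q j - q i))) <= 2 * potential E psi q.
Proof.
move=> qr Eij; rewrite /potential mulrA divff// mul1r.
have ge0 i' j' : E i' j' -> 0 <= psi_sq psi (sqnorm (q j' - q i')).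
  by move=> Eij'; rewrite psi_fine_ge0// enorm_ge0 ltW// qr.
rewrite (bigD1 i)//= (bigD1 j)//= -addrA lerDl addr_ge0//.
  by apply: sumr_ge0 => j' /andP[Eij' _]; exact: ge0.
by apply: sumr_ge0 => i' _; apply: sumr_ge0 => j' Eij'; exact: ge0.
Qed.

Lemma potential_ge0 q : (forall i j, E i j -> enorm (q j - q i) < r) ->
  0 <= potential E psi q.
Proof.
move=> qr; rewrite /potential mulr_ge0//.
by apply: sumr_ge0 => i _; apply: sumr_ge0 => j Eij; rewrite psi_fine_ge0// enorm_ge0 ltW// qr.
Qed.

Let psi_cvg (s : R) : 0 <= s <= r -> psi u @[u --> within `[0, r] (nbhs s)] --> psi s.
Proof.
move=> sr; have sI : `[0, r]%classic s by rewrite /= in_itv.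
have := @gp_continuous _ _ _ _ _ _ _ gp s.
by rewrite /continuous_at/= /nbhs/= -(nbhs_subspace_in sI).
Qed.

(** If psi blows up at r, a bound on the potential bounds each link away from
    r. *)
Let margin_infinite (L : R) : psi r = +oo%E -> exists2 rho, 0 <= rho < r &
  forall q, (forall i j, E i j -> enorm (q j - q i) < r) -> potential E psi q <= L ->
  forall i j, E i j -> enorm (q j - q i) <= rho.
Proof.
move=> psir; have := @psi_cvg r; rewrite lexx ltW// => /(_ isT).
rewrite psir => /cvgeyPgt/(_ (2 * L)); rewrite near_withinE => /nbhs_ballP[d /= d0 dP].
exists (Num.max 0 (r - d / 2)).
  by rewrite le_max lexx/= gt_max r0 ltrBlDr ltrDl divr_gt0.
move=> q qr qL i j Eij; rewrite leNgt; apply/negP; rewrite gt_max => /andP[e0 ed].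
have er := qr i j Eij; set e := enorm _ in e0 ed er.
have : ((2 * L)%:E < psi e)%E.
  apply: dP; last by rewrite /= in_itv/= !ltW.
  by rewrite /ball/= gtr0_norm ?subr_gt0//; lra.
rewrite (psi_fin (s := e)) ?er ?ltW// lte_fin.
have := edge_le_potential qr Eij; rewrite -/e => h; lra.
Qed.

(** Otherwise psi is uniformly continuous on [0, r].  Scaling a configuration
    until its longest link has length r changes the potential little if that
    link was already nearly of length r, while the scaled potential is at
    least Psimax. *)
Let margin_finite (L : R) : (L%:E < Psimax)%E -> (psi r < +oo)%E ->
  exists2 rho, 0 <= rho < r &
  forall q, (forall i j, E i j -> enorm (q j - q i) < r) -> potential E psi q <= L ->
  forall i j, E i j -> enorm (q j - q i) <= rho.
Proof.
move=> LP psir.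
have psi_fin' (s : R) : 0 <= s <= r -> psi s = (fine (psi s))%:E.
  move=> /[dup] sr /andP[s0]; rewrite le_eqVlt => /orP[/eqP sE|sr']; last first.
    by apply: psi_fin; rewrite s0.
  by rewrite fineK// ge0_fin_numE ?sE//; apply: (gp_ge0 gp); rewrite lexx ltW.
(* g extends psi from [0, r] to a continuous function on the real line. *)
pose pr (a : R) := Num.max 0 (Num.min r a).
have pr_itv a : 0 <= pr a <= r.
  by rewrite /pr le_max lexx/= ge_max ge_min lexx ltW.
have prE a : 0 <= a <= r -> pr a = a.
  by move=> /andP[h1 h2]; rewrite /pr (min_idPr h2) (max_idPr h1).
have cpr : continuous pr.
  move=> a; apply: continuous_max; first exact: cst_continuous.
  by apply: continuous_min; [exact: cst_continuous|].
pose g (a : R) := fine (psi (pr a)).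
have cg : continuous g.
  move=> a; apply/(@fine_cvg R _ (nbhs a) _ (fun a => psi (pr a))).
  rewrite -psi_fin'// => A PA.
  have H : nbhs (pr a) (fun u => `[0, r]%classic u -> A (psi u)) := psi_cvg (pr_itv a) PA.
  apply: (@filterS _ (nbhs a) _ _ _ _ (cpr a _ H)) => b; apply.
  by rewrite /= in_itv/=; exact: pr_itv.
(* N^2 bounds the number of ordered pairs of linked agents. *)
have [eta eta0 etaP] : exists2 eta, 0 < eta & ((L + 2^-1 * (N%:R * (N%:R * eta)))%:E < Psimax)%E.
  case: Psimax LP => [P|_|]; last by rewrite ltNge leNye.
    2: by exists 1; rewrite ?ltry.
  rewrite lte_fin => LP; pose K : R := N%:R * N%:R.
  have K0 : 0 <= K by rewrite mulr_ge0.
  have K1 : 0 < K + 1 by rewrite ltr_wpDl.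
  have [eta eta0 etaE] : exists2 eta, 0 < eta & eta * (K + 1) = P - L.
    by exists ((P - L) / (K + 1)); rewrite ?divfK ?gt_eqF// divr_gt0// subr_gt0.
  have KE : N%:R * (N%:R * eta) = K * eta by rewrite /K mulrA.
  have := mulr_ge0 K0 (ltW eta0); rewrite mulrDr mulr1 (mulrC eta) in etaE => h1.
  by exists eta => //; rewrite lte_fin KE; lra.
(* Uniform continuity, in the multiplicative form needed for scaling. *)
have : \forall s \near r, forall a, `[0, r]%classic a -> `|g (a * (r / s)) - g a| <= eta.
  have [H _] := compact_near_coveringP (`[0, r]%classic : set R).
  apply: (H (@segment_compact R 0 r) R (nbhs r)
    (fun s a => `|g (a * (r / s)) - g a| <= eta)) => a ar.
  pose h (p : R * R) := `|g (p.1 * (r / p.2)) - g p.1|.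
  have ch : {for (a, r), continuous h}.
    apply: (@continuous_comp _ _ _ (fun p : R * R => g (p.1 * (r / p.2)) - g p.1));
      last exact: norm_continuous.
    apply: continuousB.
      apply: (@continuous_comp _ _ _ (fun p : R * R => p.1 * (r / p.2)) g); last exact: cg.
      apply: continuousM; first exact: cvg_fst.
      apply: continuousM; first exact: cst_continuous.
      apply: continuousV => /=; first by rewrite gt_eqF.
      exact: cvg_snd.
    by apply: (@continuous_comp _ _ _ fst g); [exact: cvg_fst|exact: cg].
  have /cvgrPdist_lt/(_ _ eta0) := ch.
  rewrite /h/= divff ?gt_eqF// mulr1 subrr normr0.
  by apply: filterS => p /=; rewrite sub0r normrN normr_id => /ltW.
move=> /nbhs_ballP[d /= d0 dP].
exists (Num.max 0 (r - d / 2)).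
  by rewrite le_max lexx/= gt_max r0 ltrBlDr ltrDl divr_gt0.
move=> q qr qL i j Eij; rewrite leNgt; apply/negP => far.
pose len (p : 'I_N * 'I_N) := enorm (q p.2 - q p.1).
have Pij : [pred p : 'I_N * 'I_N | E p.1 p.2] (i, j) by [].
case: (@arg_maxP _ _ _ (i, j) [pred p : 'I_N * 'I_N | E p.1 p.2] len Pij) => -[i' j'] /= Eij' mx.
set s := len (i', j') in mx.
have sr : s < r by exact: qr.
have : Num.max 0 (r - d / 2) < s by apply: lt_le_trans far _; exact: (mx (i, j)).
rewrite gt_max => /andP[s0 sd].
have rs0 : 0 <= r / s by rewrite divr_ge0// ltW.
pose q' k := (r / s) *: q k.
have q'E k l : enorm (q' l - q' k) = r / s * enorm (q l - q k).
  by rewrite /q' -scalerBr enormZ.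
have q'r k l : E k l -> enorm (q' l - q' k) <= r.
  move=> Ekl; rewrite q'E mulrAC ler_pdivrMr// (ler_pM2l r0).
  exact: (mx (k, l) Ekl).
have q'm : enorm (q' j' - q' i') = r.
  by rewrite q'E -/(len (i', j')) -/s divfK// gt_eqF.
have := gp_max gp q'r (ex_intro _ i' (ex_intro _ j' (conj Eij' q'm))).
apply/negP; rewrite -ltNge; apply: le_lt_trans etaP.
have -> : total_potential E psi q'
    = (2^-1 * \sum_k \sum_(l | E k l) fine (psi (enorm (q' l - q' k))))%:E.
  rewrite /total_potential EFinM; congr (_ * _)%E.
  rewrite -sumEFin; apply: eq_bigr => k _; rewrite -sumEFin; apply: eq_bigr => l Ekl.
  by rewrite psi_fin'// enorm_ge0 q'r.
rewrite lee_fin; apply: le_trans (lerD qL (lexx _)).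
rewrite /potential -mulrDr ler_wpM2l ?invr_ge0//.
have -> : N%:R * (N%:R * eta) = \sum_(k < N) N%:R * eta.
  by rewrite sumr_const card_ord mulr_natl.
rewrite -big_split; apply: ler_sum => k _ /=.
apply: (@le_trans _ _ (\sum_(l | E k l) (psi_sq psi (sqnorm (q l - q k)) + eta))).
  apply: ler_sum => l Ekl; rewrite /psi_sq -enormE q'E.
  set e := enorm _.
  have er : 0 <= e <= r by rewrite enorm_ge0 ltW// qr.
  have er' : 0 <= e * (r / s) <= r by rewrite mulrC -q'E enorm_ge0 q'r.
  have := dP s; rewrite /ball/= gtr0_norm ?subr_gt0// => /(_ _ e).
  rewrite /= in_itv/= /g !prE// er mulrC => /(_ _ isT) h.
  have {}h := h ltac:(lra); move: h; rewrite ler_norml => /andP[_]; lra.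
rewrite big_split/= lerD2l sumr_const -[X in X <= _]mulr_natl ler_wpM2r ?(ltW eta0)//.
by rewrite ler_nat -[X in (_ <= X)%N]card_ord max_card.
Qed.

(** Configurations with links shorter than r and potential at most L < Psimax
    have their links uniformly shorter than r. *)
Theorem link_margin (L : R) : (L%:E < Psimax)%E -> exists2 rho, 0 <= rho < r &
  forall q, (forall i j, E i j -> enorm (q j - q i) < r) -> potential E psi q <= L ->
  forall i j, E i j -> enorm (q j - q i) <= rho.
Proof.
move=> LP; have : (psi r <= +oo)%E by rewrite leey.
rewrite le_eqVlt => /orP[/eqP|]; first exact: margin_infinite.
exact: margin_finite.
Qed.

End LinkMargin.

(** * The derivative of the potential *)

Section PotentialDerivative.
Context {R : realType}.
Variables (r : R) (psi : R -> \bar R) (d1 d2 : R -> R).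
Hypothesis d1P : forall u : R, 0 <= u < r ^+ 2 ->
  deriv_within `[0, r ^+ 2[ (psi_sq psi : R -> R^o) u (d1 u).
Hypothesis d2P : forall u : R, 0 <= u < r ^+ 2 ->
  deriv_within `[0, r ^+ 2[ (d1 : R -> R^o) u (d2 u).
Hypothesis cd2 : {within `[0, r ^+ 2[, continuous d2}.
Hypothesis d1_gt0 : forall u : R, 0 <= u < r ^+ 2 -> 0 < d1 u.

Section Truncation.
Variable rho : R.
Hypothesis rho_r : 0 <= rho < r.

(** Projection onto [0, rho^2]. *)
Definition proj_sq (u : R) : R := Num.max 0 (Num.min (rho ^+ 2) u).

(** The derivative of the potential, frozen beyond the squared distance
    rho^2; unlike d1 it is Lipschitz on the whole line. *)
Definition dtrunc (u : R) : R := d1 (proj_sq u).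

Let rho2 : 0 <= rho ^+ 2 < r ^+ 2.
Proof.
have /andP[h1 h2] := rho_r; rewrite sqr_ge0/= ltr_pXn2r// nnegrE//.
exact: le_trans (ltW h2).
Qed.

Let proj_itv u : 0 <= proj_sq u <= rho ^+ 2.
Proof. by rewrite /proj_sq le_max lexx/= ge_max ge_min lexx/= andbT; case/andP: rho2. Qed.

Let proj_r u : 0 <= proj_sq u < r ^+ 2.
Proof.
have /andP[-> h] := proj_itv u; rewrite (le_lt_trans h)//; by case/andP: rho2.
Qed.

Lemma proj_sqE u : 0 <= u <= rho ^+ 2 -> proj_sq u = u.
Proof. by move=> /andP[h1 h2]; rewrite /proj_sq (min_idPr h2) (max_idPr h1). Qed.

Lemma dtruncE u : 0 <= u <= rho ^+ 2 -> dtrunc u = d1 u.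
Proof. by move=> h; rewrite /dtrunc proj_sqE. Qed.

Let proj_cont : continuous proj_sq.
Proof.
move=> a; apply: continuous_max; first exact: cst_continuous.
by apply: continuous_min; [exact: cst_continuous|].
Qed.

Let proj_lip u u' : `|proj_sq u - proj_sq u'| <= `|u - u'|.
Proof.
have : 0 <= rho ^+ 2 by rewrite sqr_ge0.
rewrite /proj_sq; set s := rho ^+ 2 => s0; rewrite !maxEle !minEle.
case: (lerP s u) => ?; case: (lerP s u') => ?; 
  repeat case: ifP => /= ?; rewrite ?subrr ?normr0//; 
  rewrite ler_norml; apply/andP; split;
  have := ler_norm (u - u'); have := ler_norm (u' - u); rewrite (distrC u' u); lra.
Qed.

Lemma dtrunc_continuous : continuous dtrunc.
Proof.
move=> a; apply: (continuous_within_comp (d2P (proj_r a))); first exact: proj_cont.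
by near=> s; rewrite /= in_itv/= proj_r.
Unshelve. all: by end_near. Qed.

Lemma dtrunc_lipschitz : exists2 L : R, 0 <= L &
  forall a b, `|dtrunc a - dtrunc b| <= L * `|a - b|.
Proof.
have /andP[rho20 rho2r] := rho2.
have sub : `[0, rho ^+ 2] `<=` `[0, r ^+ 2[.
  by move=> u /=; rewrite !in_itv/= => /andP[-> h]; rewrite (le_lt_trans h).
have cd2' := continuous_subspaceW sub cd2.
have [a aI aM] := EVT_max rho20 cd2'; have [b bI bM] := EVT_min rho20 cd2'.
pose L := `|d2 a| + `|d2 b|.
have dL u : 0 <= u <= rho ^+ 2 -> `|d2 u| <= L.
  move=> uI; have h1 := aM u uI; have h2 := bM u uI.
  rewrite ler_norml /L; have := ler_norm (d2 a); have := ler_norm (- d2 b).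
  have := normr_ge0 (d2 a); have := normr_ge0 (d2 b).
  by rewrite normrN => *; apply/andP; split; lra.
have H u u' : 0 <= u -> u <= u' -> u' <= rho ^+ 2 ->
    `|dtrunc u' - dtrunc u| <= L * (u' - u).
  move=> u0 uu' u'r; apply: (@derive_bound _ dtrunc d2) => // s.
  - by move=> _; exact: dtrunc_continuous.
  - move=> /andP[us su']; have s0 : 0 < s by lra.
    have sr : s < rho ^+ 2 by lra.
    have := @is_derive_within_comp _ `[0, r ^+ 2[ d1 id s (d2 s) 1.
    rewrite mulr1 => D; apply: (@near_eq_is_derive _ _ _ d1).
      near=> w; rewrite dtruncE//; apply/andP; split; apply: ltW.
        by near: w; exact: lt_nbhsr.
      by near: w; exact: lt_nbhsl.
    apply: D; first by apply: d2P; rewrite ltW//= (lt_trans sr).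
    near=> w => /=; rewrite in_itv/=; apply/andP; split.
      by apply: ltW; near: w; exact: lt_nbhsr.
    by near: w; apply: lt_nbhsl; exact: lt_trans rho2r.
  - by move=> /andP[us su']; apply: dL; apply/andP; split; lra.
have L0 : 0 <= L by rewrite addr_ge0.
exists L => // u u'.
have E w : dtrunc w = dtrunc (proj_sq w) by rewrite [RHS]dtruncE.
apply: le_trans (ler_wpM2l L0 (proj_lip u u')).
rewrite (E u) (E u').
have /andP[a1 a2] := proj_itv u; have /andP[b1 b2] := proj_itv u'.
case: (lerP (proj_sq u) (proj_sq u')) => h; last by rewrite H// ltW.
by rewrite distrC H.
Unshelve. all: by end_near. Qed.

Lemma dtrunc_lower_bound : exists2 m : R, 0 < m & forall u, m <= dtrunc u.
Proof.
have /andP[rho20 rho2r] := rho2.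
have [a aI aM] := EVT_min rho20 (continuous_subspaceT dtrunc_continuous).
exists (dtrunc a); first exact: d1_gt0.
move=> u; rewrite {2}/dtrunc -(dtruncE (proj_itv u)); apply: aM.
by rewrite in_itv/=; exact: proj_itv.
Qed.

End Truncation.

(** A directional derivative is the derivative along a line. *)
Lemma derive_line (U : normedModType R) (f : U -> R) (a v : U) (l : R) :
  is_derive (0 : R) 1 (fun h : R => f (h *: v + a)) l -> 'D_v f a = l.
Proof.
move=> [_ <-]; rewrite /derive; congr (lim (_ @ 0^')).
by apply/funext => h /=; rewrite addr0 scale0r add0r [h *: 1]mulr1.
Qed.

(** As a function of the squared distance the potential is differentiable up to
    0, so its gradient also exists where the agents coincide. *)
Lemma potential_gradient n (p q : 'cV[R]_n) : sqnorm (p - q) < r ^+ 2 ->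
  gradient (fun x => fine (psi (enorm (p - x)))) q
  = (2 * d1 (sqnorm (p - q))) *: (q - p).
Proof.
move=> pqr; apply/colP => k; rewrite mxE; apply: derive_line.
pose u (h : R) := sqnorm (p - (h *: delta_mx k 0 + q)).
have du : is_derive (0 : R) 1 u (2 * (q - p) k 0).
  have -> : 2 * (q - p) k 0 = \sum_l 2 * (q - p) l 0 * (delta_mx k 0 : 'cV[R]_n) l 0.
    rewrite (bigD1 k)//= big1 ?addr0 => [|l lk]; last first.
      by rewrite [delta_mx _ _ _ _]mxE (negbTE lk) mulr0.
    by rewrite [delta_mx _ _ _ _]mxE !eqxx mulr1.
  apply: is_derive_bigsum => l _.
  have d : is_derive (0 : R) 1 (fun h => (p - (h *: delta_mx k 0 + q)) l 0)
      (- (delta_mx k 0 : 'cV[R]_n) l 0).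
    have -> : (fun h => (p - (h *: delta_mx k 0 + q)) l 0)
      = (fun h => p l 0 - q l 0 - (delta_mx k 0 : 'cV[R]_n) l 0 * h).
      by apply/funext => h; rewrite !mxE; ring.
    have := is_derive_sub (is_derive_cst (p l 0 - q l 0) (0 : R) 1)
      (@is_derive_scale _ id 0 ((delta_mx k 0 : 'cV[R]_n) l 0) 1 (is_derive_id _ _)).
    by rewrite mulr1 sub0r.
  have := is_derive_mul d d.
  rewrite [X in is_derive _ _ _ X -> _](_ : _ = 2 * (q - p) l 0 * (delta_mx k 0 : 'cV[R]_n) l 0)//.
  by rewrite !mxE; ring.
have u0 : u 0 = sqnorm (p - q) by rewrite /u scale0r add0r.
have -> : ((2 * d1 (sqnorm (p - q))) *: (q - p)) k 0 = d1 (u 0) * (2 * (q - p) k 0).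
  by rewrite u0 mxE; ring.
apply: (@is_derive_within_comp _ `[0, r ^+ 2[ (psi_sq psi) u).
- by apply: d1P; rewrite u0 sqnorm_ge0.
- have /cvgrPdist_lt/(_ (r ^+ 2 - sqnorm (p - q))) := is_derive_continuous du.
  rewrite subr_gt0 => /(_ pqr); apply: filterS => s.
  rewrite u0 ltr_norml => /andP[h _] /=.
  by rewrite in_itv/= sqnorm_ge0/=; move: h; rewrite -/(u s); lra.
Qed.

End PotentialDerivative.

(** * Trajectories of the closed loop *)

Section ClosedLoopSolutions.
Context {R : realType} {N n : nat}.
Variables (r : R) (E : rel 'I_N) (S : 'I_N -> euler_lagrange R n).
Variables (psi : R -> \bar R) (Psimax : \bar R).
Variables (c kappa : 'I_N -> R) (q0 v0 : 'I_N -> 'cV[R]_n).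
Variables (d1 d2 : R -> R).
Hypothesis r0 : 0 < r.
Hypothesis elS : forall i, el_properties (S i).
Hypothesis gp : generalized_potential n E r psi Psimax.
Hypothesis symE : symmetric E.
Hypothesis c0 : forall i, 0 < c i.
Hypothesis links0 : forall i j, E i j -> enorm (q0 j - q0 i) < r.
Hypothesis d1P : forall u : R, 0 <= u < r ^+ 2 ->
  deriv_within `[0, r ^+ 2[ (psi_sq psi : R -> R^o) u (d1 u).
Hypothesis d2P : forall u : R, 0 <= u < r ^+ 2 ->
  deriv_within `[0, r ^+ 2[ (d1 : R -> R^o) u (d2 u).
Hypothesis cd2 : {within `[0, r ^+ 2[, continuous d2}.
Notation state := (@coords N n -> R).
Notation short b q := (forall i j, E i j -> enorm (q j - q i) < b).

(** The initial condition; the filter states start at kappa q0. *)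
Definition initial_state : state := state_of q0 v0 (fun i => kappa i *: q0 i).

Notation V := (energy E S psi c kappa).
Let V0 := V initial_state.

Lemma kinetic_ge0 (x : state) i : 0 <= kinetic S x i.
Proof.
have [lam lam0 cM] := inertia_coercive elS i.
rewrite /kinetic /dot -row_colE mulmxA; apply: le_trans (cM _ _).
by rewrite mulr_ge0 ?(ltW lam0)//; exact: sqnorm_ge0.
Qed.

Lemma potential_le_energy (x : state) : potential E psi (pos_of x) <= V x.
Proof.
rewrite /energy lerDr; apply: sumr_ge0 => i _.
rewrite mulr_ge0 ?invr_ge0 ?(ltW (c0 i))// addr_ge0// mulr_ge0 ?invr_ge0//.
  exact: kinetic_ge0.
exact: sqnorm_ge0.
Qed.

(** The energy bounds velocities and filter rates, uniformly in the state. *)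
Lemma energy_bounds : exists B : R, forall x : state, short r (pos_of x) ->
  V x <= V0 -> forall i, enorm (vel_of x i) <= B /\ enorm (filt_rate kappa x i) <= B.
Proof.
have /choice[lam lamP] (i : 'I_N) : exists l : R, 0 < l /\
    forall p : 'cV[R]_n, coercive l (inertia (S i) p).
  by have [l l0 cM] := inertia_coercive elS i; exists l.
have lam0 i : 0 < lam i by case: (lamP i).
pose bv i := Num.sqrt (2 * c i * V0 / lam i); pose bw i := Num.sqrt (2 * c i * V0).
have b0 i : 0 <= bv i + bw i by rewrite addr_ge0 ?sqrtr_ge0.
exists (\sum_i (bv i + bw i)) => x xr xV i.
have bB : bv i + bw i <= \sum_i (bv i + bw i).
  by rewrite (bigD1 i)//= lerDl sumr_ge0.
have ci := c0 i; have ki := kinetic_ge0 x i; have wi := sqnorm_ge0 (filt_rate kappa x i).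
have term : (c i)^-1 * (2^-1 * kinetic S x i + 2^-1 * sqnorm (filt_rate kappa x i)) <= V0.
  apply: le_trans xV; rewrite /energy (bigD1 i)//= -addrA lerDl addr_ge0//;
    last exact: (potential_ge0 gp xr).
  apply: sumr_ge0 => j _; rewrite mulr_ge0 ?invr_ge0 ?(ltW (c0 j))//.
  rewrite addr_ge0// mulr_ge0 ?invr_ge0//.
    exact: kinetic_ge0.
  exact: sqnorm_ge0.
rewrite mulrC ler_pdivrMr// in term.
have kV : kinetic S x i <= 2 * c i * V0 by lra.
have wV : sqnorm (filt_rate kappa x i) <= 2 * c i * V0 by lra.
have vV : sqnorm (vel_of x i) <= 2 * c i * V0 / lam i.
  rewrite ler_pdivlMr// mulrC; apply: le_trans kV.
  rewrite /kinetic /dot -row_colE mulmxA; exact: (lamP i).2.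
have h1 : enorm (vel_of x i) <= bv i by exact: ler_wsqrtr.
have h2 : enorm (filt_rate kappa x i) <= bw i by exact: ler_wsqrtr.
have h3 : 0 <= bv i by exact: sqrtr_ge0.
have h4 : 0 <= bw i by exact: sqrtr_ge0.
by split; lra.
Qed.

Lemma pos_initial i : pos_of initial_state i = q0 i.
Proof. exact: pos_ofK. Qed.

Lemma short_regular (q : 'I_N -> 'cV[R]_n) : short r q -> regular r E psi d1 q.
Proof.
move=> qr i j Eij; have h := qr i j Eij; rewrite enorm_lt// in h.
by split=> //; apply: d1P; rewrite sqnorm_ge0.
Qed.

(** Once every solution that has kept its links strictly shorter than b has
    in fact kept them at most rho < b, no link ever exceeds rho. *)
Lemma links_bootstrap (x : R -> state) (T rho b : R) : 0 <= rho < b ->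
  (forall t i j, 0 <= t < T ->
     {for t, continuous (fun s => sqnorm (pos_of (x s) j - pos_of (x s) i))}) ->
  short b (pos_of (x 0)) ->
  (forall t, t <= T -> (forall s, 0 <= s < t -> short b (pos_of (x s))) ->
     forall s, 0 <= s < t -> forall i j, E i j -> enorm (pos_of (x s) j - pos_of (x s) i) <= rho) ->
  forall s, 0 <= s < T -> forall i j, E i j -> enorm (pos_of (x s) j - pos_of (x s) i) <= rho.
Proof.
move=> /andP[rho0 rhob] cx x0b step; apply: (step T) => //.
have b0 : 0 < b by exact: le_lt_trans rhob.
have sqb y : (enorm (y : 'cV[R]_n) < b) = (sqnorm y < b ^+ 2).
  by rewrite -enorm_sqr ltr_pXn2r// nnegrE ?enorm_ge0// ltW.
have rb2 : rho ^+ 2 < b ^+ 2 by rewrite ltr_pXn2r// nnegrE// ltW.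
apply: real_induction => t /andP[t0 tT] Pt.
- move: t0; rewrite le_eqVlt => /orP[/eqP<-//|t0] i j Eij.
  have tT' : 0 <= t < T by rewrite ltW.
  have st := step t (ltW tT) Pt.
  rewrite sqb ltNge; apply/negP => far.
  have /cvgrPdist_lt := cx t i j tT'.
  move=> /(_ (sqnorm (pos_of (x t) j - pos_of (x t) i) - rho ^+ 2)).
  rewrite subr_gt0 => /(_ (lt_le_trans rb2 far)) /nbhs_ballP[e /= e0 eP].
  pose s := Num.max (t / 2) (t - e / 2).
  have s0 : 0 <= s by rewrite le_max divr_ge0// ltW.
  have slt : s < t by rewrite gt_max; apply/andP; split; lra.
  have se : t - e / 2 <= s by rewrite le_max lexx orbT.
  have /eP : ball t e s by rewrite /ball/= gtr0_norm; lra.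
  have h : sqnorm (pos_of (x s) j - pos_of (x s) i) <= rho ^+ 2.
    by rewrite -enorm_sqr lerXn2r// ?nnegrE ?enorm_ge0// st// s0.
  rewrite ltr_norml => /andP[_]; lra.
- have Pb := Pt; have tT' : 0 <= t < T by rewrite t0.
  have : \forall s \near t, forall p : 'I_N * 'I_N, E p.1 p.2 ->
      sqnorm (pos_of (x s) p.2 - pos_of (x s) p.1) < b ^+ 2.
    apply: (@filter_forall R _ (fun p s => E p.1 p.2 ->
      sqnorm (pos_of (x s) p.2 - pos_of (x s) p.1) < b ^+ 2) (nbhs t)) => -[i j] /=.
    have [Eij|nE] := boolP (E i j); last by near=> s.
    have h := Pb i j Eij; rewrite sqb in h.
    have /cvgrPdist_lt := cx t i j tT'.
    move=> /(_ (b ^+ 2 - sqnorm (pos_of (x t) j - pos_of (x t) i))).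
    rewrite subr_gt0 => /(_ h); apply: filterS => s.
    by rewrite ltr_norml => /andP[hs _] _; lra.
  move=> /nbhs_ballP[e /= e0 xe]; exists e => // s /andP[ts se] i j Eij.
  rewrite sqb; apply: (xe s _ (i, j) Eij).
  by rewrite /ball/= ltr_norml; apply/andP; split; lra.
Unshelve. all: by end_near. Qed.

(** A margin rho for the configurations with potential at most V0. *)
Section Margin.
Variable rho : R.
Hypothesis rho_r : 0 <= rho < r.
Hypothesis margin : forall q : 'I_N -> 'cV[R]_n, short r q -> potential E psi q <= V0 ->
  forall i j, E i j -> enorm (q j - q i) <= rho.

Lemma solution_energy dpsi T (x : R -> state) :
  solves (field E S c kappa dpsi) T x -> x 0 = initial_state ->
  (forall s, 0 <= s < T -> regular r E psi dpsi (pos_of (x s))) ->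
  forall s, 0 <= s < T -> V (x s) <= V0.
Proof.
move=> xS x0 reg s /andP[s0 sT].
have := @energy_nonincreasing R N n r E S psi c kappa elS symE c0 dpsi T x xS 0 s.
rewrite x0; apply=> // t' /andP[t'0 t's]; apply: reg.
by rewrite t'0 (le_lt_trans t's).
Qed.

(** Below the initial energy, [margin] applies all along the solution. *)
Lemma solution_margin dpsi T (x : R -> state) :
  solves (field E S c kappa dpsi) T x -> x 0 = initial_state ->
  (forall s, 0 <= s < T -> regular r E psi dpsi (pos_of (x s))) ->
  forall s, 0 <= s < T -> forall i j, E i j -> enorm (pos_of (x s) j - pos_of (x s) i) <= rho.
Proof.
move=> xS x0 reg s sT; apply: margin.
  by move=> i j Eij; rewrite enorm_lt//; case: (reg s sT i j Eij).
by apply: le_trans (potential_le_energy _) _; exact: (solution_energy xS).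
Qed.

Lemma initial_margin i j : E i j -> enorm (pos_of initial_state j - pos_of initial_state i) <= rho.
Proof.
apply: margin => [k l Ekl|]; first by rewrite !pos_initial links0.
exact: potential_le_energy.
Qed.

(* The freezing distance lies strictly between rho and r. *)
Let rho' := (rho + r) / 2.
Let rho'_r : 0 <= rho' < r.
Proof. by have /andP[h1 h2] := rho_r; rewrite /rho'; apply/andP; split; lra. Qed.

(** The derivative of the potential as a function of the squared distance,
    frozen at the distance halfway between rho and r. *)
Definition dfrozen := dtrunc d1 rho'.

Let rho_rho' : rho < rho'.
Proof. by have /andP[h1 h2] := rho_r; rewrite /rho'; lra. Qed.

Lemma dfrozenE (y : 'cV[R]_n) : enorm y < rho' -> dfrozen (sqnorm y) = d1 (sqnorm y).
Proof.
move=> h; apply: dtruncE; rewrite sqnorm_ge0 -enorm_sqr/= lerXn2r// ?nnegrE ?enorm_ge0//.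
  by case/andP: rho'_r.
exact: ltW.
Qed.

Lemma field_frozen (x : state) :
  (forall i j, E i j -> enorm (pos_of x j - pos_of x i) <= rho) ->
  field E S c kappa dfrozen x = field E S c kappa d1 x.
Proof.
move=> xr; rewrite /field; congr state_of; apply/funext => i.
rewrite /acc; congr (_ *m _); rewrite /acc_rhs; congr (- (_ *: _) - _ - _).
by apply: eq_bigr => j Eij; rewrite dfrozenE// (le_lt_trans (xr i j Eij)).
Qed.

Lemma short_frozen_regular (q : 'I_N -> 'cV[R]_n) : short rho' q -> regular r E psi dfrozen q.
Proof.
move=> qr i j Eij; have h := qr i j Eij; rewrite dfrozenE//; apply: short_regular => //.
by move=> k l Ekl; apply: lt_trans (qr k l Ekl) _; case/andP: rho'_r.
Qed.

(** The solutions of the equation with the frozen derivative keep their links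
    at most rho, hence never see where the derivative was frozen. *)
Lemma frozen_links T (x : R -> state) :
  solves (field E S c kappa dfrozen) T x -> x 0 = initial_state ->
  forall s, 0 <= s < T -> forall i j, E i j -> enorm (pos_of (x s) j - pos_of (x s) i) <= rho.
Proof.
move=> xS x0; have /andP[rho0 _] := rho_r.
apply: (@links_bootstrap x T rho rho'); first by rewrite rho0.
- by move=> t i j; exact: (continuous_sqdist xS).
- by rewrite x0 => i j Eij; apply: le_lt_trans (initial_margin Eij) _.
- move=> t tT short_t; apply: (@solution_margin dfrozen t x) => //.
    exact: solves_le xS.
  by move=> s st; apply: short_frozen_regular; exact: short_t.
Qed.

Lemma field_frozen_locally_lipschitz : locally_lipschitz (field E S c kappa dfrozen).
Proof.
have [L _ HL] := dtrunc_lipschitz d2P cd2 rho'_r.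
exact: field_locally_lipschitz HL.
Qed.

(** Positions grow at most linearly, since velocities are bounded. *)
Lemma no_blow_up_frozen : no_blow_up (field E S c kappa dfrozen) initial_state.
Proof.
have [B BP] := energy_bounds; move=> T T0.
pose Q := \sum_i \sum_k `|q0 i k 0|.
pose K := \sum_i `|kappa i|.
have Q0 : 0 <= Q by apply: sumr_ge0 => i _; exact: sumr_ge0.
have K0 : 0 <= K by apply: sumr_ge0.
pose P := Q + `|B| * T.
have P0 : 0 <= P by rewrite addr_ge0// mulr_ge0// ltW.
exists (P + `|B| + (K * P + `|B|)) => T' x T'T xS x0.
have links := frozen_links xS x0.
have reg s : 0 <= s < T' -> regular r E psi dfrozen (pos_of (x s)).
  move=> sT; apply: short_frozen_regular => i j Eij.
  by apply: le_lt_trans (links s sT i j Eij) _.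
have xr s : 0 <= s < T' -> short r (pos_of (x s)).
  by move=> sT i j Eij; apply: le_lt_trans (links s sT i j Eij) _; case/andP: rho_r.
have Vs := solution_energy xS x0 reg.
have vB s i k : 0 <= s < T' -> `|vel_of (x s) i k 0| <= `|B|.
  move=> sT; apply: (le_trans (coord_le_enorm _ _)); apply: le_trans (ler_norm B).
  by case: (BP (x s) (xr s sT) (Vs s sT) i).
have wB s i k : 0 <= s < T' -> `|filt_rate kappa (x s) i k 0| <= `|B|.
  move=> sT; apply: (le_trans (coord_le_enorm _ _)); apply: le_trans (ler_norm B).
  by case: (BP (x s) (xr s sT) (Vs s sT) i).
have qP s i k : 0 <= s < T' -> `|pos_of (x s) i k 0| <= P.
  move=> /andP[s0 sT].
  have := @derive_bound _ (fun t => pos_of (x t) i k 0)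
    (fun t => vel_of (x t) i k 0) 0 s `|B| s0.
  rewrite subr0 => /(_ _ _ _) H.
  have {}H : `|pos_of (x s) i k 0 - pos_of (x 0) i k 0| <= `|B| * s.
    apply: H => [t /andP[t0 ts]|t /andP[t0 ts]|t /andP[t0 ts]].
    - by apply: (continuous_pos xS); rewrite t0 (le_lt_trans ts).
    - by apply: (is_derive_pos xS); rewrite t0 (lt_trans ts).
    - by apply: vB; rewrite ltW//= (lt_trans ts).
  have h : `|q0 i k 0| <= Q.
    rewrite /Q (bigD1 i)//= (bigD1 k)//= -addrA lerDl addr_ge0//.
      exact: sumr_ge0.
    by apply: sumr_ge0 => j _; exact: sumr_ge0.
  have h' : `|B| * s <= `|B| * T by rewrite ler_wpM2l// ltW// (lt_le_trans sT).
  rewrite x0 pos_initial in H.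
  have -> : pos_of (x s) i k 0 = (pos_of (x s) i k 0 - q0 i k 0) + q0 i k 0 by rewrite subrK.
  by rewrite (le_trans (ler_normD _ _))// /P addrC lerD// (le_trans H).
have KP : 0 <= K * P by rewrite mulr_ge0.
have B0 := normr_ge0 B.
move=> t [[[i k]|[i k]]|[i k]] tT.
- have := qP t i k tT; rewrite mxE; lra.
- have := vB t i k tT; rewrite mxE; lra.
- have -> : x t (inr (i, k)) = kappa i * pos_of (x t) i k 0 - filt_rate kappa (x t) i k 0.
    by rewrite /filt_rate !mxE; ring.
  rewrite (le_trans (ler_normB _ _))//.
  have := wB t i k tT; rewrite normrM.
  have : `|kappa i| * `|pos_of (x t) i k 0| <= K * P.
    rewrite ler_pM ?qP// /K (bigD1 i)//= lerDl; exact: sumr_ge0.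
  lra.
Qed.

(** The state of a trajectory, extended to negative times by its initial
    value. *)
Definition traj_state (tr : trajectory R N n) (t : R) : state :=
  state_of (pos tr (Num.max t 0)) (vel tr (Num.max t 0)) (filt tr (Num.max t 0)).

Notation loop T tr := (closed_loop_on r E S psi c kappa q0 v0 T tr).

Lemma traj_stateE tr t : 0 <= t ->
  traj_state tr t = state_of (pos tr t) (vel tr t) (filt tr t).
Proof. by move=> t0; rewrite /traj_state (max_idPl t0). Qed.

Lemma traj_state0 T tr : loop T tr -> traj_state tr 0 = initial_state.
Proof.
move=> [init _ _]; rewrite traj_stateE// /initial_state.
by congr state_of; apply/funext => i; case: (init i).
Qed.

Lemma links_keptE (q : 'I_N -> 'cV[R]_n) : links_kept r E q <-> short r q.
Proof.
by split=> h i j Eij; rewrite -enormN opprB; apply: h.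
Qed.

Lemma control_pull (q : 'I_N -> 'cV[R]_n) i (dz : 'cV[R]_n) : short r q ->
  control E S psi c kappa q i dz
  = - (c i *: pull E d1 q i) - kappa i *: dz + gravity (S i) (q i).
Proof.
move=> qr; rewrite /control; congr (- (_ *: _) - _ + _).
apply: eq_bigr => j Eij; rewrite (potential_gradient d1P)//.
by rewrite -enorm_lt// qr.
Qed.

(** In coordinates, the dynamics of the agents is the equation x' = field x. *)
Lemma dynamics_field (tr : trajectory R N n) t a :
  short r (pos tr t) -> (forall i, agent_dynamics E S psi c kappa tr t i) ->
  deriv_within `[0, +oo[
    ((fun s => state_of (pos tr s) (vel tr s) (filt tr s) a) : R -> R^o) t
    (field E S c kappa d1 (state_of (pos tr t) (vel tr t) (filt tr t)) a).
Proof.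
move=> qr dyn; pose y := state_of (pos tr t) (vel tr t) (filt tr t).
have posy i : pos_of y i = pos tr t i by exact: pos_ofK.
have vely i : vel_of y i = vel tr t i by exact: vel_ofK.
have pull_y i : pull E d1 (pos_of y) i = pull E d1 (pos tr t) i.
  by congr (pull _ _ _ _); apply/funext => j; exact: pos_ofK.
have filty i : filt_rate kappa y i = - filt tr t i + kappa i *: pos tr t i.
  by rewrite /filt_rate pos_ofK filt_ofK.
case: a => [[[i k]|[i k]]|[i k]] /=; have [av [dz [dq dv df dM dzE]]] := dyn i.
- rewrite vely; exact: (deriv_within_mxP _ _ _ _).1 dq k.
- suff -> : acc E S c kappa d1 y i = av by exact: (deriv_within_mxP _ _ _ _).1 dv k.
  have [lam lam0 cM] := inertia_coercive elS i.
  have Mu : inertia (S i) (pos_of y i) \in unitmx by exact: coercive_unitmx lam0 (cM _).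
  rewrite /acc -[RHS](mulKmx Mu); congr (_ *m _).
  rewrite posy /acc_rhs pull_y filty vely posy -dzE.
  move: dM; rewrite control_pull// => /addIr <-.
  by rewrite addrK.
- rewrite filty -dzE; exact: (deriv_within_mxP _ _ _ _).1 df k.
Qed.

(** As long as no link is lost, a trajectory of the closed loop solves the
    equation x' = field x. *)
Lemma closed_loop_solves T tr (T1 : R) : loop T tr -> (T1%:E <= T)%E ->
  (forall s, 0 <= s < T1 -> short r (pos tr s)) ->
  solves (field E S c kappa d1) T1 (traj_state tr).
Proof.
move=> [_ _ dyn] T1T links.
have D t a : 0 <= t < T1 -> deriv_within `[0, +oo[
    ((fun s => state_of (pos tr s) (vel tr s) (filt tr s) a) : R -> R^o) t
    (field E S c kappa d1 (state_of (pos tr t) (vel tr t) (filt tr t)) a).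
  move=> tT; have /andP[t0 tT1] := tT.
  apply: dynamics_field; first exact: links.
  apply: dyn => //; first by rewrite (lt_le_trans _ T1T)// lte_fin.
  by move=> s /andP[s0 st]; apply/links_keptE; apply: links; rewrite s0 (le_lt_trans st).
split=> t a /andP[t0 tT].
- apply: (@continuous_within_comp _ `[0, +oo[
    (fun s => state_of (pos tr s) (vel tr s) (filt tr s) a) (fun s => Num.max s 0) t
    (field E S c kappa d1 (state_of (pos tr t) (vel tr t) (filt tr t)) a)).
  + by rewrite /= (max_idPl t0); apply: D; rewrite t0.
  + by apply: continuous_max; [|exact: cst_continuous].
  + by near=> s; rewrite /= in_itv/= le_max lexx orbT.
- rewrite traj_stateE ?ltW//.
  apply: (@near_eq_is_derive _ _ _ (fun s => state_of (pos tr s) (vel tr s) (filt tr s) a)).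
    near=> s; rewrite traj_stateE//; apply: ltW; near: s; exact: lt_nbhsr.
  by apply: deriv_within_is_derive => //; apply: D; rewrite ltW.
Unshelve. all: by end_near. Qed.

Lemma traj_pos_continuous T tr t i k : loop T tr -> 0 <= t -> (t%:E < T)%E ->
  {for t, continuous (fun s => pos_of (traj_state tr s) i k 0)}.
Proof.
move=> [_ cpos _] t0 tT.
have -> : (fun s => pos_of (traj_state tr s) i k 0)
  = (fun s => pos tr (Num.max s 0) i k 0).
  by apply/funext => s; rewrite pos_ofK.
suff cq : {for t, continuous (fun s : R => pos tr (Num.max s 0) i)}.
  have cc := @coord_continuous R n 1 k 0 (pos tr (Num.max t 0) i).
  exact: (@continuous_comp _ _ _ (fun s : R => pos tr (Num.max s 0) i)
    (fun M : 'cV[R]_n => M k 0) t cq cc).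
have tD : [set t : R | 0 <= t /\ (t%:E < T)%E] t by [].
have := @cpos i t; rewrite /continuous_at/= /nbhs/= -(nbhs_subspace_in tD) => H A PA.
have HA : nbhs t (fun s => (0 <= s /\ (s%:E < T)%E) -> A (pos tr s i)).
  by apply: H; move: PA; rewrite /= (max_idPl t0).
have cm : {for t, continuous (fun s : R => Num.max s 0)}.
  by apply: continuous_max; [|exact: cst_continuous].
rewrite -[X in nbhs X _](max_idPl t0) in HA.
have tT' : \forall s \near t, (s%:E < T)%E.
  case: T tT {H HA tD cpos} => [T'||//].
    by rewrite lte_fin => tT'; near=> s; rewrite lte_fin; near: s; exact: lt_nbhsl.
  by move=> _; near=> s; rewrite ltry.
apply: filterS2 tT' (cm _ HA) => s sT; apply.
by rewrite le_max lexx orbT; split=> //; rewrite maxEle; case: ifP => // _; exact: le_lt_trans tT.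
Unshelve. all: by end_near. Qed.

Lemma real_horizon (T : \bar R) t : (t%:E < T)%E -> exists2 T1 : R, t < T1 & (T1%:E <= T)%E.
Proof.
case: T => [T||//]; first by rewrite lte_fin => tT; exists T.
by move=> _; exists (t + 1); rewrite ?ltrDl ?leey.
Qed.

Lemma closed_loop_links_upto T tr (T1 : R) : loop T tr -> (T1%:E <= T)%E ->
  forall s, 0 <= s < T1 -> forall i j, E i j ->
    enorm (pos_of (traj_state tr s) j - pos_of (traj_state tr s) i) <= rho.
Proof.
move=> L T1T; apply: (@links_bootstrap (traj_state tr) T1 rho r) => //.
- move=> t i j /andP[t0 tT].
  have cp l k : {for t, continuous (fun s => pos_of (traj_state tr s) l k 0)}.
    by apply: (@traj_pos_continuous T tr t l k L t0); apply: lt_le_trans T1T; rewrite lte_fin.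
  apply: continuous_bigsum => k _.
  have d : {for t, continuous (fun s =>
      (pos_of (traj_state tr s) j - pos_of (traj_state tr s) i) k 0)}.
    have -> : (fun s => (pos_of (traj_state tr s) j - pos_of (traj_state tr s) i) k 0)
      = (fun s => pos_of (traj_state tr s) j k 0 - pos_of (traj_state tr s) i k 0).
      by apply/funext => s; rewrite !mxE.
    by apply: continuousB.
  exact: (continuousM d).
- rewrite (traj_state0 L) => i j Eij; apply: le_lt_trans (initial_margin Eij) _.
  by case/andP: rho_r.
- move=> t tT short_t; apply: (@solution_margin d1 t (traj_state tr)).
  + apply: (closed_loop_solves L); first by apply: le_trans T1T; rewrite lee_fin.
    move=> s /[dup] st /andP[s0 _] i j Eij; have := short_t s st i j Eij.
    by rewrite traj_stateE// !pos_ofK.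
  + exact: traj_state0 L.
  + by move=> s st; apply: short_regular; exact: short_t.
Qed.

Lemma closed_loop_links T tr t : loop T tr -> 0 <= t -> (t%:E < T)%E ->
  forall i j, E i j -> enorm (pos tr t j - pos tr t i) <= rho.
Proof.
move=> L t0 tT i j Eij; have [T1 tT1 T1T] := real_horizon tT.
have := @closed_loop_links_upto T tr T1 L T1T t _ i j Eij.
by rewrite t0 tT1 traj_stateE// !pos_ofK; apply.
Qed.

Lemma closed_loop_solves_d1 T tr (T1 : R) : loop T tr -> (T1%:E <= T)%E ->
  solves (field E S c kappa d1) T1 (traj_state tr).
Proof.
move=> L T1T; apply: (closed_loop_solves L) => // s /andP[s0 sT] i j Eij.
have sT' : (s%:E < T)%E by apply: lt_le_trans T1T; rewrite lte_fin.
by apply: le_lt_trans (closed_loop_links L s0 sT' Eij) _; case/andP: rho_r.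
Qed.

Lemma closed_loop_solves_frozen T tr (T1 : R) : loop T tr -> (T1%:E <= T)%E ->
  solves (field E S c kappa dfrozen) T1 (traj_state tr).
Proof.
move=> L T1T; have [cx dx] := closed_loop_solves_d1 L T1T; split=> // t a tT.
rewrite field_frozen; first exact: dx.
by apply: (closed_loop_links_upto L T1T); case/andP: tT => /ltW -> ->.
Qed.

Lemma closed_loop_unique T T' tr tr' t : loop T tr -> loop T' tr' ->
  0 <= t -> (t%:E < T)%E -> (t%:E < T')%E -> traj_state tr t = traj_state tr' t.
Proof.
move=> L L' t0 tT tT'.
have [T1 tT1 T1T] := real_horizon tT; have [T2 tT2 T2T] := real_horizon tT'.
pose U := Num.min T1 T2.
have tU : t < U by rewrite lt_min tT1.
have UT1 : U <= T1 by rewrite ge_min lexx.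
have UT2 : U <= T2 by rewrite ge_min lexx orbT.
have x1 := solves_le UT1 (closed_loop_solves_frozen L T1T).
have x2 := solves_le UT2 (closed_loop_solves_frozen L' T2T).
have [B BP] := no_blow_up_frozen (le_lt_trans t0 tU).
have [K K0 KP] := field_frozen_locally_lipschitz (normr_ge0 B).
have B1 := BP U _ (lexx _) x1 (traj_state0 L).
have B2 := BP U _ (lexx _) x2 (traj_state0 L').
apply: (solves_unique KP (ltW K0) x1 x2).
- by rewrite (traj_state0 L) (traj_state0 L').
- by move=> s a sU; apply: le_trans (B1 s a sU) (ler_norm _).
- by move=> s a sU; apply: le_trans (B2 s a sU) (ler_norm _).
- by rewrite t0.
Qed.

Theorem closed_loop_exists : exists tr, loop +oo%E tr.
Proof.
have [x [x0 dx]] := locally_lipschitz_global_solution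
  field_frozen_locally_lipschitz no_blow_up_frozen.
have xS T : solves (field E S c kappa dfrozen) T x.
  split=> t a /andP[t0 _]; last by apply: dx; exact: ltW.
  by apply: is_derive_continuous; exact: dx.
pose tr := Trajectory (fun t => pos_of (x t)) (fun t => vel_of (x t)) (fun t => filt_of (x t)).
exists tr; split.
- by move=> i; rewrite /= x0 pos_ofK vel_ofK filt_ofK.
- move=> i; apply: continuous_in_subspaceT => t; rewrite inE => -[t0 _].
  apply: continuous_cV => k; apply: (continuous_pos (xS (t + 1))).
  by rewrite t0 ltrDl ltr01.
- move=> t t0 _ _ i.
  have links : forall i j, E i j -> enorm (pos_of (x t) j - pos_of (x t) i) <= rho.
    by apply: (frozen_links (xS (t + 1)) x0); rewrite t0 ltrDl ltr01.
  have links' : short r (pos_of (x t)).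
    by move=> k l Ekl; apply: le_lt_trans (links k l Ekl) _; case/andP: rho_r.
  have d a : is_derive t 1 (x ^~ a) (field E S c kappa d1 (x t) a).
    by rewrite -field_frozen//; exact: dx.
  exists (acc E S c kappa d1 (x t) i), (filt_rate kappa (x t) i); split => //.
  + apply/deriv_within_mxP => k; apply: is_derive_deriv_within.
    have -> : (fun s : R => pos tr s i k 0) = x ^~ (inl (inl (i, k))).
      by apply/funext => s; rewrite /= mxE.
    exact: d (inl (inl (i, k))).
  + apply/deriv_within_mxP => k; apply: is_derive_deriv_within.
    have -> : (fun s : R => vel tr s i k 0) = x ^~ (inl (inr (i, k))).
      by apply/funext => s; rewrite /= mxE.
    exact: d (inl (inr (i, k))).
  + apply/deriv_within_mxP => k; apply: is_derive_deriv_within.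
    have -> : (fun s : R => filt tr s i k 0) = x ^~ (inr (i, k)).
      by apply/funext => s; rewrite /= mxE.
    exact: d (inr (i, k)).
  + by rewrite /= control_pull// inertia_acc// subrK.
Qed.

End Margin.
End ClosedLoopSolutions.

(** * Convergence *)

Section Vanishing.
Context {R : realType}.
Implicit Types (f g h : R -> R) (s t e : R).

(** f tends to 0 at +oo. *)
Definition vanishes f : Prop :=
  forall e, 0 < e -> exists T : R, forall t, T <= t -> `|f t| <= e.

(** Cauchy criterion at +oo. *)
Definition settles f : Prop :=
  forall e, 0 < e -> exists T : R, forall s t, T <= s -> T <= t -> `|f s - f t| <= e.

Lemma vanishes_le f g (T0 : R) : (forall t, T0 <= t -> `|f t| <= `|g t|) ->
  vanishes g -> vanishes f.
Proof.
move=> fg Hg e e0; have [T HT] := Hg e e0; exists (Num.max T0 T) => t.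
by rewrite ge_max => /andP[t0 tT]; rewrite (le_trans (fg t t0))// HT.
Qed.

Lemma vanishes0 : vanishes (fun=> 0).
Proof. by move=> e e0; exists 0 => t _; rewrite normr0 ltW. Qed.

Lemma vanishes_add f g : vanishes f -> vanishes g -> vanishes (fun t => f t + g t).
Proof.
move=> Hf Hg e e0; have e2 : 0 < e / 2 by rewrite divr_gt0.
have [T HT] := Hf _ e2; have [T' HT'] := Hg _ e2; exists (Num.max T T') => t.
rewrite ge_max => /andP[t1 t2]; rewrite (le_trans (ler_normD _ _))//.
by have := HT t t1; have := HT' t t2; lra.
Qed.

Lemma vanishes_mul f g (B T0 : R) : (forall t, T0 <= t -> `|f t| <= B) ->
  vanishes g -> vanishes (fun t => f t * g t).
Proof.
move=> fB Hg e e0.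
have B1 : 0 < `|B| + 1 by rewrite ltr_wpDl.
have [T HT] := Hg (e / (`|B| + 1)) (divr_gt0 e0 B1).
exists (Num.max T0 T) => t; rewrite ge_max => /andP[t1 t2]; rewrite normrM.
have -> : e = (`|B| + 1) * (e / (`|B| + 1)) by rewrite mulrC divfK// gt_eqF.
rewrite ler_pM//; last exact: HT.
by rewrite (le_trans (fB t t1))// (le_trans (ler_norm B))// lerDl.
Qed.

Lemma vanishes_scale (a : R) f : vanishes f -> vanishes (fun t => a * f t).
Proof. exact: (@vanishes_mul (fun=> a) f `|a| 0). Qed.

Lemma vanishes_opp f : vanishes f -> vanishes (fun t => - f t).
Proof. by apply: (@vanishes_le _ _ 0) => t _; rewrite normrN. Qed.

Lemma vanishes_sum (J : finType) (P : pred J) (h : J -> R -> R) :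
  (forall j, P j -> vanishes (h j)) -> vanishes (fun t => \sum_(j | P j) h j t).
Proof.
move=> H; have -> : (fun t => \sum_(j | P j) h j t) = \sum_(j | P j) h j.
  by apply/funext => t; rewrite fct_sumE.
elim/big_ind : _ => //; first exact: vanishes0.
by move=> u v; exact: vanishes_add.
Qed.

Lemma vanishes_sqr f : vanishes (fun t => f t ^+ 2) -> vanishes f.
Proof.
move=> H e e0; have [T HT] := H (e ^+ 2) (exprn_gt0 2 e0); exists T => t /HT.
by rewrite normrX ler_pXn2r// nnegrE ltW.
Qed.

Lemma vanishes_settles f : vanishes f -> settles f.
Proof.
move=> Hf e e0; have e2 : 0 < e / 2 by rewrite divr_gt0.
have [T HT] := Hf _ e2; exists T => s t /HT h /HT h'.
by rewrite (le_trans (ler_normB _ _))//; lra.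
Qed.

Lemma nonincreasing_settles f :
  (forall s t, 0 <= s -> s <= t -> f t <= f s) -> (forall t, 0 <= t -> 0 <= f t) ->
  settles f.
Proof.
move=> fdecr f0 e e0; pose A : set R := [set f t | t in [set t | 0 <= t]].
have Ainf : has_inf A.
  by split; [exists (f 0), 0 => /=|exists 0 => _ [t /= t0 <-]; exact: f0].
have [_ [T /= T0 <-] fT] := inf_adherent e0 Ainf.
have low t : 0 <= t -> inf A <= f t.
  by move=> t0; apply: ge_inf; [case: Ainf|exists t].
exists T => s t sT tT.
have := fdecr _ _ T0 sT; have := fdecr _ _ T0 tT.
have := low s (le_trans T0 sT); have := low t (le_trans T0 tT).
by rewrite ler_norml => *; apply/andP; split; lra.
Qed.

(** The half-line and the distance for which Lipschitz functions of time are
    considered. *)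
Definition positive_times : set R := [set t | 0 < t].
Definition time_dist (s t : R) : R := `|s - t|.
Notation bl := (bounded_lipschitz positive_times time_dist).

Lemma bl_bounded f : bl f -> exists B : R, forall t, 0 < t -> `|f t| <= B.
Proof. by move=> [B [L [_ _ H _]]]; exists B. Qed.

Lemma bl_derive f f' (B M : R) : (forall t, 0 < t -> is_derive t 1 f (f' t)) ->
  (forall t, 0 < t -> `|f t| <= B) -> (forall t, 0 < t -> `|f' t| <= M) -> bl f.
Proof.
move=> df fB f'M; have B0 := le_trans (normr_ge0 _) (fB 1 ltr01).
have M0 := le_trans (normr_ge0 _) (f'M 1 ltr01).
have H s t : 0 < s -> s <= t -> `|f t - f s| <= M * (t - s).
  move=> s0 st; apply: (@derive_bound _ f f') => // w /andP[sw wt].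
  - by apply: is_derive_continuous (df w _); lra.
  - by apply: df; lra.
  - by apply: f'M; lra.
exists B, M; split=> // s t s0 t0; rewrite /time_dist.
case: (lerP s t) => st; last by rewrite H// ltW.
by rewrite distrC H.
Qed.

(** A variant of Barbalat's lemma: where g is not small, it keeps away from 0 for
    a fixed time by the Lipschitz condition, so that f changes by a fixed
    amount. *)
Lemma barbalat f g h : (forall t, 0 < t -> is_derive t 1 f (g t + h t)) ->
  bl g -> vanishes h -> settles f -> vanishes g.
Proof.
move=> df [B [L [B0 L0 gB gL]]] Hh Hf e e0.
have L1 : 0 < 4 * (L + 1) by rewrite mulr_gt0// ltr_wpDl.
(* On an interval of length eta the function g varies by less than e / 4. *)
pose eta := e / (4 * (L + 1)).
have eta0 : 0 < eta by rewrite divr_gt0.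
have etaE : 4 * (L * eta) + 4 * eta = e.
  by rewrite /eta; field; rewrite gt_eqF// ltr_wpDl.
have e4 : 0 < e / 4 by rewrite divr_gt0.
have [T1 HT1] := Hh _ e4; have [T2 HT2] := Hf _ (mulr_gt0 eta0 e4).
exists (Num.max 1 (Num.max T1 T2)) => t; rewrite !ge_max => /andP[t1 /andP[tT1 tT2]].
have t0 : 0 < t by lra.
have tt : t <= t + eta by rewrite lerDl ltW.
have := @derive_bound _ (fun s => f s - g t * s) (fun s => g s + h s - g t * 1)
  t (t + eta) (e / 2) tt.
have dphi s : 0 < s -> is_derive s 1 (fun s => f s - g t * s) (g s + h s - g t * 1).
  move=> s0.
  exact: (is_derive_sub (df s s0) (@is_derive_scale _ id s (g t) 1 (is_derive_id _ _))).
move=> H; have {H} : `|f (t + eta) - g t * (t + eta) - (f t - g t * t)| <= e / 2 * (t + eta - t).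
  apply: H => s /andP[ts st].
  - by apply: is_derive_continuous (dphi s _); lra.
  - by apply: dphi; lra.
  - have s0 : 0 < s by lra.
    have := gL s t s0 t0; rewrite /time_dist (gtr0_norm (_ : 0 < s - t)) ?subr_gt0// => h1.
    have h2 : L * (s - t) <= L * eta by rewrite ler_wpM2l//; lra.
    have h3 := HT1 s (le_trans tT1 (ltW ts)).
    have -> : g s + h s - g t * 1 = (g s - g t) + h s by ring.
    rewrite (le_trans (ler_normD _ _))//; lra.
have h4 := HT2 (t + eta) t (le_trans tT2 tt) tT2.
have -> : f (t + eta) - g t * (t + eta) - (f t - g t * t)
  = (f (t + eta) - f t) - g t * eta by ring.
rewrite (addrC t) addrK => h5; rewrite (addrC eta) in h5.
rewrite -(ler_pM2r eta0) -[X in _ * X <= _](gtr0_norm eta0) -normrM.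
have -> : g t * eta = (f (t + eta) - f t) - ((f (t + eta) - f t) - g t * eta) by ring.
rewrite (le_trans (ler_normB _ _))//.
have := mulr_gt0 e0 eta0; lra.
Qed.

End Vanishing.

(** Asymptotics of a solution x of the closed-loop equation along which links,
    velocities and filter rates are bounded, with D the derivative of the
    potential with respect to the squared distance. *)
Section Convergence.
Context {R : realType} {N n : nat}.
Variables (r : R) (E : rel 'I_N) (S : 'I_N -> euler_lagrange R n).
Variables (psi : R -> \bar R) (c kappa : 'I_N -> R).
Variables (D : R -> R) (LD m rho B : R) (x : R -> @coords N n -> R).
Hypothesis elS : forall i, el_properties (S i).
Hypothesis symE : symmetric E.
Hypothesis connE : graph_connected E.
Hypothesis c0 : forall i, 0 < c i.
Hypothesis kappa0 : forall i, 0 < kappa i.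
Hypothesis D_lip : forall a b, `|D a - D b| <= LD * `|a - b|.
Hypothesis m0 : 0 < m.
Hypothesis D_ge : forall a, m <= D a.
Hypothesis xS : forall T, solves (field E S c kappa D) T x.
Hypothesis reg : forall t, 0 <= t -> regular r E psi D (pos_of (x t)).
Hypothesis links : forall t i j, 0 <= t -> E i j ->
  enorm (pos_of (x t) j - pos_of (x t) i) <= rho.
Hypothesis vB : forall t i, 0 <= t -> enorm (vel_of (x t) i) <= B.
Hypothesis wB : forall t i, 0 <= t -> enorm (filt_rate kappa (x t) i) <= B.
Hypothesis V_ge0 : forall t, 0 <= t -> 0 <= energy E S psi c kappa (x t).

Notation q t := (pos_of (x t)).
Notation v t := (vel_of (x t)).
Notation w t := (filt_rate kappa (x t)).
Notation bl := (bounded_lipschitz positive_times time_dist).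

Let horizon (t : R) : 0 < t -> 0 < t < t + 1.
Proof. by move=> ->; rewrite ltrDl ltr01. Qed.

Let vkB (t : R) i k : 0 < t -> `|v t i k 0| <= B.
Proof. by move=> t0; rewrite (le_trans (coord_le_enorm _ _))// vB// ltW. Qed.

Let wkB (t : R) i k : 0 < t -> `|w t i k 0| <= B.
Proof. by move=> t0; rewrite (le_trans (coord_le_enorm _ _))// wB// ltW. Qed.

Let B0 : 'I_N -> 0 <= B.
Proof. by move=> i; apply: le_trans (vB i (lexx 0)); exact: enorm_ge0. Qed.

Let bl_w i k : bl (fun t => w t i k 0).
Proof.
apply: (@bl_derive _ _ (fun t => - w t i k 0 + kappa i * v t i k 0) B (B + kappa i * B)).
- by move=> t t0; apply: (is_derive_filt_rate (xS (t + 1))); exact: horizon.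
- by move=> t t0; exact: wkB.
- move=> t t0; rewrite (le_trans (ler_normD _ _))// normrN normrM (gtr0_norm (kappa0 i)).
  by rewrite lerD ?wkB// ler_wpM2l ?vkB// ltW.
Qed.

Let bl_link i j k : E i j -> bl (fun t => (q t i - q t j) k 0).
Proof.
move=> Eij.
apply: (@bl_derive _ _ (fun t => v t i k 0 - v t j k 0) rho (B + B)).
- move=> t t0; have -> : (fun t => (q t i - q t j) k 0) = (fun t => q t i k 0 - q t j k 0).
    by apply/funext => s; rewrite !mxE.
  by apply: is_derive_sub; apply: (is_derive_pos (xS (t + 1))); exact: horizon.
- move=> t t0; rewrite (le_trans (coord_le_enorm _ _))// links ?ltW//.
  by rewrite symE.
- by move=> t t0; rewrite (le_trans (ler_normB _ _))// lerD// vkB.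
Qed.

Let bl_pull i k : bl (fun t => pull E D (q t) i k 0).
Proof.
apply: (@bl_ext _ _ _ _ (fun t => \sum_(j | E i j)
   (2 * D (sqnorm (q t j - q t i))) * (q t i - q t j) k 0)).
  by move=> t _; rewrite /pull summxE; apply: eq_bigr => j _; rewrite !mxE.
apply: bl_sum => // j Eij; apply: bl_mul => //; last exact: bl_link.
apply: bl_scale => //; apply: (bl_lip_comp D_lip).
have Eji : E j i by rewrite symE.
by apply: bl_sum => // l _; apply: bl_mul => //; exact: bl_link.
Qed.

Let coriolisB i : exists2 Cb : R, 0 <= Cb & forall t k l, 0 < t ->
  `|coriolis (S i) (q t i) (v t i) k l| <= Cb.
Proof.
have [cb cb0 H] := el_coriolis_bound (elS i).
exists (cb * B); first by rewrite mulr_ge0 ?(ltW cb0)// B0.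
move=> t k l t0.
have := coord_le_enorm (coriolis (S i) (q t i) (v t i) *m (delta_mx l 0 : 'cV[R]_n)) k.
rewrite -colE mxE => /le_trans; apply; rewrite colE.
apply: (le_trans (H _ _ _)).
have -> : enorm (delta_mx l 0 : 'cV[R]_n) = 1.
  rewrite /enorm (bigD1 l)//= mxE !eqxx big1 ?addr0 ?expr1n ?sqrtr1// => k' kl.
  by rewrite mxE (negbTE kl) expr0n.
by rewrite mulr1 ler_wpM2l ?vB ?ltW.
Qed.

Let bl_v i k : bl (fun t => v t i k 0).
Proof.
have [Cb Cb0 HC] := coriolisB i.
have [lam lam0 cM] := inertia_coercive elS i.
have /choice[P HP] (l : 'I_n) := bl_bounded (bl_pull i l).
pose M := lam^-1 * \sum_l (c i * P l + kappa i * B + \sum_(l' < n) Cb * B).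
apply: (@bl_derive _ _ (fun t => acc E S c kappa D (x t) i k 0) B M).
- by move=> t t0; apply: (is_derive_vel (xS (t + 1))); exact: horizon.
- by move=> t t0; exact: vkB.
- move=> t t0.
  apply: (le_trans (coercive_bound lam0 (cM _) (inertia_acc E c kappa D elS (x t) i) k)).
  rewrite ler_wpM2l ?invr_ge0 ?(ltW lam0)//; apply: ler_sum => l _.
  have -> : acc_rhs E S c kappa D (x t) i l 0 = - (c i * pull E D (q t) i l 0)
     - kappa i * w t i l 0 - \sum_l' coriolis (S i) (q t i) (v t i) l l' * v t i l' 0.
    by rewrite /acc_rhs !mxE.
  rewrite (le_trans (ler_normB _ _))// lerD//.
    rewrite (le_trans (ler_normB _ _))// normrN !normrM.
    rewrite (gtr0_norm (c0 i)) (gtr0_norm (kappa0 i)) lerD//.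
      by rewrite ler_wpM2l ?HP// ltW.
    by rewrite ler_wpM2l ?wkB// ltW.
  rewrite (le_trans (ler_norm_sum _ _ _))//; apply: ler_sum => l' _.
  by rewrite normrM ler_pM// ?HC// vkB.
Qed.

(* The energy is nonincreasing and nonnegative, hence converges; its derivative
   is minus the dissipation. *)
Let w_vanishes i k : vanishes (fun t => w t i k 0).
Proof.
have dis : vanishes (fun t => - dissipation c kappa (x t)).
  apply: (@barbalat _ (fun t => energy E S psi c kappa (x t)) _ (fun=> 0)).
  - move=> t t0; rewrite addr0.
    by apply: (is_derive_energy elS symE c0 (xS (t + 1))); [exact: horizon|apply: reg; exact: ltW].
  - apply: bl_opp; apply: bl_sum => j _; apply: bl_scale.
    by apply: bl_sum => l _; apply: bl_mul; exact: bl_w.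
  - exact: vanishes0.
  - apply: nonincreasing_settles => [s t s0 st|t t0]; last exact: V_ge0.
    apply: (energy_nonincreasing elS symE c0 (xS (t + 1))) => //.
      by rewrite ltrDl ltr01.
    by move=> t' /andP[t'0 _]; exact: reg.
apply: vanishes_sqr.
apply: (@vanishes_le _ _ (fun t => c i * (- dissipation c kappa (x t))) 0);
  last exact: vanishes_scale.
move=> t t0; rewrite normrX real_normK ?num_real// normrM normrN.
rewrite (gtr0_norm (c0 i)) ger0_norm; last exact: dissipation_ge0.
rewrite -ler_pdivrMl// /dissipation (bigD1 i)//= -[X in X <= _]addr0 lerD//.
  rewrite ler_wpM2l ?invr_ge0 ?(ltW (c0 i))// /sqnorm (bigD1 k)//= lerDl.
  by apply: sumr_ge0 => l _; exact: sqr_ge0.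
by apply: sumr_ge0 => j _; rewrite mulr_ge0 ?sqnorm_ge0// invr_ge0 ltW.
Qed.

(* The derivative of w is kappa v up to the vanishing term - w. *)
Let v_vanishes i k : vanishes (fun t => v t i k 0).
Proof.
have H : vanishes (fun t => kappa i * v t i k 0).
  apply: (@barbalat _ (fun t => w t i k 0) _ (fun t => - w t i k 0)).
  - move=> t t0; rewrite addrC.
    by apply: (is_derive_filt_rate (xS (t + 1))); exact: horizon.
  - by apply: bl_scale; exact: bl_v.
  - by apply: vanishes_opp; exact: w_vanishes.
  - by apply: vanishes_settles; exact: w_vanishes.
have := vanishes_scale (kappa i)^-1 H; apply: (@vanishes_le _ _ _ 0) => t _.
by rewrite mulrA mulVf ?mul1r// gt_eqF.
Qed.

(* By polarization, the quadratic bounds on the inertia matrix bound its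
   entries. *)
Let inertiaB i : exists lM : R, forall p k l, `|inertia (S i) p k l| <= lM.
Proof.
have [l1 [l2 [l10 l20 H]]] := el_bounds (elS i); exists (2 * l2) => p k l.
have [lo hi] := H p; set M := inertia (S i) p in lo hi *.
pose e (k : 'I_n) : 'cV[R]_n := delta_mx k 0.
have quad (y : 'cV[R]_n) : 0 <= dot y (M *m y) <= l2 * dot y y.
  have sc (a : R) : (y^T *m a%:M *m y) 0 0 = a * dot y y.
    by rewrite mul_mx_scalar -scalemxAl mxE row_colE.
  have := lo y; have := hi y; rewrite !sc -mulmxA row_colE -/(dot _ _).
  move=> h1 h2; rewrite h1 andbT; apply: le_trans h2.
  by rewrite mulr_ge0 ?(ltW l10)//; exact: sqnorm_ge0.
have ee (a b : 'I_n) : dot (e a) (e b) = (a == b)%:R.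
  rewrite /dot (bigD1 a)//= [e a a 0]mxE !eqxx mul1r big1 ?addr0 => [|j ja].
    by rewrite mxE eqxx andbT.
  by rewrite [e a j 0]mxE (negbTE ja) mul0r.
have eM (a b : 'I_n) : dot (e a) (M *m e b) = M a b.
  rewrite -colE /dot (bigD1 a)//= [e a a 0]mxE !eqxx mul1r big1 ?addr0 ?mxE// => j ja.
  by rewrite [e a j 0]mxE (negbTE ja) mul0r.
have symM : M l k = M k l by have /matrixP/(_ k l) := el_sym (elS i) p; rewrite mxE.
have hk := quad (e k); have hl := quad (e l).
have := quad (e k + e l).
rewrite mulmxDr !dotDr ![dot (_ + _) _]dotC !dotDr.
rewrite [dot (M *m e k) _]dotC [dot (M *m e k) _]dotC [dot (M *m e l) _]dotC [dot (M *m e l) _]dotC.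
move: hk hl; rewrite !eM !ee !eqxx symM [l == k]eq_sym.
case: (k == l); rewrite /= ?mulr1n ?mulr0n => /andP[? ?] /andP[? ?] /andP[? ?];
  rewrite ler_norml; apply/andP; split; lra.
Qed.

(* The momentum M(q) v vanishes.  Its derivative (C + C^T) v + M v' is
   - c pull + C^T v - kappa w, where all terms but the first vanish. *)
Let pull_vanishes i k : vanishes (fun t => pull E D (q t) i k 0).
Proof.
have [lM HM] := inertiaB i; have [Cb Cb0 HC] := coriolisB i.
pose p t := \sum_l inertia (S i) (q t i) k l * v t i l 0.
pose h t := \sum_l coriolis (S i) (q t i) (v t i) l k * v t i l 0 - kappa i * w t i k 0.
have H : vanishes (fun t => - (c i * pull E D (q t) i k 0)).
  apply: (@barbalat _ p _ h).
  - move=> t t0.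
    pose C := coriolis (S i) (q t i) (v t i); pose a := acc E S c kappa D (x t) i.
    have dq : is_derive t 1 (fun s => q s i) (v t i).
      apply: is_derive_mx => l j; rewrite ord1.
      by apply: (is_derive_pos (xS (t + 1))); exact: horizon.
    have dM : is_derive t 1 (fun s => inertia (S i) (q s i)) (C + C^T).
      have := is_derive_chain (el_smooth_inertia (elS i) [::] (q t i)) dq.
      by rewrite inertia_derivative.
    have -> : - (c i * pull E D (q t) i k 0) + h t
      = \sum_l ((C + C^T) k l * v t i l 0 + inertia (S i) (q t i) k l * a l 0).
      have := congr1 (fun y : 'cV[R]_n => y k 0) (inertia_acc E c kappa D elS (x t) i).
      rewrite mxE big_split/= => ->.
      have -> : \sum_l (C + C^T) k l * v t i l 0
        = \sum_l C k l * v t i l 0 + \sum_l C l k * v t i l 0.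
        by rewrite -big_split; apply: eq_bigr => l _ /=; rewrite !mxE mulrDl.
      have -> : acc_rhs E S c kappa D (x t) i k 0 = - (c i * pull E D (q t) i k 0)
         - kappa i * w t i k 0 - \sum_l C k l * v t i l 0.
        by rewrite /acc_rhs !mxE.
      by rewrite /h -/C; ring.
    apply: is_derive_bigsum => l _; apply: is_derive_mul.
      exact: is_derive_entry dM.
    by apply: (is_derive_vel (xS (t + 1))); exact: horizon.
  - by apply: bl_opp; apply: bl_scale; exact: bl_pull.
  - apply: vanishes_add; last by apply: vanishes_opp; apply: vanishes_scale; exact: w_vanishes.
    apply: vanishes_sum => l _; apply: (@vanishes_mul _ _ _ Cb 1); last exact: v_vanishes.
    by move=> t t1; apply: HC; lra.
  - apply: vanishes_settles; apply: vanishes_sum => l _.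
    by apply: (@vanishes_mul _ _ _ lM 0); [|exact: v_vanishes].
have := vanishes_scale (c i)^-1 H; apply: (@vanishes_le _ _ _ 0) => t _.
by rewrite mulrN normrN mulrA mulVf ?mul1r// gt_eqF.
Qed.

Let offset_bounded i j : exists b : R, forall t k, 0 < t -> `|(q t i - q t j) k 0| <= b.
Proof.
apply: (connect_rel_ind (E := E) (P := fun i j => exists b : R, forall t k, 0 < t ->
  `|(q t i - q t j) k 0| <= b)); last exact: connE.
- by move=> i'; exists 0 => t k _; rewrite subrr mxE normr0.
- move=> i' j' l Eij [b Hb]; exists (rho + b) => t k t0.
  have -> : (q t i' - q t l) k 0 = (q t i' - q t j') k 0 + (q t j' - q t l) k 0.
    by rewrite !mxE; ring.
  rewrite (le_trans (ler_normD _ _))// lerD ?Hb//.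
  by rewrite (le_trans (coord_le_enorm _ _))// links ?ltW// symE.
Qed.

(* The pulls paired with the offsets from a fixed agent sum up to a combination
   of the squared lengths of the links with coefficients at least m. *)
Let link_vanishes i j k : E i j -> vanishes (fun t => (q t i - q t j) k 0).
Proof.
move=> Eij.
have H : vanishes (fun t => \sum_i' dot (q t i' - q t i) (pull E D (q t) i')).
  apply: vanishes_sum => i' _; apply: vanishes_sum => l _.
  have [b Hb] := offset_bounded i' i.
  apply: (@vanishes_mul _ _ _ b 1); last exact: pull_vanishes.
  by move=> t t1; apply: Hb; lra.
apply: vanishes_sqr.
have := vanishes_scale m^-1 H; apply: (@vanishes_le _ _ _ 0) => t _.
have S0 i' j' : E i' j' -> 0 <= (2 * D (sqnorm (q t j' - q t i'))) *
    dot (q t i' - q t j') ((q t i' - q t i) - (q t j' - q t i)).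
  move=> _; rewrite mulr_ge0//; first by rewrite mulr_ge0// (le_trans _ (D_ge _))// ltW.
  have -> : q t i' - q t i - (q t j' - q t i) = q t i' - q t j' by rewrite opprB addrA subrK.
  exact: sqnorm_ge0.
have := @edge_sum_by_parts R N n E symE (fun i' j' => 2 * D (sqnorm (q t j' - q t i')))
  (q t) (fun i' => q t i' - q t i).
have sy i' j' : 2 * D (sqnorm (q t j' - q t i')) = 2 * D (sqnorm (q t i' - q t j')).
  by rewrite -sqnormN opprB.
  move=> /(_ sy) HS; set G := \sum_i' _.
  have {}HS : 2 * G = _ := esym HS.
  have GE : 0 <= m^-1 * G /\ (q t i - q t j) k 0 ^+ 2 <= m^-1 * G.
    have lower : 2 * D (sqnorm (q t j - q t i)) * sqnorm (q t i - q t j) <= 2 * G.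
      rewrite HS (bigD1 i)//= (bigD1 j)//= -addrA.
      have -> : q t i - q t i - (q t j - q t i) = q t i - q t j by rewrite subrr sub0r opprB.
      rewrite lerDl addr_ge0//.
        by apply: sumr_ge0 => j' /andP[Eij' _]; exact: S0.
      by apply: sumr_ge0 => i' _; apply: sumr_ge0 => j' Eij'; exact: S0.
    have sk : (q t i - q t j) k 0 ^+ 2 <= sqnorm (q t i - q t j).
      rewrite /sqnorm (bigD1 k)//= lerDl.
      by apply: sumr_ge0 => l _; exact: sqr_ge0.
    have mD : m * sqnorm (q t i - q t j) <= D (sqnorm (q t j - q t i)) * sqnorm (q t i - q t j).
      by rewrite ler_wpM2r ?sqnorm_ge0.
    have mG : m * sqnorm (q t i - q t j) <= G by lra.
    have : sqnorm (q t i - q t j) <= m^-1 * G by rewrite mulrC ler_pdivlMr// mulrC.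
    have := sqr_ge0 ((q t i - q t j) k 0); lra.
  case: GE => G0 h; rewrite ger0_norm ?sqr_ge0// ger0_norm//.
Qed.

Theorem solution_consensus i j k : vanishes (fun t => (q t i - q t j) k 0).
Proof.
apply: (connect_rel_ind (E := E) (P := fun i j => vanishes (fun t => (q t i - q t j) k 0)));
  last exact: connE.
- move=> i'; have -> : (fun t => (q t i' - q t i') k 0) = (fun=> 0).
    by apply/funext => t; rewrite subrr mxE.
  exact: vanishes0.
- move=> i' j' l Eij H.
  have -> : (fun t => (q t i' - q t l) k 0)
    = (fun t => (q t i' - q t j') k 0 + (q t j' - q t l) k 0).
    by apply/funext => t; rewrite !mxE; ring.
  by apply: vanishes_add => //; exact: link_vanishes.
Qed.

End Convergence.

(** * Connectivity-preserving consensus *)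

Section Consensus.
Context {R : realType} {N n : nat}.
Variables (r : R) (E : rel 'I_N) (S : 'I_N -> euler_lagrange R n).
Variables (psi : R -> \bar R) (Psimax : \bar R) (q0 v0 : 'I_N -> 'cV[R]_n).
Hypothesis r0 : 0 < r.
Hypothesis elS : forall i, el_properties (S i).
Hypothesis gp : generalized_potential n E r psi Psimax.
Hypothesis symE : symmetric E.
Hypothesis connE : graph_connected E.
Hypothesis links0 : forall i j, E i j -> enorm (q0 j - q0 i) < r.

(** Twice the initial kinetic energy of agent i. *)
Definition initial_kinetic i : R := dot (v0 i) (inertia (S i) (q0 i) *m v0 i).

(** The filters start at rest, so they do not contribute to the initial
    energy. *)
Lemma initial_energy (c kappa : 'I_N -> R) :
  energy E S psi c kappa (initial_state kappa q0 v0)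
  = \sum_i (c i)^-1 * (2^-1 * initial_kinetic i) + potential E psi q0.
Proof.
rewrite /energy; congr (_ + _); last by congr potential; apply/funext => i; exact: pos_ofK.
apply: eq_bigr => i _.
rewrite /kinetic pos_ofK vel_ofK /filt_rate pos_ofK filt_ofK addNr.
suff -> : sqnorm (0 : 'cV[R]_n) = 0 by rewrite mulr0 addr0.
by rewrite /sqnorm big1// => k _; rewrite mxE expr0n.
Qed.

Lemma initial_kinetic_ge0 i : 0 <= initial_kinetic i.
Proof.
have [lam lam0 cM] := inertia_coercive elS i.
rewrite /initial_kinetic /dot -row_colE mulmxA; apply: le_trans (cM _ _).
by rewrite mulr_ge0 ?(ltW lam0)//; exact: sqnorm_ge0.
Qed.

(** The result for any gains such that the initial energy is below Psimax. *)
Theorem consensus_of_initial_energy (c kappa : 'I_N -> R) :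
  (forall i, 0 < c i) -> (forall i, 0 < kappa i) ->
  ((energy E S psi c kappa (initial_state kappa q0 v0))%:E < Psimax)%E ->
  connectivity_preserving_consensus r E S psi c kappa q0 v0.
Proof.
move=> c0 kappa0 V0_lt.
have [d1 [d2 [d1P d2P cd2 d1_gt0]]] := gp_C2 gp.
have [rho rho_r margin] := link_margin r0 gp V0_lt.
have /andP[rho0 rhor] := rho_r.
have rho'_r : 0 <= (rho + r) / 2 < r by apply/andP; split; lra.
split.
- exact: (closed_loop_exists r0 elS gp symE c0 links0 d1P d2P cd2 rho_r margin).
- move=> T x T0 L.
  have [y Ly] := closed_loop_exists r0 elS gp symE c0 links0 d1P d2P cd2 rho_r margin.
  exists y => // t i t0 tT.
  have := closed_loop_unique r0 elS gp symE c0 links0 d1P d2P cd2 rho_r margin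
    Ly L t0 (ltry t) tT.
  rewrite !traj_stateE// => e; split.
  + have := congr1 (fun s => pos_of s i) e; by rewrite !pos_ofK.
  + have := congr1 (fun s => vel_of s i) e; by rewrite !vel_ofK.
  + have := congr1 (fun s => filt_of s i) e; by rewrite !filt_ofK.
- move=> tr L.
  have links t i j : 0 <= t -> E i j -> enorm (pos tr t j - pos tr t i) <= rho.
    move=> t0; exact: (closed_loop_links r0 elS symE c0 links0 d1P rho_r margin L t0 (ltry t)).
  split=> [t t0 i j Eij|i j].
    rewrite -enormN opprB; exact: le_lt_trans (links t i j t0 Eij) rhor.
  pose x := traj_state tr.
  have posx t k : 0 <= t -> pos_of (x t) k = pos tr t k.
    by move=> t0; rewrite /x traj_stateE// pos_ofK.
  have xlinks t k l : 0 <= t -> E k l -> enorm (pos_of (x t) l - pos_of (x t) k) <= rho.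
    by move=> t0 Ekl; rewrite !posx// links.
  have xS T := closed_loop_solves_frozen r0 elS symE c0 links0 d1P rho_r margin L (leey T%:E).
  have reg t : 0 <= t -> regular r E psi (dfrozen r d1 rho) (pos_of (x t)).
    move=> t0; apply: (short_frozen_regular r0 d1P rho_r) => k l Ekl.
    by apply: le_lt_trans (xlinks t k l t0 Ekl) _; lra.
  have xr t k l : 0 <= t -> E k l -> enorm (pos_of (x t) l - pos_of (x t) k) < r.
    by move=> t0 Ekl; exact: le_lt_trans (xlinks t k l t0 Ekl) rhor.
  have Vle t : 0 <= t ->
      energy E S psi c kappa (x t) <= energy E S psi c kappa (initial_state kappa q0 v0).
    move=> t0; apply: (@solution_energy _ _ _ r _ _ _ _ _ _ _ elS symE c0 _ (t + 1) x (xS _)).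
    + exact: traj_state0 L.
    + by move=> s /andP[s0 _]; exact: reg.
    + by rewrite t0 ltrDl ltr01.
  have [B HB] := @energy_bounds R N n r E S psi Psimax c kappa q0 v0 elS gp c0.
  have [LD _ HLD] := dtrunc_lipschitz d2P cd2 rho'_r.
  have [m m0 Hm] := dtrunc_lower_bound d2P d1_gt0 rho'_r.
  have V k : vanishes (fun t => (pos_of (x t) i - pos_of (x t) j) k 0).
    apply: (solution_consensus elS symE connE c0 kappa0 HLD m0 Hm xS reg xlinks (B := B)).
    + by move=> t l t0; case: (HB (x t) (fun k l => @xr t k l t0) (Vle t t0) l).
    + by move=> t l t0; case: (HB (x t) (fun k l => @xr t k l t0) (Vle t t0) l).
    + move=> t t0; apply: le_trans (potential_le_energy E psi kappa elS c0 _).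
      by apply: (potential_ge0 gp) => k' l; exact: xr.
  apply/cvgrPdist_le => e e0.
  near=> t; rewrite sub0r normrN /Num.Def.normr/= mx_normrE (bigmax_le _ (ltW e0))//= => -[k l] _.
  rewrite ord1; move: k {l}; near: t.
  apply: (@filter_forall _ _ (fun k t => `|(pos tr t i - pos tr t j) k 0| <= e)) => k.
  have [T HT] := V k e e0.
  have : \forall t \near +oo, Num.max 0 T <= t by apply: nbhs_pinfty_ge; exact: num_real.
  by apply: filterS => t; rewrite ge_max => /andP[t0 tT]; rewrite -!posx//; exact: HT.
Unshelve. all: by end_near. Qed.

End Consensus.

Theorem mainTheorem5 (R : realType) (N n : nat) (r : R) (E : rel 'I_N)
    (S : 'I_N -> euler_lagrange R n)
    (psi : R -> \bar R) (Psimax : \bar R)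
    (q0 v0 : 'I_N -> 'cV[R]_n) :
  0 < r ->
  (forall i, el_properties (S i)) ->
  generalized_potential n E r psi Psimax ->
  undirected E ->
  graph_connected E ->
  (exists2 eps : R, 0 < eps &
     forall i j, E i j -> enorm (q0 j - q0 i) <= r - eps) ->
  (total_potential E psi q0 < Psimax)%E ->
  (Psimax = +oo%E ->
     forall c kappa : 'I_N -> R,
       (forall i, 0 < c i) -> (forall i, 0 < kappa i) ->
       connectivity_preserving_consensus r E S psi c kappa q0 v0) /\
  ((Psimax < +oo)%E ->
     exists cmin : R, forall c kappa : 'I_N -> R,
       (forall i, 0 < c i) -> (forall i, 0 < kappa i) ->
       (forall i, cmin <= c i) ->
       connectivity_preserving_consensus r E S psi c kappa q0 v0).
Proof.
move=> r0 elS gp [symE _] connE [eps eps0 links_eps] pot_lt.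
have links0 i j : E i j -> enorm (q0 j - q0 i) < r.
  by move=> Eij; have := links_eps i j Eij; lra.
have potE := total_potentialE gp links0.
split=> [Pmax c kappa c0 kappa0|Pfin].
  apply: (consensus_of_initial_energy r0 elS gp symE connE links0 c0 kappa0).
  by rewrite Pmax ltry.
have [P PE] : exists P : R, Psimax = P%:E.
  move: Pfin (gp_max_gt0 gp); case: (Psimax) => [P _ _|//|//]; by exists P.
move: pot_lt; rewrite potE PE lte_fin => pot_lt.
pose K := \sum_i 2^-1 * initial_kinetic S q0 v0 i.
pose gap := P - potential E psi q0.
have gap0 : 0 < gap by rewrite subr_gt0.
have K0 : 0 <= K.
  by apply: sumr_ge0 => i _; rewrite mulr_ge0// initial_kinetic_ge0.
(* Gains of at least cmin weigh the initial kinetic energy down to less than the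
   gap. *)
pose cmin := K / gap + 1; exists cmin => c kappa c0 kappa0 cminc.
have cmin0 : 0 < cmin by rewrite ltr_wpDl// divr_ge0// ltW.
apply: (consensus_of_initial_energy r0 elS gp symE connE links0 c0 kappa0).
rewrite PE lte_fin initial_energy -ltrBrDr -/gap.
apply: (@le_lt_trans _ _ (cmin^-1 * K)).
  rewrite mulr_sumr; apply: ler_sum => i _.
  by rewrite ler_wpM2r ?lef_pV2 ?posrE// mulr_ge0// initial_kinetic_ge0.
rewrite mulrC ltr_pdivrMr// /cmin mulrDr mulr1 mulrC divfK ?gt_eqF//.
by rewrite ltrDl.
Qed.
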